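(* For every expansion proof $\mathcal{P}$ there is a cut-free expansion proof $\mathcal{P}^*$ with $\mathrm{Sh}(\mathcal{P})=\mathrm{Sh}(\mathcal{P}^* )$ and $\mathcal{P}\rightarrow\mathcal{P}^*$.
   Context: Classical first-order logic; formulas in negation normal form, $\overline{A}$ the de Morgan dual, a literal is an atom or negated atom; a sequent is a finite set of formulas. Expansion trees $E$ and shallow formula $\mathrm{Sh}(E)$: (i) a literal $L$, $\mathrm{Sh}(L)=L$; (ii) $E_1\circ E_2$ for $\circ\in\{\wedge,\vee\}$, $\mathrm{Sh}=\mathrm{Sh}(E_1)\circ\mathrm{Sh}(E_2)$; (iii) for a set of terms $\{t_1,\dots,t_n\}$ and $E_i$ with $\mathrm{Sh}(E_i)=A[x\backslash t_i]$, $\exists x\,A+^{t_1}E_1\cdots+^{t_n}E_n$ with shallow formula $\exists x\,A$; (iv) for $E_0$ with $\mathrm{Sh}(E_0)=A[x\backslash y]$, $y$ a variable, $\forall x\,A+^{y}E_0$ with shallow formula $\forall x\,A$. $+^{t_i}$ are $\exists$-expansions, $+^{y}$ a $\forall$-expansion with eigenvariable $y$; an expansion dominates all expansions in its attached subtree. Deep formula: $\mathrm{Dp}(L)=L$, $\mathrm{Dp}(E_1\circ E_2)=\mathrm{Dp}(E_1)\circ\mathrm{Dp}(E_2)$, $\mathrm{Dp}(\exists x\,A+^{t_1}E_1\cdots+^{t_n}E_n)=\bigvee_i\mathrm{Dp}(E_i)$, $\mathrm{Dp}(\forall x\,A+^{y}E_0)=\mathrm{Dp}(E_0)$. A cut is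 a set $\{E_1,E_2\}$ of expansion trees with $\mathrm{Sh}(E_1)=\overline{\mathrm{Sh}(E_2)}$; its cut-formula is the positive one (top symbol $\vee$, $\exists$, or a positive literal); $\mathrm{Dp}$ of a cut is $\mathrm{Dp}(E_1)\wedge\mathrm{Dp}(E_2)$. An expansion pre-proof $\mathcal{P}=\mathcal{C},\mathcal{E}$: a set $\mathcal{C}$ of cuts with pairwise distinct cut-formulas and a set $\mathcal{E}$ of expansion trees with pairwise distinct shallow formulas, distinct $\forall$-expansions with distinct eigenvariables, $\mathrm{Sh}(\mathcal{P}):=\mathrm{Sh}(\mathcal{E})$ without free variables; $\mathrm{Dp}(\mathcal{P})$ is the sequent $\mathrm{Dp}(\mathcal{E}),\mathrm{Dp}(\mathcal{C})$ (read disjunctively). Dependency relation $<_{\mathcal{P}}$: transitive closure of the least $<^0$ on expansions and cuts with $v<^0w$ if $w$ is an $\exists$-expansion whose term contains the eigenvariable of $\forall$-expansion $v$; $v<^0w$ if $v$ dominates $w$; $C<^0v$ if $v$ is an expansion in cut $C$; $v<^0C$ if the cut-formula of $C$ contains the eigenvariable of $\forall$-expansion $v$. An expansion proof is a pre-proof with $<_{\mathcal{P}}$ acyclic and $\mathrm{Dp}(\mathcal{P})$ a propositional tautology; cut-free if $\mathcal{C}=\emptyset$. Substitution on expansion trees (possibly creating merge nodes $\sqcup$): $L\sigma$ usual, $(E_1\circ E_2)\sigma=E_1\sigma\circ E_2\sigma$, $(\exists x\,A+^{t_1}E_1\cdots+^{t_n}E_n)\sigma=\exists x\,A\sigma+^{s_1}\bigsqcup_{t_i\sigma=s_1}E_i\sigma\cdots+^{s_k}\bigsqcup_{t_i\sigma=s_k}E_i\sigma$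 with $\{s_1,\dots,s_k\}=\{t_1\sigma,\dots,t_n\sigma\}$, $(\forall x\,A+^\beta E)\sigma=\forall x\,A\sigma+^{\beta\sigma}E\sigma$, $(E_1\sqcup E_2)\sigma=E_1\sigma\sqcup E_2\sigma$. Merge nodes are eliminated by the merge reduction ($\mathcal{P}[\,]$ a context): (1) $\mathcal{P}[L\sqcup L]\mapsto\mathcal{P}[L]$; (2) $\mathcal{P}[(E_1'\circ E_1'')\sqcup(E_2'\circ E_2'')]\mapsto\mathcal{P}[(E_1'\sqcup E_2')\circ(E_1''\sqcup E_2'')]$; (3) $\mathcal{P}[(\forall x\,A+^{\alpha_1}E_1)\sqcup(\forall x\,A+^{\alpha_2}E_2)]\mapsto\mathcal{P}[\forall x\,A+^{\alpha_1}(E_1\sqcup E_2)][\alpha_2\backslash\alpha_1]$; (4) for $E_1=\exists x\,A+^{r_1}E_{1,1}\cdots+^{r_k}E_{1,k}+^{s_1}F_1\cdots+^{s_l}F_l$, $E_2=\exists x\,A+^{r_1}E_{2,1}\cdots+^{r_k}E_{2,k}+^{t_1}G_1\cdots+^{t_m}G_m$ with $\{s_j\}\cap\{t_j\}=\emptyset$: $\mathcal{P}[E_1\sqcup E_2]\mapsto\mathcal{P}[\exists x\,A+^{r_1}(E_{1,1}\sqcup E_{2,1})\cdots+^{r_k}(E_{1,k}\sqcup E_{2,k})+^{s_1}F_1\cdots+^{s_l}F_l+^{t_1}G_1\cdots+^{t_m}G_m]$; this reduction is confluent and terminating, with normal form $\lfloor\cdot\rfloor$. For pre-proofs (possibly with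 merges) $\mathcal{P}_1\cup\mathcal{P}_2:=\lfloor\mathcal{P}_1\sqcup\mathcal{P}_2\rfloor$, where $\mathcal{P}_1\sqcup\mathcal{P}_2$ joins with $\sqcup$ trees of equal shallow formula and cuts of equal cut-formula (componentwise) and takes the union of the rest. Cut-reduction steps $\mapsto$: (quantifier) $\{\exists x\,A+^{t_1}E_1\cdots+^{t_n}E_n,\ \forall x\,\overline{A}+^{\alpha}E\},\mathcal{P}\ \mapsto\ \mathcal{P}\cup\{E_1\vee\cdots\vee E_n,\ E\eta_1[\alpha\backslash t_1]\wedge\cdots\wedge E\eta_n[\alpha\backslash t_n]\}\cup\bigcup_{i=1}^n\mathcal{P}\eta_i[\alpha\backslash t_i]$, where each $\eta_i$ renames the eigenvariables of $\mathcal{P},E$ to fresh variables; (propositional) $\{E_1\vee E_2,E_1'\wedge E_2'\},\mathcal{P}\mapsto\{E_1,E_1'\}\cup\{E_2,E_2'\}\cup\mathcal{P}$; (atomic) $\{A,\overline{A}\},\mathcal{P}\mapsto\mathcal{P}$ for an atom $A$. $\rightarrow$ is the reflexive transitive closure of $\mapsto$. *)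

(* Defs.v *)
From HB Require Import structures.
From mathcomp Require Import all_boot boolp.
From Stdlib Require Import Relation_Operators.
From Stdlib Require List.

Set Implicit Arguments.
Unset Strict Implicit.
Unset Printing Implicit Defensive.

Record signature := Signature {
  fsym : Type; farity : fsym -> nat;
  psym : Type; parity : psym -> nat }.

Definition var := nat.

(** * Terms and formulas in negation normal form *)

Inductive term (S : signature) (V : Type) : Type :=
| Var (v : V)
| App (f : fsym S) (ts : 'I_(farity f) -> term S V).
Arguments Var {S V} v.

Record atom (S : signature) (V : Type) : Type :=
  Atom { apred : psym S; aargs : 'I_(parity apred) -> term S V }.

Inductive conn := And | Or.
Inductive quant := All | Ex.

(* Free variables range over [V]. The body of a quantifier lives over
   [option V], where [None] is the bound variable, so formulas are identified
   up to renaming of bound variables and substitution cannot capture. *)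
Inductive formula (S : signature) (V : Type) : Type :=
| Lit (b : bool) (a : atom S V)  (* [Lit false a] is the negated atom *)
| Bin (c : conn) (A B : formula S V)
| Qua (q : quant) (A : formula S (option V)).

(* Symbols form arbitrary types, so equality on syntax is decided
   classically. *)
HB.instance Definition _ S V := gen_eqMixin (term S V).
HB.instance Definition _ S V := gen_eqMixin (formula S V).

Definition dual_conn c := if c is And then Or else And.
Definition dual_quant q := if q is All then Ex else All.

Fixpoint dual S V (A : formula S V) : formula S V :=
  match A with
  | Lit b a => Lit (~~ b) a
  | Bin c A B => Bin (dual_conn c) (dual A) (dual B)
  | Qua q A => Qua (dual_quant q) (dual A)
  end.

Definition positive S V (A : formula S V) : bool :=
  match A with
  | Lit b _ => b
  | Bin Or _ _ => true
  | Qua Ex _ => true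
  | _ => false
  end.

Fixpoint tsubst S V W (s : V -> term S W) (t : term S V) : term S W :=
  match t with
  | Var v => s v
  | App f ts => @App S W f (fun i => tsubst s (ts i))
  end.

Definition asubst S V W (s : V -> term S W) (a : atom S V) : atom S W :=
  @Atom S W (apred a) (fun i => tsubst s (aargs i)).

Definition lift S V W (s : V -> term S W) (o : option V) : term S (option W) :=
  if o is Some v then tsubst (fun w => Var (Some w)) (s v) else Var None.

Fixpoint fsubst S V (A : formula S V) :
    forall W, (V -> term S W) -> formula S W :=
  match A with
  | Lit b a => fun W s => Lit b (asubst s a)
  | Bin c A B => fun W s => Bin c (fsubst A s) (fsubst B s)
  | Qua q A => fun W s => Qua q (fsubst A (lift s))
  end.

(* A[x\t], where x is the variable bound by the quantifier over A. *)
Definition inst S V (A : formula S (option V)) (t : term S V) : formula S V :=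
  fsubst A (fun o => if o is Some v then Var v else t).

Fixpoint occ_term S V (x : V) (t : term S V) : Prop :=
  match t with
  | Var y => x = y
  | App f ts => exists i, occ_term x (ts i)
  end.

Definition occ_atom S V (x : V) (a : atom S V) : Prop :=
  exists i, occ_term x (@aargs S V a i).

Fixpoint occ_formula S V (x : V) (A : formula S V) : Prop :=
  match A with
  | Lit _ a => occ_atom x a
  | Bin _ A B => occ_formula x A \/ occ_formula x B
  | Qua _ A => occ_formula (Some x) A
  end.

Definition closed S V (A : formula S V) := forall x, ~ occ_formula x A.

(** * Expansion trees *)

(* Raw trees, possibly with merge nodes. The children of an ∃-node form a set
   {+^t E}, here an enumeration of it. *)
Inductive tree (S : signature) : Type :=
| TLit (b : bool) (a : atom S var)
| TBin (c : conn) (E1 E2 : tree S)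
| TEx (A : formula S (option var)) (l : seq (term S var * tree S))
| TAll (A : formula S (option var)) (y : var) (E : tree S)
| TMerge (E1 E2 : tree S).

HB.instance Definition _ S := gen_eqMixin (tree S).

Fixpoint Sh S (E : tree S) : formula S var :=
  match E with
  | TLit b a => Lit b a
  | TBin c E1 E2 => Bin c (Sh E1) (Sh E2)
  | TEx A _ => Qua Ex A
  | TAll A _ _ => Qua All A
  | TMerge E1 _ => Sh E1
  end.

(* Expansion trees proper, without merge nodes. *)
Inductive is_tree S : tree S -> Prop :=
| is_lit b a : is_tree (TLit b a)
| is_bin c E1 E2 : is_tree E1 -> is_tree E2 -> is_tree (TBin c E1 E2)
| is_ex A l :
    uniq (unzip1 l) ->
    (forall t E, (t, E) \in l -> is_tree E) ->
    (forall t E, (t, E) \in l -> Sh E = inst A t) ->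
    is_tree (TEx A l)
| is_all A y E : is_tree E -> Sh E = inst A (Var y) -> is_tree (TAll A y E).

(* Quantifier-free formulas; [QBot] is the disjunction over the empty set of
   expansions of an ∃-node. *)
Inductive qformula (S : signature) : Type :=
| QBot
| QLit (b : bool) (a : atom S var)
| QBin (c : conn) (A B : qformula S).
Arguments QBot {S}.

Fixpoint qbigor S (l : seq (qformula S)) : qformula S :=
  match l with
  | [::] => QBot
  | [:: A] => A
  | A :: l' => QBin Or A (qbigor l')
  end.

Fixpoint qeval S (v : atom S var -> bool) (A : qformula S) : bool :=
  match A with
  | QBot => false
  | QLit b a => v a == b
  | QBin And A B => qeval v A && qeval v B
  | QBin Or A B => qeval v A || qeval v B
  end.

Fixpoint Dp S (E : tree S) : qformula S :=
  match E with
  | TLit b a => QLit b a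
  | TBin c E1 E2 => QBin c (Dp E1) (Dp E2)
  | TEx _ l => qbigor [seq Dp tE.2 | tE <- l]
  | TAll _ _ E => Dp E
  | TMerge E1 E2 => QBin Or (Dp E1) (Dp E2)
  end.

Fixpoint eigenvars S (E : tree S) : seq var :=
  match E with
  | TLit _ _ => [::]
  | TBin _ E1 E2 => eigenvars E1 ++ eigenvars E2
  | TEx _ l => flatten [seq eigenvars tE.2 | tE <- l]
  | TAll _ y E => y :: eigenvars E
  | TMerge E1 E2 => eigenvars E1 ++ eigenvars E2
  end.

Fixpoint occ_tree S (x : var) (E : tree S) : Prop :=
  match E with
  | TLit _ a => occ_atom x a
  | TBin _ E1 E2 => occ_tree x E1 \/ occ_tree x E2
  | TEx A l => occ_formula (Some x) A \/
      foldr (fun tE R => [\/ occ_term x tE.1, occ_tree x tE.2 | R]) False l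
  | TAll A y E => [\/ occ_formula (Some x) A, x = y | occ_tree x E]
  | TMerge E1 E2 => occ_tree x E1 \/ occ_tree x E2
  end.

(** * Cuts and expansion proofs *)

(* In {E1, E2} with Sh(E1) dual to Sh(E2), exactly one of the shallow formulas
   is positive; its tree comes first. *)
Record cut (S : signature) : Type := Cut { cpos : tree S; cneg : tree S }.

HB.instance Definition _ S := gen_eqMixin (cut S).

Definition mk_cut S (E1 E2 : tree S) : cut S :=
  if positive (Sh E1) then Cut E1 E2 else Cut E2 E1.

Definition cut_formula S (c : cut S) : formula S var := Sh (cpos c).

Definition is_cut S (c : cut S) : Prop :=
  [/\ is_tree (cpos c), is_tree (cneg c), positive (cut_formula c)
    & Sh (cneg c) = dual (cut_formula c)].

(* Raw pre-proofs, possibly with merge nodes; both components enumerate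
   sets. *)
Record pre (S : signature) : Type :=
  Pre { cuts : seq (cut S); trees : seq (tree S) }.

Definition all_trees S (P : pre S) : seq (tree S) :=
  trees P ++ flatten [seq [:: cpos c; cneg c] | c <- cuts P].

Definition pre_eigenvars S (P : pre S) : seq var :=
  flatten [seq eigenvars E | E <- all_trees P].

Definition occ_pre S (x : var) (P : pre S) : Prop :=
  exists2 E, E \in all_trees P & occ_tree x E.

Definition pre_Sh S (P : pre S) : seq (formula S var) :=
  [seq Sh E | E <- trees P].

Definition pre_Dp S (P : pre S) : seq (qformula S) :=
  [seq Dp E | E <- trees P] ++
  [seq QBin And (Dp (cpos c)) (Dp (cneg c)) | c <- cuts P].

Definition tautology S (G : seq (qformula S)) : Prop :=
  forall v, has (qeval v) G.

Record expansion_preproof S (P : pre S) : Prop := ExpansionPreproof {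
  pp_trees : forall E, E \in trees P -> is_tree E;
  pp_cuts : forall c, c \in cuts P -> is_cut c;
  pp_cut_formulas : uniq [seq cut_formula c | c <- cuts P];
  pp_shallow : uniq (pre_Sh P);
  pp_eigenvars : uniq (pre_eigenvars P);
  pp_closed : forall A, A \in pre_Sh P -> closed A }.

(* Occurrences. A root is a tree of the pre-proof or a side of one of its cuts
   ([true] is the positive side); an expansion is addressed by the path from
   the root to its attached subtree. *)
Inductive root := InTree (i : nat) | InCut (i : nat) (side : bool).

Inductive label (S : signature) :=
| LEx (t : term S var)
| LAll (y : var).
Arguments LAll {S} y.

Inductive expansion_at S : tree S -> seq nat -> label S -> Prop :=
| at_bin1 c E1 E2 p L :
    expansion_at E1 p L -> expansion_at (TBin c E1 E2) (0 :: p) L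
| at_bin2 c E1 E2 p L :
    expansion_at E2 p L -> expansion_at (TBin c E1 E2) (1 :: p) L
| at_ex A l i t E :
    onth l i = Some (t, E) -> expansion_at (TEx A l) [:: i] (LEx t)
| at_ex_sub A l i t E p L :
    onth l i = Some (t, E) -> expansion_at E p L ->
    expansion_at (TEx A l) (i :: p) L
| at_all A y E : expansion_at (TAll A y E) [:: 0] (LAll y)
| at_all_sub A y E p L :
    expansion_at E p L -> expansion_at (TAll A y E) (0 :: p) L.

Definition root_tree S (P : pre S) (r : root) : option (tree S) :=
  match r with
  | InTree i => onth (trees P) i
  | InCut i b => omap (fun c => if b then cpos c else cneg c) (onth (cuts P) i)
  end.

Inductive node := NExp (r : root) (p : seq nat) | NCut (i : nat).

Definition expansion S (P : pre S) (r : root) (p : seq nat) (L : label S) :=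
  exists2 E, root_tree P r = Some E & expansion_at E p L.

Inductive dep0 S (P : pre S) : node -> node -> Prop :=
| dep_term r p y r' p' t :
    expansion P r p (LAll y) -> expansion P r' p' (LEx t) -> occ_term y t ->
    dep0 P (NExp r p) (NExp r' p')
| dep_dom r p q L L' :
    expansion P r p L -> expansion P r (p ++ q) L' -> q <> [::] ->
    dep0 P (NExp r p) (NExp r (p ++ q))
| dep_in_cut i b p L :
    expansion P (InCut i b) p L -> dep0 P (NCut i) (NExp (InCut i b) p)
| dep_cut_formula r p y i c :
    expansion P r p (LAll y) -> onth (cuts P) i = Some c ->
    occ_formula y (cut_formula c) ->
    dep0 P (NExp r p) (NCut i).

Definition dep S (P : pre S) : node -> node -> Prop := clos_trans node (dep0 P).

Definition expansion_proof S (P : pre S) : Prop :=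
  [/\ expansion_preproof P, forall v, ~ dep P v v & tautology (pre_Dp P)].

Definition cut_free S (P : pre S) : Prop := cuts P = [::].

(** * Substitution and merge *)

(* [collect key op l] combines with [op] the elements of [l] of equal key. *)
Fixpoint insert (T : Type) (K : eqType) (key : T -> K) (op : T -> T -> T)
    (s : seq T) (x : T) : seq T :=
  if s is y :: s' then
    if key y == key x then op y x :: s' else y :: insert key op s' x
  else [:: x].

Definition collect (T : Type) (K : eqType) (key : T -> K) (op : T -> T -> T)
    (s : seq T) : seq T := foldl (insert key op) [::] s.

Definition collect_children S : seq (term S var * tree S) -> _ :=
  collect fst (fun tE tE' => (tE.1, TMerge tE.2 tE'.2)).

Definition collect_trees S : seq (tree S) -> _ := collect (@Sh S) (@TMerge S).

Definition collect_cuts S : seq (cut S) -> _ :=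
  collect (@cut_formula S)
    (fun c c' => Cut (TMerge (cpos c) (cpos c')) (TMerge (cneg c) (cneg c'))).

Definition subst S := var -> term S var.

Definition single S (x : var) (t : term S var) : subst S :=
  fun y => if y == x then t else Var y.

(* An eigenvariable is only ever replaced by a variable; the other case is a
   dummy. *)
Definition vsubst S (s : subst S) (y : var) : var :=
  if s y is Var z then z else y.

Fixpoint esubst S (s : subst S) (E : tree S) : tree S :=
  match E with
  | TLit b a => TLit b (asubst s a)
  | TBin c E1 E2 => TBin c (esubst s E1) (esubst s E2)
  | TEx A l => TEx (fsubst A (lift s))
      (collect_children [seq (tsubst s tE.1, esubst s tE.2) | tE <- l])
  | TAll A y E => TAll (fsubst A (lift s)) (vsubst s y) (esubst s E)
  | TMerge E1 E2 => TMerge (esubst s E1) (esubst s E2)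
  end.

(* Cuts whose cut-formulas become equal are joined, as in a pre-proof
   cut-formulas are pairwise distinct. *)
Definition psubst S (s : subst S) (P : pre S) : pre S :=
  Pre (collect_cuts [seq Cut (esubst s (cpos c)) (esubst s (cneg c))
                    | c <- cuts P])
      (collect_trees [seq esubst s E | E <- trees P]).

(* The join P_1 ⊔ ... ⊔ P_n. *)
Definition join S (Ps : seq (pre S)) : pre S :=
  Pre (collect_cuts (flatten [seq cuts P | P <- Ps]))
      (collect_trees (flatten [seq trees P | P <- Ps])).

(* [merge_tree E o E']: a merge node in E is reduced, giving E'; when
   [o = Some (a2, a1)] the substitution [a2\a1] remains to be applied to the
   whole pre-proof. *)
Inductive merge_tree S : tree S -> option (var * var) -> tree S -> Prop :=
| merge_lit b a :
    merge_tree (TMerge (TLit b a) (TLit b a)) None (TLit b a)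
| merge_bin c E1 E1' E2 E2' :
    merge_tree (TMerge (TBin c E1 E1') (TBin c E2 E2')) None
               (TBin c (TMerge E1 E2) (TMerge E1' E2'))
| merge_all A a1 E1 a2 E2 :
    merge_tree (TMerge (TAll A a1 E1) (TAll A a2 E2)) (Some (a2, a1))
               (TAll A a1 (TMerge E1 E2))
| merge_ex A l1 l2 :
    merge_tree (TMerge (TEx A l1) (TEx A l2)) None
               (TEx A (collect_children (l1 ++ l2)))
| in_bin1 c E1 E2 o E1' :
    merge_tree E1 o E1' -> merge_tree (TBin c E1 E2) o (TBin c E1' E2)
| in_bin2 c E1 E2 o E2' :
    merge_tree E2 o E2' -> merge_tree (TBin c E1 E2) o (TBin c E1 E2')
| in_ex A l1 t E l2 o E' :
    merge_tree E o E' ->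
    merge_tree (TEx A (l1 ++ (t, E) :: l2)) o (TEx A (l1 ++ (t, E') :: l2))
| in_all A y E o E' :
    merge_tree E o E' -> merge_tree (TAll A y E) o (TAll A y E')
| in_merge1 E1 E2 o E1' :
    merge_tree E1 o E1' -> merge_tree (TMerge E1 E2) o (TMerge E1' E2)
| in_merge2 E1 E2 o E2' :
    merge_tree E2 o E2' -> merge_tree (TMerge E1 E2) o (TMerge E1 E2').

Definition rename_after S (o : option (var * var)) (P : pre S) : pre S :=
  if o is Some (a2, a1) then psubst (single a2 (Var a1)) P else P.

Inductive merge_step S : pre S -> pre S -> Prop :=
| merge_in_tree C T1 E T2 o E' :
    merge_tree E o E' ->
    merge_step (Pre C (T1 ++ E :: T2))
               (rename_after o (Pre C (T1 ++ E' :: T2)))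
| merge_in_cpos C1 E F C2 T o E' :
    merge_tree E o E' ->
    merge_step (Pre (C1 ++ Cut E F :: C2) T)
               (rename_after o (Pre (C1 ++ Cut E' F :: C2) T))
| merge_in_cneg C1 E F C2 T o F' :
    merge_tree F o F' ->
    merge_step (Pre (C1 ++ Cut E F :: C2) T)
               (rename_after o (Pre (C1 ++ Cut E F' :: C2) T)).

Definition normal_form S (P Q : pre S) : Prop :=
  clos_refl_trans _ (@merge_step S) P Q /\ forall R, ~ merge_step Q R.

(* [is_union Ps Q]: Q is P_1 ∪ ... ∪ P_n. *)
Definition is_union S (Ps : seq (pre S)) (Q : pre S) : Prop :=
  normal_form (join Ps) Q.

(** * Cut reduction *)

Definition only_cut S (c : cut S) : pre S := Pre [:: c] [::].

Definition renaming S (xs : seq var) (e : var -> var) : subst S :=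
  fun x => Var (if x \in xs then e x else x).

(* The etas rename xs injectively and to pairwise disjoint sets of variables
   fresh for P. *)
Definition fresh_renamings S (P : pre S) (xs : seq var)
    (etas : seq (var -> var)) : Prop :=
  uniq [seq (e : var -> var) x | e <- etas, x <- xs] /\
  forall e x, List.In e etas -> x \in xs -> ~ occ_pre (e x) P.

Fixpoint tbins S (c : conn) (E : tree S) (l : seq (tree S)) : tree S :=
  if l is E' :: l' then TBin c E (tbins c E' l') else E.

(* The cut {E_1 ∨ ... ∨ E_n, F_1 ∧ ... ∧ F_n}. For n = 0 it would be the
   trivial cut {⊥, ⊤} and is omitted. *)
Definition instance_cut S (Es Fs : seq (tree S)) : seq (pre S) :=
  match Es, Fs with
  | E :: Es', F :: Fs' => [:: only_cut (mk_cut (tbins Or E Es') (tbins And F Fs'))]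
  | _, _ => [::]
  end.

Inductive cut_step S : pre S -> pre S -> Prop :=
| step_quantifier C1 C2 T A l l' alpha E etas Q :
    let c := Cut (TEx A l) (TAll (dual A) alpha E) in
    let P := Pre (C1 ++ C2) T in
    let xs := pre_eigenvars P ++ eigenvars E in
    let sigmas := [seq (renaming S xs et.1, single alpha et.2)
                  | et <- zip etas (unzip1 l')] in
    (* l' = [:: (t_1, E_1); ...; (t_n, E_n)] is any enumeration of the set *)
    perm_eq l' l ->
    size etas = size l' ->
    fresh_renamings (Pre (C1 ++ c :: C2) T) xs etas ->
    is_union (P :: instance_cut (unzip2 l')
                     [seq esubst s.2 (esubst s.1 E) | s <- sigmas]
                ++ [seq psubst s.2 (psubst s.1 P) | s <- sigmas]) Q ->
    cut_step (Pre (C1 ++ c :: C2) T) Q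
| step_propositional C1 C2 T E1 E2 E1' E2' Q :
    is_union [:: only_cut (mk_cut E1 E1'); only_cut (mk_cut E2 E2');
                 Pre (C1 ++ C2) T] Q ->
    cut_step (Pre (C1 ++ Cut (TBin Or E1 E2) (TBin And E1' E2') :: C2) T) Q
| step_atomic C1 C2 T a :
    cut_step (Pre (C1 ++ Cut (TLit true a) (TLit false a) :: C2) T)
             (Pre (C1 ++ C2) T).

Definition cut_reduces S : pre S -> pre S -> Prop :=
  clos_refl_trans _ (@cut_step S).

(* Main.v *)
(** Acyclicity of the dependency relation amounts to the solvability of a system
    of equations that interprets every eigenvariable by a Skolem term recording
    its position: the formula at the first quantifier above it and the values of
    the terms on the way down. Merging two eigenvariables identifies variables of
    equal value, so a solution survives merge reduction, and in a normal form
    without propositional cuts a solution is injective, as the position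
    determines the eigenvariable. Reductions need not preserve acyclicity: the
    instance cut [E_1 \/ ... \/ E_n] mixes the terms [t_i]. Dependencies are
    therefore counted from the first quantifier on rather than from the whole
    cut-formula, which makes no difference once there are no cuts left.

    Propositional and atomic cuts are reduced first. Then, among the cuts of
    maximal quantifier depth, one whose formula has a value of maximal size is
    reduced. No eigenvariable occurring in a formula of maximal depth depends on
    this cut, so the copies of the other cuts of maximal depth have the same values
    as the originals. As distinct cuts have distinct values, the number of values
    of cut-formulas of maximal depth decreases. *)

From HB Require Import structures.
From mathcomp Require Import all_boot boolp zify.
From Stdlib Require Import Relation_Operators.
From Stdlib Require List.
Require Import Defs.

Set Implicit Arguments.
Unset Strict Implicit.
Unset Printing Implicit Defensive.

(* [fsubst] and [occ_formula] only apply to variables in [Set]; the generated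
   induction principle would quantify over all of [Type]. *)
Fixpoint formula_set_ind S (P : forall V : Set, formula S V -> Prop)
    (HL : forall (V : Set) b a, P V (Lit b a))
    (HB : forall (V : Set) c A, P V A -> forall B, P V B -> P V (Bin c A B))
    (HQ : forall (V : Set) q A, P (option V) A -> P V (Qua q A))
    (V : Set) (A : formula S V) : P V A :=
  match A with
  | Lit b a => HL V b a
  | Bin c A B => HB V c A (formula_set_ind HL HB HQ A)
                            B (formula_set_ind HL HB HQ B)
  | Qua q A => HQ V q A (formula_set_ind HL HB HQ A)
  end.

Lemma tsubst_comp S (V W X : Set) (s : V -> term S W) (s' : W -> term S X) t :
  tsubst s' (tsubst s t) = tsubst (fun v => tsubst s' (s v)) t.
Proof. by elim: t => [v|f ts IH] //=; congr App; apply: funext => i. Qed.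

Lemma lift_comp S (V W X : Set) (s : V -> term S W) (s' : W -> term S X) :
  (fun o => tsubst (lift s') (lift s o)) = lift (fun v => tsubst s' (s v)).
Proof. by apply: funext => -[v|] //=; rewrite !tsubst_comp. Qed.

Lemma asubst_comp S (V W X : Set) (s : V -> term S W) (s' : W -> term S X) a :
  asubst s' (asubst s a) = asubst (fun v => tsubst s' (s v)) a.
Proof.
by case: a => p ts; congr Atom; apply: funext => i /=; rewrite tsubst_comp.
Qed.

Lemma fsubst_comp S (V : Set) (A : formula S V) (W X : Set) (s : V -> term S W)
    (s' : W -> term S X) :
  fsubst (fsubst A s) s' = fsubst A (fun v => tsubst s' (s v)).
Proof.
elim/formula_set_ind: A W X s s' => {V} /= [V b a|V c A IHA B IHB|V q A IH] W X s s'.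
- by rewrite asubst_comp.
- by rewrite IHA IHB.
- by rewrite IH lift_comp.
Qed.

Lemma tsubst_id S (V : Set) (s : V -> term S V) t :
  (forall x, occ_term x t -> s x = Var x) -> tsubst s t = t.
Proof.
elim: t => [v|f ts IH] /= H; first exact: H.
by congr App; apply: funext => i; apply: IH => x Hx; apply: H; exists i.
Qed.

Lemma fsubst_id S (V : Set) (A : formula S V) (s : V -> term S V) :
  (forall x, occ_formula x A -> s x = Var x) -> fsubst A s = A.
Proof.
elim/formula_set_ind: A s => {V} /= [V b a|V c A IHA B IHB|V q A IH] s H.
- congr Lit; case: a H => p ts H; congr Atom; apply: funext => i /=.
  by apply: tsubst_id => x Hx; apply: H; exists i.
- by rewrite IHA ?IHB // => x Hx; apply: H; [right|left].
- by rewrite IH // => -[v|] //= /H ->.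
Qed.

Lemma fsubst_inst S (V W : Set) (A : formula S (option V)) t (s : V -> term S W) :
  fsubst (inst A t) s = inst (fsubst A (lift s)) (tsubst s t).
Proof.
rewrite /inst !fsubst_comp; congr fsubst; apply: funext => -[v|] //=.
by rewrite tsubst_comp tsubst_id.
Qed.

Lemma occ_tsubst S (V W : Set) z (s : V -> term S W) t :
  occ_term z (tsubst s t) -> exists2 x, occ_term x t & occ_term z (s x).
Proof.
elim: t => [v|f ts IH] /=; first by exists v.
by move=> [i /IH[x Hx Hz]]; exists x => //; exists i.
Qed.

Lemma occ_fsubst S (V : Set) (A : formula S V) (W : Set) z (s : V -> term S W) :
  occ_formula z (fsubst A s) ->
  exists2 x, occ_formula x A & occ_term z (s x).
Proof.
elim/formula_set_ind: A W z s => {V} /= [V b a|V c A IHA B IHB|V q A IH] W z s.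
- by move=> [i H]; have [x Hx Hz] := occ_tsubst H; exists x => //; exists i.
- by case=> [/(IHA W)|/(IHB W)] [x Hx Hz]; exists x => //; [left|right].
- move=> /(IH (option W))[[x|] Hx] //= H; have [y Hy [E]] := occ_tsubst H.
  by exists x => //; rewrite E.
Qed.

Lemma occ_inst S (V : Set) (A : formula S (option V)) t z :
  occ_formula z (inst A t) -> occ_formula (Some z) A \/ occ_term z t.
Proof.
move=> H; have [[x|] Hx /= Hz] := occ_fsubst H; last by right.
by rewrite Hz; left.
Qed.

Lemma dual_fsubst S (V : Set) (A : formula S V) (W : Set) (s : V -> term S W) :
  dual (fsubst A s) = fsubst (dual A) s.
Proof.
elim/formula_set_ind: A W s => {V} /= [V b a|V c A IHA B IHB|V q A IH] W s //.
- by rewrite IHA IHB.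
- by rewrite IH.
Qed.

Lemma dualK S (V : Set) (A : formula S V) : dual (dual A) = A.
Proof.
elim/formula_set_ind: A => {V} /= [V b a|V c A IHA B IHB|V q A IH].
- by rewrite negbK.
- by rewrite IHA IHB; case: c.
- by rewrite IH; case: q.
Qed.

Lemma occ_dual S (V : Set) (A : formula S V) x : occ_formula x (dual A) -> occ_formula x A.
Proof.
elim/formula_set_ind: A x => {V} //= [V c A IHA B IHB|V q A IH] x; last exact: IH.
by case=> [/IHA|/IHB]; [left|right].
Qed.

Lemma positive_fsubst S (V : Set) (A : formula S V) (W : Set) (s : V -> term S W) :
  positive (fsubst A s) = positive A.
Proof. by case: A s. Qed.

Lemma positive_dual S (V : Set) (A : formula S V) : positive (dual A) = ~~ positive A.
Proof. by case: A => [[] a|[] A B|[] A]. Qed.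

Definition is_bin S (V : Set) (A : formula S V) : bool :=
  if A is Bin _ _ _ then true else false.

Definition is_qua S (V : Set) (A : formula S V) : bool :=
  if A is Qua _ _ then true else false.

Lemma is_bin_fsubst S (V : Set) (A : formula S V) (W : Set) (s : V -> term S W) :
  is_bin (fsubst A s) = is_bin A.
Proof. by case: A s. Qed.

Lemma is_qua_fsubst S (V : Set) (A : formula S V) (W : Set) (s : V -> term S W) :
  is_qua (fsubst A s) = is_qua A.
Proof. by case: A s. Qed.

Lemma is_bin_dual S (V : Set) (A : formula S V) : is_bin (dual A) = is_bin A.
Proof. by case: A. Qed.

Lemma is_qua_dual S (V : Set) (A : formula S V) : is_qua (dual A) = is_qua A.
Proof. by case: A. Qed.

Fixpoint qdepth S (V : Set) (A : formula S V) : nat :=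
  match A with
  | Lit _ _ => 0
  | Bin _ A B => maxn (qdepth A) (qdepth B)
  | Qua _ A => (qdepth A).+1
  end.

Lemma qdepth_fsubst S (V : Set) (A : formula S V) (W : Set) (s : V -> term S W) :
  qdepth (fsubst A s) = qdepth A.
Proof.
by elim/formula_set_ind: A W s => {V} //= [V c A IHA B IHB|V q A IH] W s; rewrite ?IHA ?IHB ?IH.
Qed.

Lemma qdepth_dual S (V : Set) (A : formula S V) : qdepth (dual A) = qdepth A.
Proof.
by elim/formula_set_ind: A => {V} //= [V c A IHA B IHB|V q A IH]; rewrite ?IHA ?IHB ?IH.
Qed.

(** * Values *)

Inductive val (S : signature) : Type :=
| VVar (x : var)
| VBd (k : nat)
| VApp (f : fsym S) (ts : seq (val S))
| VLit (b : bool) (p : psym S) (ts : seq (val S))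
| VBin (c : conn) (v w : val S)
| VQua (q : quant) (v : val S)
| VTree (v : val S)
| VTag (b : bool)
| VRoot (p : option (val S)) (v : val S)
| VL (m : val S)
| VR (m : val S)
| VEx (m t : val S)
| VAll (m : val S).
Arguments VVar {S} x.
Arguments VBd {S} k.
Arguments VTag {S} b.

HB.instance Definition _ S := gen_eqMixin (val S).

Fixpoint vsize S (v : val S) : nat :=
  match v with
  | VVar x => x.+1
  | VBd _ | VTag _ => 1
  | VApp _ ts | VLit _ _ ts => (sumn (map (@vsize S) ts)).+1
  | VBin _ v w | VEx v w => (vsize v + vsize w).+1
  | VRoot p v => (oapp (@vsize S) 0 p + vsize v).+1
  | VQua _ v | VTree v | VL v | VR v | VAll v => (vsize v).+1
  end.

Fixpoint tsem S (V : Set) (r : V -> val S) (t : term S V) : val S :=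
  match t with
  | Var v => r v
  | App f ts => VApp f [seq tsem r (ts i) | i <- enum 'I_(farity f)]
  end.

Definition vlift S (V : Set) (k : nat) (r : V -> val S) (o : option V) : val S :=
  if o is Some v then r v else VBd k.

Fixpoint fsem S (V : Set) (k : nat) (r : V -> val S) (A : formula S V) : val S :=
  match A with
  | Lit b a =>
      VLit b (apred a) [seq tsem r (aargs i) | i <- enum 'I_(parity (apred a))]
  | Bin c A B => VBin c (fsem k r A) (fsem k r B)
  | Qua q A => VQua q (fsem k.+1 (vlift k r) A)
  end.

Definition scomp S (V W : Set) (r : W -> val S) (s : V -> term S W) : V -> val S :=
  fun x => tsem r (s x).

Lemma tsem_tsubst S (V W : Set) (r : W -> val S) (s : V -> term S W) t :
  tsem r (tsubst s t) = tsem (scomp r s) t.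
Proof. by elim: t => [v|f ts IH] //=; congr VApp; apply: eq_map. Qed.

Lemma fsem_fsubst S (V : Set) (A : formula S V) (W : Set) k (r : W -> val S)
    (s : V -> term S W) :
  fsem k r (fsubst A s) = fsem k (scomp r s) A.
Proof.
elim/formula_set_ind: A W k r s => {V} /= [V b a|V c A IHA B IHB|V q A IH] W k r s.
- by case: a => p ts /=; congr VLit; apply: eq_map => i; rewrite tsem_tsubst.
- by rewrite IHA IHB.
- rewrite IH; congr (VQua _ (fsem _ _ _)); apply: funext => -[v|] //=.
  by rewrite /scomp /= tsem_tsubst.
Qed.

Lemma tsem_ext S (V : Set) (r1 r2 : V -> val S) t :
  (forall x, occ_term x t -> r1 x = r2 x) -> tsem r1 t = tsem r2 t.
Proof.
elim: t => [v|f ts IH] /= H; first exact: H.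
by congr VApp; apply: eq_map => i; apply: IH => x Hx; apply: H; exists i.
Qed.

Lemma fsem_ext S (V : Set) (A : formula S V) k (r1 r2 : V -> val S) :
  (forall x, occ_formula x A -> r1 x = r2 x) -> fsem k r1 A = fsem k r2 A.
Proof.
elim/formula_set_ind: A k r1 r2 => {V} /= [V b a|V c A IHA B IHB|V q A IH] k r1 r2 H.
- congr VLit; apply: eq_map => i; apply: tsem_ext => x Hx; apply: H.
  by exists i.
- by congr VBin; [apply: IHA|apply: IHB] => x Hx; apply: H; [left|right].
- by congr VQua; apply: IH => -[v|] //= /H.
Qed.

Lemma vsize_tsem S (V : Set) (r : V -> val S) t x :
  occ_term x t -> vsize (r x) <= vsize (tsem r t).
Proof.
elim: t => [v|f ts IH] /= => [->//|[i /IH]] H.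
apply: leq_trans H _; apply: leqW.
have: i \in enum 'I_(farity f) by rewrite mem_enum.
elim: (enum _) => //= j l IHl; rewrite in_cons => /orP[/eqP <-|/IHl H].
  exact: leq_addr.
exact: leq_trans H (leq_addl _ _).
Qed.

Lemma vsize_fsem S (V : Set) (A : formula S V) k (r : V -> val S) x :
  occ_formula x A -> vsize (r x) < vsize (fsem k r A).
Proof.
elim/formula_set_ind: A k r x => {V} /= [V b a|V c A IHA B IHB|V q A IH] k r x.
- case: a => p ts [i /=] /(vsize_tsem r) H; rewrite ltnS.
  apply: leq_trans H _.
  have: i \in enum 'I_(parity p) by rewrite mem_enum.
  elim: (enum _) => //= j l IHl; rewrite in_cons => /orP[/eqP <-|/IHl H].
    exact: leq_addr.
  exact: leq_trans H (leq_addl _ _).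
- rewrite ltnS; case=> [/(IHA k r)|/(IHB k r)] /ltnW H; apply: leq_trans H _.
    exact: leq_addr.
  exact: leq_addl.
- by move=> /(IH k.+1 (vlift k r)) /=; exact: ltnW.
Qed.

(* The condition excludes the values that [tsem] produces for compound terms
   and the bound variables not yet introduced at level [k]. *)
Definition nice S (k : nat) (v : val S) : bool :=
  match v with
  | VVar _ | VAll _ => true
  | VBd j => j < k
  | _ => false
  end.

Lemma tsem_inj S (V : Set) k (r : V -> val S) t t' :
  (forall x, nice k (r x)) ->
  (forall x y, occ_term x t -> r x = r y -> x = y) ->
  tsem r t = tsem r t' -> t = t'.
Proof.
move=> Hn; elim: t t' => [x|f ts IH] [y|g us] /= H.
- by move=> /H ->.
- by move=> E; have := Hn x; rewrite E.
- by move=> E; have := Hn y; rewrite -E.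
- case=> E; case: _ / E us => us /eq_in_map E.
  congr App; apply: funext => i; apply: IH; last by apply: E; rewrite mem_enum.
  by move=> x y Hx; apply: H; exists i.
Qed.

Lemma fsem_inj S (V : Set) (A A' : formula S V) k (r : V -> val S) :
  (forall x, nice k (r x)) ->
  (forall x y, occ_formula x A -> r x = r y -> x = y) ->
  fsem k r A = fsem k r A' -> A = A'.
Proof.
elim/formula_set_ind: A A' k r => {V} /= [V b a|V c A IHA B IHB|V q A IH] A' k r Hn H.
- case: A' => //= b' a' [-> E]; case: a a' E H => [p ts] [p' ts'] /= E.
  case: _ / E ts' => ts' H /eq_in_map E.
  congr Lit; congr Atom; apply: funext => i.
  apply: (tsem_inj Hn) (E i _); last by rewrite mem_enum.
  by move=> x y Hx; apply: H; exists i.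
- case: A' => //= c' A' B' [-> EA EB].
  congr Bin; first by apply: (IHA _ _ _ Hn _ EA) => x y Hx; apply: H; left.
  by apply: (IHB _ _ _ Hn _ EB) => x y Hx; apply: H; right.
- case: A' => //= q' A' [-> E]; congr Qua; apply: IH E.
    by move=> [v|] //=; case: (r v) (Hn v) => //= j /ltnW.
  move=> [v|] [w|] //= Hx; first by move/H => ->.
    by move=> E; have := Hn v; rewrite E /= ltnn.
  by move=> E; have := Hn w; rewrite -E /= ltnn.
Qed.

Lemma fsem_var_inj S (A B : formula S var) k :
  fsem k VVar A = fsem k VVar B -> A = B.
Proof. by apply: fsem_inj => // x y _ []. Qed.

Lemma fsem_positive S (V : Set) (A B : formula S V) k r :
  fsem k r A = fsem k r B -> positive A = positive B.
Proof.
by case: A B => [b a|c A A'|q A] [b' a'|c' B B'|q' B] //= [] ->.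
Qed.

Lemma fsem_is_bin S (V : Set) (A B : formula S V) k r :
  fsem k r A = fsem k r B -> is_bin A = is_bin B.
Proof. by case: A B => [b a|c A A'|q A] [b' a'|c' B B'|q' B]. Qed.

(** * Collecting *)

Lemma insert_ind (T K : eqType) (key : T -> K) op (Pr : T -> Prop) s x :
  (forall x y, key x = key y -> Pr x -> Pr y -> Pr (op x y)) ->
  (forall z, z \in s -> Pr z) -> Pr x ->
  forall z, z \in insert key op s x -> Pr z.
Proof.
move=> Hop; elim: s => [|y s IH] /= Hs Hx z.
  by rewrite inE => /eqP ->.
case: eqP => [E|_]; rewrite in_cons => /orP[/eqP ->|Hz].
- by apply: Hop => //; apply: Hs; rewrite mem_head.
- by apply: Hs; rewrite in_cons Hz orbT.
- by apply: Hs; rewrite mem_head.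
- by apply: IH Hz => // w Hw; apply: Hs; rewrite in_cons Hw orbT.
Qed.

Lemma collect_ind (T K : eqType) (key : T -> K) op (Pr : T -> Prop) s :
  (forall x y, key x = key y -> Pr x -> Pr y -> Pr (op x y)) ->
  (forall z, z \in s -> Pr z) ->
  forall z, z \in collect key op s -> Pr z.
Proof.
move=> Hop; rewrite /collect.
suff: forall acc, (forall z, z \in acc -> Pr z) -> (forall z, z \in s -> Pr z) ->
  forall z, z \in foldl (insert key op) acc s -> Pr z by apply.
elim: s => //= x s IH acc Ha Hs; apply: IH; last first.
  by move=> z Hz; apply: Hs; rewrite in_cons Hz orbT.
by apply: insert_ind => //; apply: Hs; rewrite mem_head.
Qed.

Lemma insert_keys (T : Type) (K : eqType) (key : T -> K) op s x :
  (forall x y, key (op x y) = key x) ->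
  map key (insert key op s x) =
  if key x \in map key s then map key s else rcons (map key s) (key x).
Proof.
move=> Hop; elim: s => //= y s IH; rewrite in_cons eq_sym.
by case: eqP => //= _; rewrite ?Hop // IH; case: ifP.
Qed.

Lemma collect_keys (T : Type) (K : eqType) (key : T -> K) op s :
  (forall x y, key (op x y) = key x) ->
  uniq (map key (collect key op s)) /\
  map key (collect key op s) =i map key s.
Proof.
move=> Hop; rewrite /collect.
suff: forall acc, uniq (map key acc) ->
  uniq (map key (foldl (insert key op) acc s)) /\
  map key (foldl (insert key op) acc s) =i map key acc ++ map key s.
  by move=> H; have [] := H [::] isT.
elim: s => /= [|x s IH] acc Ha; first by rewrite cats0.
have [|Hu Hi] := IH (insert key op acc x).
  rewrite insert_keys //; case: ifP => // /negbT Hx.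
  by rewrite rcons_uniq Hx.
split=> // k; rewrite Hi insert_keys // !mem_cat in_cons.
case: ifP => Hx; last by rewrite mem_rcons in_cons -orbA orbCA.
by case: eqP => //= ->; rewrite Hx.
Qed.

Lemma insert_perm (T : Type) (K X : eqType) (key : T -> K) op (f : T -> seq X)
    s x :
  (forall x y, perm_eq (f (op x y)) (f x ++ f y)) ->
  perm_eq (flatten (map f (insert key op s x))) (flatten (map f s) ++ f x).
Proof.
move=> Hop; elim: s => [|y s IH] /=; first by rewrite cats0.
case: eqP => _ /=; last by rewrite -catA perm_cat2l.
apply: (@perm_trans _ ((f y ++ f x) ++ flatten (map f s))).
  by rewrite perm_cat2r.
by rewrite -!catA perm_cat2l perm_catC.
Qed.

Lemma collect_perm (T : Type) (K X : eqType) (key : T -> K) op (f : T -> seq X)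
    s :
  (forall x y, perm_eq (f (op x y)) (f x ++ f y)) ->
  perm_eq (flatten (map f (collect key op s))) (flatten (map f s)).
Proof.
move=> Hop; rewrite /collect.
suff H: forall acc, perm_eq (flatten (map f (foldl (insert key op) acc s)))
  (flatten (map f acc) ++ flatten (map f s)) by apply: (H [::]).
elim: s => /= [|x s IH] acc; first by rewrite cats0.
apply: (perm_trans (IH _)); rewrite catA perm_cat2r; exact: insert_perm.
Qed.

Lemma collect_sum (T : Type) (K : eqType) (key : T -> K) op (f : T -> nat) s :
  (forall x y, f (op x y) = f x + f y) ->
  sumn (map f (collect key op s)) = sumn (map f s).
Proof.
move=> Hop; pose g x := nseq (f x) tt.
have E l : sumn (map f l) = size (flatten (map g l)).
  by elim: l => //= x l ->; rewrite size_cat size_nseq.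
rewrite !E; apply: perm_size; apply: collect_perm => x y.
by rewrite /g Hop nseqD.
Qed.

Lemma collect_has (T : Type) (K : eqType) (key : T -> K) op (p : pred T) s :
  (forall x y, p x || p y -> p (op x y)) ->
  has p s -> has p (collect key op s).
Proof.
move=> Hop; rewrite /collect.
have Hi l x : has p l || p x -> has p (insert key op l x).
  elim: l => /= [->//|y l IH]; case: eqP => _ /=.
    by case/orP => [/orP[H|->]|H]; rewrite ?orbT // Hop ?H ?orbT.
  by rewrite -orbA => /orP[->//|/IH ->]; rewrite orbT.
suff H: forall acc, has p acc || has p s ->
  has p (foldl (insert key op) acc s) by apply: (H [::]).
elim: s => /= [|x s IH] acc; first by rewrite orbF.
by rewrite orbA => /orP[/Hi H|H]; apply: IH; rewrite ?H ?orbT.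
Qed.

(** * Trees *)

Lemma tree_children_ind S (P : tree S -> Prop) :
  (forall b a, P (TLit b a)) ->
  (forall c E1, P E1 -> forall E2, P E2 -> P (TBin c E1 E2)) ->
  (forall A l, (forall t E, (t, E) \in l -> P E) -> P (TEx A l)) ->
  (forall A y E, P E -> P (TAll A y E)) ->
  (forall E1, P E1 -> forall E2, P E2 -> P (TMerge E1 E2)) ->
  forall E, P E.
Proof.
move=> HL HB HE HA HM; fix IH 1 => -[b a|c E1 E2|A l|A y E|E1 E2].
- exact: HL.
- exact: HB.
- apply: HE; elim: l => [|[t' E'] l IHl] t E; first by clear IH.
  rewrite in_cons => /predU1P[[_ ->]|]; first exact: IH.
  exact: IHl.
- exact: HA.
- exact: HM.
Qed.

Fixpoint nsize S (E : tree S) : nat :=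
  match E with
  | TLit _ _ => 1
  | TBin _ E1 E2 => (nsize E1 + nsize E2).+1
  | TEx _ l => (sumn [seq nsize tE.2 | tE <- l]).+1
  | TAll _ _ E => (nsize E).+1
  | TMerge E1 E2 => nsize E1 + nsize E2
  end.

Lemma qeval_bigor S v (l : seq (qformula S)) :
  qeval v (qbigor l) = has (qeval v) l.
Proof.
elim: l => //= A l IH; case: l IH => [|B l] /= IH; first by rewrite orbF.
by rewrite IH.
Qed.

Lemma qeval_ex S v A (l : seq (term S var * tree S)) :
  qeval v (Dp (TEx A l)) = has (fun tE => qeval v (Dp tE.2)) l.
Proof. by rewrite /= qeval_bigor has_map. Qed.

(* Merged trees only have to agree up to an interpretation of the variables:
   after a quantifier step, the right side of the instance cut, and hence a tree
   merged with it, has renamed eigenvariables in its shallow formula. *)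
Inductive wf S (r : var -> val S) : tree S -> Prop :=
| wf_lit b a : wf r (TLit b a)
| wf_bin c E1 E2 : wf r E1 -> wf r E2 -> wf r (TBin c E1 E2)
| wf_ex A l :
    uniq (unzip1 l) ->
    (forall t E, (t, E) \in l -> wf r E) ->
    (forall t E, (t, E) \in l -> Sh E = inst A t) ->
    wf r (TEx A l)
| wf_all A y E : wf r E -> Sh E = inst A (Var y) -> wf r (TAll A y E)
| wf_merge E1 E2 :
    wf r E1 -> wf r E2 -> fsem 0 r (Sh E1) = fsem 0 r (Sh E2) ->
    wf r (TMerge E1 E2).

Lemma is_tree_wf S r (E : tree S) : is_tree E -> wf r E.
Proof. by elim => *; constructor. Qed.

Lemma wf_var S r (E : tree S) : wf VVar E -> wf r E.
Proof.
elim => *; try by constructor.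
by apply: wf_merge => //; congr fsem; apply: fsem_var_inj; eassumption.
Qed.

(* [Above p] is the state above the first quantifier of a tree; there [p]
   records the tree and the propositional path, if they are to be tracked.
   From the first quantifier on, [Below m] records the whole history. *)
Inductive mode S := Above (p : option (val S)) | Below (m : val S).
Arguments Above {S} p.

HB.instance Definition _ S := gen_eqMixin (mode S).

Definition mleft S (m : mode S) :=
  match m with Above p => Above (omap (@VL S) p) | Below m => Below (VL m) end.

Definition mright S (m : mode S) :=
  match m with Above p => Above (omap (@VR S) p) | Below m => Below (VR m) end.

Definition hist S (m : mode S) (v : val S) : val S :=
  match m with Above p => VRoot p v | Below m => m end.

(* The Skolem terms prescribed for the eigenvariables. *)
Fixpoint eqs S (r : var -> val S) (m : mode S) (E : tree S) :
    seq (var * val S) :=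
  match E with
  | TLit _ _ => [::]
  | TBin _ E1 E2 => eqs r (mleft m) E1 ++ eqs r (mright m) E2
  | TEx A l =>
      flatten [seq eqs r (Below (VEx (hist m (fsem 0 r (Qua Ex A))) (tsem r tE.1)))
                     tE.2 | tE <- l]
  | TAll A y E =>
      let v := VAll (hist m (fsem 0 r (Qua All A))) in
      (y, v) :: eqs r (Below v) E
  | TMerge E1 E2 => eqs r m E1 ++ eqs r m E2
  end.

Definition ok S r m (E : tree S) :=
  forall y v, (y, v) \in eqs r m E -> r y = v.

Lemma ok_bin S r m c (E1 E2 : tree S) :
  ok r m (TBin c E1 E2) <-> ok r (mleft m) E1 /\ ok r (mright m) E2.
Proof.
split=> [H|[H1 H2] y v].
  by split=> y v Hv; apply: H; rewrite /= mem_cat Hv ?orbT.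
by rewrite /= mem_cat => /orP[/H1|/H2].
Qed.

Lemma ok_merge S r m (E1 E2 : tree S) :
  ok r m (TMerge E1 E2) <-> ok r m E1 /\ ok r m E2.
Proof.
split=> [H|[H1 H2] y v].
  by split=> y v Hv; apply: H; rewrite /= mem_cat Hv ?orbT.
by rewrite /= mem_cat => /orP[/H1|/H2].
Qed.

Lemma ok_all S r m A y (E : tree S) :
  let v := VAll (hist m (fsem 0 r (Qua All A))) in
  ok r m (TAll A y E) <-> r y = v /\ ok r (Below v) E.
Proof.
move=> v; split=> [H|[H1 H2] z w].
  by split=> [|z w Hw]; apply: H; rewrite /= in_cons ?eqxx // Hw orbT.
by rewrite /= in_cons => /orP[/eqP[-> ->]|/H2].
Qed.

Lemma ok_ex S r m A (l : seq (term S var * tree S)) :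
  ok r m (TEx A l) <->
  forall t E, (t, E) \in l ->
    ok r (Below (VEx (hist m (fsem 0 r (Qua Ex A))) (tsem r t))) E.
Proof.
split=> [H t E Hl y v Hv|H y v /flattenP[s /mapP[[t E] Hl ->]]].
  by apply: H; apply/flattenP; eexists; [apply/mapP; exists (t, E)|].
exact: H.
Qed.

Lemma eqs_keys S r m (E : tree S) : unzip1 (eqs r m E) = eigenvars E.
Proof.
elim/tree_children_ind: E m => //= [c E1 IH1 E2 IH2|A l IH|A y E IH|E1 IH1 E2 IH2] m.
- by rewrite -(IH1 (mleft m)) -(IH2 (mright m)) /unzip1 map_cat.
- rewrite /unzip1 map_flatten -map_comp; congr flatten.
  by apply/eq_in_map => -[t E] Hl; exact: IH Hl _.
- by rewrite -(IH (Below (VAll (hist m (VQua All (fsem 1 (vlift 0 r) A)))))).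
- by rewrite -(IH1 m) -(IH2 m) /unzip1 map_cat.
Qed.

Lemma mem_eqs S r m (E : tree S) y v : (y, v) \in eqs r m E -> y \in eigenvars E.
Proof. by rewrite -(eqs_keys r m) => /(map_f fst). Qed.

Lemma eigenvars_eqs S r m (E : tree S) y :
  y \in eigenvars E -> exists v, (y, v) \in eqs r m E.
Proof. by rewrite -(eqs_keys r m) => /mapP[[z v] H ->]; exists v. Qed.

Lemma ok_eqs S r m (E : tree S) y :
  ok r m E -> y \in eigenvars E -> (y, r y) \in eqs r m E.
Proof. by move=> H /(eigenvars_eqs r m)[v Hv]; rewrite (H _ _ Hv). Qed.

(** * Substitution on trees *)

Definition fixes_eigenvars S (s : subst S) (E : tree S) :=
  forall y, y \in eigenvars E -> s y = Var (vsubst s y).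

Lemma Sh_esubst S (s : subst S) E : Sh (esubst s E) = fsubst (Sh E) s.
Proof. by elim: E => //= c E1 -> E2 ->. Qed.

Lemma esubst_perm S (s : subst S) E :
  perm_eq (eigenvars (esubst s E)) (map (vsubst s) (eigenvars E)).
Proof.
elim/tree_children_ind: E => //= [c E1 IH1 E2 IH2|A l IH|A y E IH|E1 IH1 E2 IH2].
- by rewrite map_cat perm_cat.
- apply: (@perm_trans _ (flatten [seq eigenvars tE.2 |
      tE <- [seq (tsubst s tE.1, esubst s tE.2) | tE <- l]])).
    exact: collect_perm.
  rewrite map_flatten -!map_comp; elim: l IH => //= -[t E] l IHl IH.
  rewrite perm_cat //; first by apply: (IH t); rewrite mem_head.
  by apply: IHl => t' E' H; apply: (IH t'); rewrite in_cons H orbT.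
- by rewrite perm_cons.
- by rewrite map_cat perm_cat.
Qed.

Lemma nsize_esubst S (s : subst S) E : nsize (esubst s E) = nsize E.
Proof.
elim/tree_children_ind: E => //= [c E1 -> E2 ->//|A l IH|A y E ->//|E1 -> E2 ->//].
congr _.+1; rewrite /collect_children collect_sum // -map_comp.
by congr sumn; apply/eq_in_map => -[t E] /IH.
Qed.

Lemma qeval_esubst S (s : subst S) v E :
  qeval (fun a => v (asubst s a)) (Dp E) -> qeval v (Dp (esubst s E)).
Proof.
elim/tree_children_ind: E => //.
- move=> [] E1 IH1 E2 IH2 /=; first by case/andP => /IH1 -> /IH2 ->.
  by case/orP => [/IH1|/IH2] ->; rewrite ?orbT.
- move=> A l IH; rewrite qeval_ex => /hasP[[t E] Hl /= /(IH t _ Hl) H].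
  rewrite qeval_bigor has_map; apply: collect_has => //=; rewrite has_map.
  by apply/hasP; exists (t, E).
- by move=> E1 IH1 E2 IH2 /= /orP[/IH1|/IH2] ->; rewrite ?orbT.
Qed.

Lemma wf_esubst S (s : subst S) r E :
  fixes_eigenvars s E -> wf (scomp r s) E -> wf r (esubst s E).
Proof.
move=> Hs H; elim: H Hs => {E} /=.
- by constructor.
- move=> c E1 E2 _ IH1 _ IH2 H; constructor.
    by apply: IH1 => y Hy; apply: H; rewrite /= mem_cat Hy.
  by apply: IH2 => y Hy; apply: H; rewrite /= mem_cat Hy orbT.
- move=> A l Hu _ IH HSh H.
  set l' := [seq _ | _ <- _].
  have Hl' tE : tE \in collect_children l' ->
      wf r tE.2 /\ Sh tE.2 = inst (fsubst A (lift s)) tE.1.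
    move: tE; apply: (collect_ind (Pr := fun tE =>
        wf r tE.2 /\ Sh tE.2 = inst (fsubst A (lift s)) tE.1)).
      move=> [t1 E1] [t2 E2] /= -> [W1 S1] [W2 S2].
      by split=> //; constructor => //; rewrite S1 S2.
    move=> _ /mapP[[t E] Hl ->] /=; split.
      apply: (IH _ _ Hl) => y Hy; apply: H; apply/flattenP.
      by exists (eigenvars E) => //; apply/mapP; exists (t, E).
    by rewrite Sh_esubst (HSh _ _ Hl) fsubst_inst.
  constructor; last 2 first.
  + by move=> t E /Hl'[].
  + by move=> t E /Hl'[].
  by have [] := @collect_keys _ _ fst (fun tE tE' => (tE.1, TMerge tE.2 tE'.2)) l'.
- move=> A y E _ IH HSh H; constructor.
    by apply: IH => z Hz; apply: H; rewrite in_cons Hz orbT.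
  rewrite Sh_esubst HSh fsubst_inst /=.
  by rewrite -H ?mem_head.
- move=> E1 E2 _ IH1 _ IH2 HSh H; constructor.
  + by apply: IH1 => y Hy; apply: H; rewrite /= mem_cat Hy.
  + by apply: IH2 => y Hy; apply: H; rewrite /= mem_cat Hy orbT.
  + by rewrite !Sh_esubst !fsem_fsubst.
Qed.

Lemma ok_esubst S (s : subst S) r m E :
  fixes_eigenvars s E -> ok (scomp r s) m E -> ok r m (esubst s E).
Proof.
elim/tree_children_ind: E m => [b a|c E1 IH1 E2 IH2|A l IH|A y E IH|E1 IH1 E2 IH2] m Hs.
- by [].
- move=> /ok_bin[H1 H2]; apply/ok_bin; split.
    by apply: IH1 => // y Hy; apply: Hs; rewrite /= mem_cat Hy.
  by apply: IH2 => // y Hy; apply: Hs; rewrite /= mem_cat Hy orbT.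
- move=> /ok_ex H; apply/ok_ex => t E Hl.
  have ->: t = (t, E).1 by []; have {2}->: E = (t, E).2 by [].
  move: (t, E) Hl => {t E} tE.
  apply: (collect_ind (Pr := fun tE => ok _ (Below (VEx _ (tsem _ tE.1))) tE.2)).
    by move=> [t1 E1] [t2 E2] /= -> H1 H2; apply/ok_merge.
  move=> _ /mapP[[t E] Hl ->] /=; apply: (IH t) => //.
    move=> y Hy; apply: Hs; apply/flattenP.
    by exists (eigenvars E) => //; apply/mapP; exists (t, E).
  have := H _ _ Hl; rewrite tsem_tsubst.
  by rewrite -[VQua _ _]/(fsem 0 r (fsubst (Qua Ex A) s)) fsem_fsubst.
- move=> /ok_all[Hy HE]; apply/ok_all.
  have ->: fsem 0 r (Qua All (fsubst A (lift s))) = fsem 0 (scomp r s) (Qua All A).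
    exact: (fsem_fsubst (Qua All A)).
  split; first by rewrite -Hy /scomp Hs //= mem_head.
  by apply: IH => // z Hz; apply: Hs; rewrite /= in_cons Hz orbT.
- move=> /ok_merge[H1 H2]; apply/ok_merge; split.
    by apply: IH1 => // y Hy; apply: Hs; rewrite /= mem_cat Hy.
  by apply: IH2 => // y Hy; apply: Hs; rewrite /= mem_cat Hy orbT.
Qed.

(** * Merge reduction *)

Lemma merge_tree_Sh S (E : tree S) o E' : merge_tree E o E' -> Sh E' = Sh E.
Proof.
by elim=> //= {E o E'} c E1 E2 o E2' _ ->.
Qed.

Definition omerged (o : option (var * var)) : seq var :=
  if o is Some p then [:: p.1] else [::].

Lemma collect_children_perm S (l : seq (term S var * tree S)) :
  perm_eq (flatten [seq eigenvars tE.2 | tE <- collect_children l])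
          (flatten [seq eigenvars tE.2 | tE <- l]).
Proof. exact: collect_perm. Qed.

Lemma merge_tree_perm S (E : tree S) o E' :
  merge_tree E o E' -> perm_eq (eigenvars E) (omerged o ++ eigenvars E').
Proof.
have H (a b c d : seq var) : perm_eq a (b ++ c) -> perm_eq (a ++ d) (b ++ c ++ d).
  by rewrite catA perm_cat2r.
have H' (a b c d : seq var) : perm_eq a (b ++ c) -> perm_eq (d ++ a) (b ++ d ++ c).
  by move=> /permP h; apply/permP => p; rewrite !count_cat h count_cat; lia.
elim=> //= {E o E'}.
- by move=> c E1 E1' E2 E2'; apply/permP => p; rewrite !count_cat; lia.
- by move=> A a1 E1 a2 E2; apply/permP => p; rewrite /= !count_cat /=; lia.
- by move=> A l1 l2; rewrite -flatten_cat -map_cat perm_sym collect_children_perm.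
- by move=> *; exact: H.
- by move=> *; exact: H'.
- by move=> A l1 t E l2 o E' _ IH; rewrite !map_cat !flatten_cat /=; apply/H'/H.
- move=> A y E o E' _ /permP IH; apply/permP => p.
  by rewrite /= IH !count_cat /=; lia.
- by move=> *; exact: H.
- by move=> *; exact: H'.
Qed.

Lemma merge_tree_mem S (E : tree S) o E' a2 a1 :
  merge_tree E o E' -> o = Some (a2, a1) -> a1 \in eigenvars E'.
Proof.
elim=> //= {E o E'}.
- by move=> A b1 E1 b2 E2 [_ ->]; rewrite mem_head.
- by move=> c E1 E2 o E1' _ IH /IH; rewrite mem_cat => ->.
- by move=> c E1 E2 o E1' _ IH /IH; rewrite mem_cat orbC => ->.
- move=> A l1 t E l2 o E' _ IH /IH H.
  by rewrite map_cat flatten_cat !mem_cat H orbT.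
- by move=> A y E o E' _ IH /IH; rewrite in_cons orbC => ->.
- by move=> E1 E2 o E1' _ IH /IH; rewrite mem_cat => ->.
- by move=> E1 E2 o E1' _ IH /IH; rewrite mem_cat orbC => ->.
Qed.

Lemma merge_tree_nsize S (E : tree S) o E' :
  merge_tree E o E' -> nsize E' < nsize E.
Proof.
elim=> //= {E o E'}; try by move=> *; lia.
- by move=> A l1 l2; rewrite collect_sum // map_cat sumn_cat; lia.
- by move=> A l1 t E l2 o E' _ IH; rewrite !map_cat !sumn_cat /=; lia.
Qed.

Lemma merge_tree_qeval S (E : tree S) o E' v :
  merge_tree E o E' -> qeval v (Dp E) -> qeval v (Dp E').
Proof.
elim=> //= {E o E'}.
- by move=> b a; rewrite orbb.
- by move=> [] E1 E1' E2 E2' /=; do 4!case: (qeval v _).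
- move=> A l1 l2; rewrite !qeval_bigor !has_map -has_cat.
  by apply: collect_has => -[t1 E1] [t2 E2] /=.
- by move=> [] E1 E2 o E1' _ IH /=; [case/andP=> /IH -> ->|case/orP=> [/IH|] ->];
    rewrite ?orbT.
- by move=> [] E1 E2 o E1' _ IH /=; [case/andP=> -> /IH ->|case/orP=> [|/IH] ->];
    rewrite ?orbT.
- move=> A l1 t E l2 o E' _ IH; rewrite !qeval_bigor !has_map !has_cat /=.
  by case/or3P => [->|/IH ->|->]; rewrite ?orbT.
- by move=> E1 E2 o E1' _ IH /=; case/orP=> [/IH|] ->; rewrite ?orbT.
- by move=> E1 E2 o E1' _ IH /=; case/orP=> [|/IH] ->; rewrite ?orbT.
Qed.

Definition identifies S (r : var -> val S) (o : option (var * var)) :=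
  forall a2 a1, o = Some (a2, a1) -> r a1 = r a2.

Lemma merge_tree_ok S r m (E : tree S) o E' :
  merge_tree E o E' -> ok r m E -> ok r m E' /\ identifies r o.
Proof.
move=> H; elim: H m => {E o E'}.
- by move=> b a m _; split.
- move=> c E1 E1' E2 E2' m /ok_merge[/ok_bin[H1 H1'] /ok_bin[H2 H2']].
  by split=> //; apply/ok_bin; split; apply/ok_merge.
- move=> A a1 E1 a2 E2 m /ok_merge[/ok_all[H1 H1'] /ok_all[H2 H2']]; split.
    by apply/ok_all; split=> //; apply/ok_merge.
  by move=> _ _ [<- <-]; rewrite H1 H2.
- move=> A l1 l2 m /ok_merge[/ok_ex H1 /ok_ex H2]; split=> //.
  apply/ok_ex => t E Hl.
  have ->: t = (t, E).1 by []; have {2}->: E = (t, E).2 by [].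
  move: (t, E) Hl => {t E} tE.
  apply: (collect_ind (Pr := fun tE => ok _ (Below (VEx _ (tsem _ tE.1))) tE.2)).
    by move=> [t1 E1] [t2 E2] /= -> K1 K2; apply/ok_merge.
  by move=> [t E]; rewrite mem_cat => /orP[/H1|/H2].
- move=> c E1 E2 o E1' _ IH m /ok_bin[/IH[H1 Ho] H2].
  by split=> //; apply/ok_bin.
- move=> c E1 E2 o E1' _ IH m /ok_bin[H1 /IH[H2 Ho]].
  by split=> //; apply/ok_bin.
- move=> A l1 t E l2 o E' _ IH m /ok_ex H.
  have [|H1 Ho] := IH (Below (VEx (hist m (fsem 0 r (Qua Ex A))) (tsem r t))).
    by apply: H; rewrite mem_cat mem_head orbT.
  split=> //; apply/ok_ex => u F; rewrite mem_cat in_cons.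
  case/or3P => [K|/eqP[-> ->]//|K]; apply: H; rewrite mem_cat.
    by rewrite K.
  by rewrite in_cons K !orbT.
- move=> A y E o E' _ IH m /ok_all[Hy /IH[H Ho]].
  by split=> //; apply/ok_all.
- move=> E1 E2 o E1' _ IH m /ok_merge[/IH[H1 Ho] H2].
  by split=> //; apply/ok_merge.
- move=> E1 E2 o E1' _ IH m /ok_merge[H1 /IH[H2 Ho]].
  by split=> //; apply/ok_merge.
Qed.

Lemma wf_binE S r c (E1 E2 : tree S) : wf r (TBin c E1 E2) -> wf r E1 /\ wf r E2.
Proof. by move=> H; inversion H. Qed.

Lemma wf_allE S r A y (E : tree S) :
  wf r (TAll A y E) -> wf r E /\ Sh E = inst A (Var y).
Proof. by move=> H; inversion H. Qed.

Lemma wf_mergeE S r (E1 E2 : tree S) :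
  wf r (TMerge E1 E2) ->
  [/\ wf r E1, wf r E2 & fsem 0 r (Sh E1) = fsem 0 r (Sh E2)].
Proof. by move=> H; inversion H. Qed.

Lemma wf_exE S r A (l : seq (term S var * tree S)) :
  wf r (TEx A l) ->
  uniq (unzip1 l) /\ forall t E, (t, E) \in l -> wf r E /\ Sh E = inst A t.
Proof. by move=> H; inversion H; split=> // t E Ht; split; eauto. Qed.

Lemma fsem_inst S (A : formula S (option var)) k r t u :
  tsem r t = tsem r u -> fsem k r (inst A t) = fsem k r (inst A u).
Proof.
by move=> E; rewrite !fsem_fsubst; congr fsem; apply: funext => -[v|].
Qed.

Lemma collect_children_uniq S (l : seq (term S var * tree S)) :
  uniq (unzip1 (collect_children l)).
Proof.
by have [] := @collect_keys _ _ fst (fun tE tE' => (tE.1, TMerge tE.2 tE'.2)) l.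
Qed.

Lemma merge_tree_wf S r (E : tree S) o E' :
  merge_tree E o E' -> identifies r o -> wf r E -> wf r E'.
Proof.
elim=> {E o E'}.
- by constructor.
- move=> c E1 E1' E2 E2' _ /wf_mergeE[/wf_binE[? ?] /wf_binE[? ?] [? ?]].
  by constructor; constructor.
- move=> A a1 E1 a2 E2 Hi /wf_mergeE[/wf_allE[? S1] /wf_allE[? S2] _].
  constructor=> //; constructor=> //; rewrite S1 S2; apply: fsem_inst.
  exact: Hi.
- move=> A l1 l2 _ /wf_mergeE[/wf_exE[_ H1] /wf_exE[_ H2] _].
  have H tE : tE \in collect_children (l1 ++ l2) ->
      wf r tE.2 /\ Sh tE.2 = inst A tE.1.
    move: tE; apply: (collect_ind (Pr := fun tE =>
        wf r tE.2 /\ Sh tE.2 = inst A tE.1)).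
      move=> [t1 F1] [t2 F2] /= -> [W1 S1] [W2 S2].
      by split=> //; constructor => //; rewrite S1 S2.
    by move=> [t E]; rewrite mem_cat => /orP[/H1|/H2].
  constructor; first exact: collect_children_uniq.
    by move=> t E /H[].
  by move=> t E /H[].
- by move=> c E1 E2 o E1' _ IH Hi /wf_binE[? ?]; constructor; auto.
- by move=> c E1 E2 o E1' _ IH Hi /wf_binE[? ?]; constructor; auto.
- move=> A l1 t E l2 o E' HE IH Hi /wf_exE[Hu H].
  have H' u F : (u, F) \in l1 ++ (t, E') :: l2 -> wf r F /\ Sh F = inst A u.
    have [|? HSh] := H t E; first by rewrite mem_cat mem_head orbT.
    rewrite mem_cat in_cons => /or3P[K|/eqP[-> ->]|K].
    + by apply: H; rewrite mem_cat K.
    + by rewrite (merge_tree_Sh HE); split; auto.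
    + by apply: H; rewrite mem_cat in_cons K !orbT.
  constructor; first by move: Hu; rewrite /unzip1 !map_cat.
    by move=> u F /H'[].
  by move=> u F /H'[].
- move=> A y E o E' HE IH Hi /wf_allE[? HSh]; constructor; auto.
  by rewrite (merge_tree_Sh HE).
- move=> E1 E2 o E1' HE IH Hi /wf_mergeE[? ? HSh]; constructor; auto.
  by rewrite (merge_tree_Sh HE).
- move=> E1 E2 o E1' HE IH Hi /wf_mergeE[? ? HSh]; constructor; auto.
  by rewrite (merge_tree_Sh HE).
Qed.

(** * Pre-proofs with merges *)

HB.instance Definition _ S := gen_eqMixin (pre S).

Definition mtree S (E : tree S) : mode S :=
  Above (Some (VTree (fsem 0 VVar (Sh E)))).

(* [K] tags the two sides of a propositional cut. With tags, a position
   determines the root if there is only one such cut; without tags ([untagged]),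
   a solution is not affected by a propositional reduction. *)
Definition mcut S (K : bool -> option (val S)) (b : bool) (c : cut S) : mode S :=
  Above (if is_bin (cut_formula c) then K b else None).

Definition roots S K (P : pre S) : seq (mode S * tree S) :=
  [seq (mtree E, E) | E <- trees P] ++
  flatten [seq [:: (mcut K true c, cpos c); (mcut K false c, cneg c)]
          | c <- cuts P].

Definition cut_shallow S (P : pre S) : seq (formula S var * formula S var) :=
  [seq (cut_formula c, Sh (cneg c)) | c <- cuts P].

Lemma all_treesE S K (P : pre S) : all_trees P = unzip2 (roots K P).
Proof.
rewrite /all_trees /roots /unzip2 map_cat map_flatten -!map_comp.
by rewrite (@eq_map _ _ _ id) // map_id.
Qed.

Lemma roots_tree S K (P : pre S) E : E \in trees P -> (mtree E, E) \in roots K P.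
Proof. by move=> H; rewrite mem_cat (map_f (fun E => (mtree E, E)) H). Qed.

Lemma roots_cpos S K (P : pre S) c :
  c \in cuts P -> (mcut K true c, cpos c) \in roots K P.
Proof.
move=> H; rewrite mem_cat; apply/orP; right; apply/flattenP.
by eexists; [apply/mapP; exists c => //|rewrite mem_head].
Qed.

Lemma roots_cneg S K (P : pre S) c :
  c \in cuts P -> (mcut K false c, cneg c) \in roots K P.
Proof.
move=> H; rewrite mem_cat; apply/orP; right; apply/flattenP.
by eexists; [apply/mapP; exists c => //|rewrite !in_cons eqxx orbT].
Qed.

Lemma rootsP S K (P : pre S) (R : mode S * tree S -> Prop) :
  (forall E, E \in trees P -> R (mtree E, E)) ->
  (forall c, c \in cuts P -> R (mcut K true c, cpos c) /\ R (mcut K false c, cneg c)) ->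
  forall mE, mE \in roots K P -> R mE.
Proof.
move=> HT HC mE; rewrite mem_cat => /orP[/mapP[E /HT H ->]//|].
case/flattenP => s /mapP[c /HC[H1 H2] ->].
by rewrite !in_cons => /or3P[/eqP ->|/eqP ->|].
Qed.

Lemma pre_eigenvarsE S (P : pre S) :
  pre_eigenvars P = flatten [seq eigenvars E | E <- trees P] ++
    flatten [seq eigenvars (cpos c) ++ eigenvars (cneg c) | c <- cuts P].
Proof.
rewrite /pre_eigenvars /all_trees map_cat flatten_cat; congr (_ ++ _).
by elim: (cuts P) => //= c l IH; rewrite -catA IH.
Qed.

Inductive merge_in S : pre S -> option (var * var) -> pre S -> Prop :=
| min_tree C T1 E T2 o E' :
    merge_tree E o E' ->
    merge_in (Pre C (T1 ++ E :: T2)) o (Pre C (T1 ++ E' :: T2))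
| min_cpos C1 E F C2 T o E' :
    merge_tree E o E' ->
    merge_in (Pre (C1 ++ Cut E F :: C2) T) o (Pre (C1 ++ Cut E' F :: C2) T)
| min_cneg C1 E F C2 T o F' :
    merge_tree F o F' ->
    merge_in (Pre (C1 ++ Cut E F :: C2) T) o (Pre (C1 ++ Cut E F' :: C2) T).

Lemma merge_stepE S (P Q : pre S) :
  merge_step P Q <-> exists o P', merge_in P o P' /\ Q = rename_after o P'.
Proof.
split; first by case=> *; do 2!eexists; (split; last reflexivity); constructor.
by move=> [o [P' [H ->]]]; case: H => *; constructor.
Qed.

Lemma merge_in_Sh S (P : pre S) o P' : merge_in P o P' -> pre_Sh P' = pre_Sh P.
Proof.
case=> //= C T1 E T2 {}o E' /merge_tree_Sh H.
by rewrite /pre_Sh /= !map_cat /= H.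
Qed.

Lemma merge_in_cut_shallow S (P : pre S) o P' :
  merge_in P o P' -> cut_shallow P' = cut_shallow P.
Proof.
by case=> //= C1 E F C2 T {}o F' /merge_tree_Sh H;
  rewrite /cut_shallow /= !map_cat /= /cut_formula /= H.
Qed.

Lemma merge_in_roots S K (P : pre S) o P' :
  merge_in P o P' -> exists X m E E' Y,
    [/\ merge_tree E o E', roots K P = X ++ (m, E) :: Y &
        roots K P' = X ++ (m, E') :: Y].
Proof.
pose pair c : seq (mode S * tree S) :=
  [:: (mcut K true c, cpos c); (mcut K false c, cneg c)].
pose one E : mode S * tree S := (mtree E, E).
case=> [C T1 E T2 {}o E' H|C1 E F C2 T {}o E' H|C1 E F C2 T {}o F' H];
  have HSh := merge_tree_Sh H; rewrite /roots /= -/pair -/one.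
- exists (map one T1), (mtree E), E, E', (map one T2 ++ flatten (map pair C)).
  have HE' : one E' = (mtree E, E') by rewrite /one /mtree HSh.
  by rewrite !map_cat -!catA /= HE'.
- exists (map one T ++ flatten (map pair C1)), (mcut K true (Cut E F)), E, E',
    ((mcut K false (Cut E F), F) :: flatten (map pair C2)).
  by rewrite !map_cat !flatten_cat -!catA /= /mcut /cut_formula /= HSh.
- exists (map one T ++ flatten (map pair C1) ++ [:: (mcut K true (Cut E F), E)]),
    (mcut K false (Cut E F)), F, F', (flatten (map pair C2)).
  by rewrite !map_cat !flatten_cat -!catA.
Qed.

Lemma merge_in_perm S (P : pre S) o P' :
  merge_in P o P' -> perm_eq (pre_eigenvars P) (omerged o ++ pre_eigenvars P').
Proof.
move=> /(merge_in_roots (fun _ => None))[X [m [E [E' [Y [H HP HP']]]]]].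
rewrite /pre_eigenvars (all_treesE (fun _ => None) P) HP.
rewrite (all_treesE (fun _ => None) P') HP' /unzip2 !map_cat !flatten_cat /=.
move/permP: (merge_tree_perm H) => {}H; apply/permP => p.
by rewrite !count_cat H count_cat; lia.
Qed.

Lemma merge_in_mem S (P : pre S) o P' a2 a1 :
  merge_in P o P' -> o = Some (a2, a1) -> a1 \in pre_eigenvars P'.
Proof.
move=> /(merge_in_roots (fun _ => None))[X [m [E [E' [Y [H HP HP']]]]]] Ho.
rewrite /pre_eigenvars (all_treesE (fun _ => None) P') HP'.
by rewrite /unzip2 !map_cat !flatten_cat /= !mem_cat (merge_tree_mem H Ho) orbT.
Qed.

Definition pre_size S (P : pre S) : nat :=
  sumn [seq nsize E | E <- trees P] +
  sumn [seq nsize (cpos c) + nsize (cneg c) | c <- cuts P].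

Lemma merge_in_size S (P : pre S) o P' :
  merge_in P o P' -> pre_size P' < pre_size P.
Proof.
by case=> [C T1 E T2 {}o E' /merge_tree_nsize|C1 E F C2 T {}o E' /merge_tree_nsize
  |C1 E F C2 T {}o F' /merge_tree_nsize]; rewrite /pre_size /= !map_cat !sumn_cat /=;
  lia.
Qed.

Definition qeval_cut S v (c : cut S) : bool :=
  qeval v (Dp (cpos c)) && qeval v (Dp (cneg c)).

Definition holds S v (P : pre S) : bool :=
  has (fun E => qeval v (Dp E)) (trees P) || has (qeval_cut v) (cuts P).

Lemma tautologyE S (P : pre S) : tautology (pre_Dp P) <-> forall v, holds v P.
Proof.
by split=> H v; have := H v; rewrite /holds /pre_Dp has_cat !has_map.
Qed.

Lemma merge_in_holds S (P : pre S) o P' v :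
  merge_in P o P' -> holds v P -> holds v P'.
Proof.
case=> [C T1 E T2 {}o E'|C1 E F C2 T {}o E'|C1 E F C2 T {}o F'];
  move/(@merge_tree_qeval _ _ _ _ v); rewrite /holds !has_cat /= /qeval_cut /=.
- by move=> H; case/orP => [/or3P[->|/H ->|->]|->]; rewrite ?orbT.
- by move=> H; case/orP => [->//|/or3P[->|/andP[/H -> ->]|->]]; rewrite ?orbT.
- by move=> H; case/orP => [->//|/or3P[->|/andP[-> /H ->]|->]]; rewrite ?orbT.
Qed.

(** * Joins *)

Definition merge_cuts S (c c' : cut S) : cut S :=
  Cut (TMerge (cpos c) (cpos c')) (TMerge (cneg c) (cneg c')).

Lemma mem_join_trees S (Ps : seq (pre S)) (R : tree S -> Prop) :
  (forall E E', Sh E = Sh E' -> R E -> R E' -> R (TMerge E E')) ->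
  (forall P E, P \in Ps -> E \in trees P -> R E) ->
  forall E, E \in trees (join Ps) -> R E.
Proof.
move=> HM H; apply: collect_ind => //= E /flattenP[_ /mapP[P HP ->]].
exact: H HP.
Qed.

Lemma mem_join_cuts S (Ps : seq (pre S)) (R : cut S -> Prop) :
  (forall c c', cut_formula c = cut_formula c' -> R c -> R c' ->
     R (merge_cuts c c')) ->
  (forall P c, P \in Ps -> c \in cuts P -> R c) ->
  forall c, c \in cuts (join Ps) -> R c.
Proof.
move=> HM H; apply: collect_ind => //= c /flattenP[_ /mapP[P HP ->]].
exact: H HP.
Qed.

Lemma join_cut_formulas S (Ps : seq (pre S)) :
  uniq [seq cut_formula c | c <- cuts (join Ps)].
Proof. by have [] := @collect_keys _ _ (@cut_formula S) (@merge_cuts S)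
  (flatten [seq cuts P | P <- Ps]). Qed.

Lemma join_uniq_Sh S (Ps : seq (pre S)) : uniq (pre_Sh (join Ps)).
Proof. by have [] := @collect_keys _ _ (@Sh S) (@TMerge S)
  (flatten [seq trees P | P <- Ps]). Qed.

Lemma join_Sh S (Ps : seq (pre S)) :
  pre_Sh (join Ps) =i flatten [seq pre_Sh P | P <- Ps].
Proof.
have [//|_ H] := @collect_keys _ _ (@Sh S) (@TMerge S)
  (flatten [seq trees P | P <- Ps]).
move=> A; by rewrite /pre_Sh H map_flatten -map_comp.
Qed.

Lemma join_perm S (Ps : seq (pre S)) :
  perm_eq (pre_eigenvars (join Ps)) (flatten [seq pre_eigenvars P | P <- Ps]).
Proof.
rewrite pre_eigenvarsE.
apply: (@perm_trans _ (flatten [seq eigenvars E |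
    E <- flatten [seq trees P | P <- Ps]] ++
  flatten [seq eigenvars (cpos c) ++ eigenvars (cneg c) |
    c <- flatten [seq cuts P | P <- Ps]])).
  apply: perm_cat; apply: collect_perm => //= c c'.
  by apply/permP => p; rewrite !count_cat; lia.
elim: Ps => //= P Ps IH; rewrite !map_cat !flatten_cat pre_eigenvarsE.
move/permP: IH => IH; apply/permP => p; have := IH p; rewrite !count_cat; lia.
Qed.

Lemma join_size S (Ps : seq (pre S)) :
  pre_size (join Ps) = sumn [seq pre_size P | P <- Ps].
Proof.
rewrite /pre_size /join /= /collect_trees /collect_cuts !collect_sum //=.
  by elim: Ps => //= P Ps IH; rewrite !map_cat !sumn_cat; lia.
by move=> c c'; lia.
Qed.

Lemma join_holds S (Ps : seq (pre S)) v :
  has (holds v) Ps -> holds v (join Ps).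
Proof.
move=> H; have: has (fun E => qeval v (Dp E)) (flatten [seq trees P | P <- Ps]) ||
    has (qeval_cut v) (flatten [seq cuts P | P <- Ps]).
  elim: Ps H => //= P Ps IH; rewrite !has_cat => /orP[/orP[]|/IH /orP[]] ->;
    by rewrite ?orbT.
case/orP => H'; apply/orP; [left|right]; apply: collect_has H' => // c c'.
by rewrite /qeval_cut /=; do 4!case: (qeval v _).
Qed.

Lemma roots_join S K (R : mode S -> tree S -> Prop) (Ps : seq (pre S)) :
  (forall m E E', R m E -> R m E' -> R m (TMerge E E')) ->
  (forall P mE, P \in Ps -> mE \in roots K P -> R mE.1 mE.2) ->
  forall mE, mE \in roots K (join Ps) -> R mE.1 mE.2.
Proof.
move=> HM H; apply: rootsP.
  apply: mem_join_trees => [E E' HSh HE HE'|P E HP HE].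
    by apply: HM => //=; rewrite /mtree /= HSh.
  exact: (H P (mtree E, E)) HP (roots_tree _ HE).
apply: mem_join_cuts => [c c' HF [H1 H2] [H1' H2']|P c HP Hc].
  have E b : mcut K b (merge_cuts c c') = mcut K b c by [].
  have E' b : mcut K b (merge_cuts c c') = mcut K b c' by rewrite E /mcut HF.
  by split; apply: HM; rewrite ?E // -?E E' .
split; first exact: (H P (_, _)) HP (roots_cpos _ Hc).
exact: (H P (_, _)) HP (roots_cneg _ Hc).
Qed.

(** * Invariants *)

Definition pre_closed S (P : pre S) :=
  forall A, A \in pre_Sh P -> closed A.

Record raw S (P : pre S) : Prop := Raw {
  raw_cut_formulas : uniq [seq cut_formula c | c <- cuts P];
  raw_shallow : uniq (pre_Sh P);
  raw_eigenvars : uniq (pre_eigenvars P);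
  raw_closed : pre_closed P }.

Definition ok_pre S K r (P : pre S) :=
  forall mE, mE \in roots K P -> ok r mE.1 mE.2.

Definition default_off_eigenvars S (r : var -> val S) (P : pre S) :=
  forall x, x \notin pre_eigenvars P -> r x = VVar x.

Record wf_pre S (r : var -> val S) (P : pre S) : Prop := WfPre {
  wf_all_trees : forall E, E \in all_trees P -> wf r E;
  wf_positive : forall F, F \in cut_shallow P -> positive F.1;
  wf_dual : forall F, F \in cut_shallow P -> fsem 0 r F.2 = fsem 0 r (dual F.1) }.

(* Cuts of depth [d] are counted by the values [V] that their formulas may
   take. *)
Definition cuts_bounded S d (V : seq (val S)) (r : var -> val S) (P : pre S) :=
  forall F, F \in cut_shallow P -> qdepth F.1 < d \/
    [/\ qdepth F.1 = d, is_qua F.1 & fsem 0 r F.1 \in V].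

Record good S K d V r (P : pre S) : Prop := Good {
  good_ok : ok_pre K r P;
  good_default : default_off_eigenvars r P;
  good_wf : wf_pre r P;
  good_bounded : cuts_bounded d V r P }.

Lemma cut_shallowP S (P : pre S) (R : formula S var -> formula S var -> Prop) :
  (forall c, c \in cuts P -> R (cut_formula c) (Sh (cneg c))) ->
  forall F, F \in cut_shallow P -> R F.1 F.2.
Proof. by move=> H F /mapP[c Hc ->]; exact: H. Qed.

Lemma mem_cut_shallow S (P : pre S) c :
  c \in cuts P -> (cut_formula c, Sh (cneg c)) \in cut_shallow P.
Proof. by move=> H; apply/mapP; exists c. Qed.

Lemma wf_preP S r (P : pre S) :
  wf_pre r P <->
  (forall E, E \in trees P -> wf r E) /\
  (forall c, c \in cuts P -> [/\ wf r (cpos c), wf r (cneg c),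
     positive (cut_formula c) &
     fsem 0 r (Sh (cneg c)) = fsem 0 r (dual (cut_formula c))]).
Proof.
split=> [[H1 H2 H3]|[H1 H2]].
  split=> [E HE|c Hc]; first by apply: H1; rewrite mem_cat HE.
  rewrite (H2 _ (mem_cut_shallow Hc)) (H3 _ (mem_cut_shallow Hc)).
  split=> //; apply: H1; rewrite (all_treesE (fun _ => None)).
    exact: (map_f snd (roots_cpos _ Hc)).
  exact: (map_f snd (roots_cneg _ Hc)).
split.
- move=> E; rewrite (all_treesE (fun _ => None)) => /mapP[mE + ->].
  move: mE; apply: rootsP => //= c /H2[]; by split.
- by move=> F /mapP[c /H2[_ _ ? _] ->].
- by move=> F /mapP[c /H2[_ _ _ ?] ->].
Qed.

Lemma merge_in_ok S K r (P : pre S) o P' :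
  merge_in P o P' -> ok_pre K r P -> ok_pre K r P' /\ identifies r o.
Proof.
move=> /(merge_in_roots K)[X [m [E [E' [Y [HE HP HP']]]]]] H.
have [|H1 Ho] := merge_tree_ok HE (H (m, E) _).
  by rewrite HP mem_cat mem_head orbT.
split=> // mE; rewrite HP' mem_cat in_cons => /or3P[K'|/eqP ->//|K'].
  by apply: H; rewrite HP mem_cat K'.
by apply: H; rewrite HP mem_cat in_cons K' !orbT.
Qed.

Lemma merge_in_wf S r (P : pre S) o P' :
  merge_in P o P' -> identifies r o -> wf_pre r P -> wf_pre r P'.
Proof.
move=> HM Ho [H1 H2 H3]; split; rewrite ?(merge_in_cut_shallow HM) //.
have [X [m [E [E' [Y [HE HP HP']]]]]] := merge_in_roots (fun _ => None) HM.
move: H1; rewrite !(all_treesE (fun _ => None)) HP HP' /unzip2 !map_cat /= => H F.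
rewrite mem_cat in_cons => /or3P[K|/eqP ->|K].
- by apply: H; rewrite mem_cat K.
- by apply: (merge_tree_wf HE) => //; apply: H; rewrite mem_cat mem_head orbT.
- by apply: H; rewrite mem_cat in_cons K !orbT.
Qed.

Lemma ok_join S K r (Ps : seq (pre S)) :
  (forall P, P \in Ps -> ok_pre K r P) -> ok_pre K r (join Ps).
Proof.
move=> H; apply: (roots_join (R := ok r)); last first.
  by move=> P mE HP; exact: H.
by move=> m E E' H1 H2; apply/ok_merge.
Qed.

Lemma wf_join S r (Ps : seq (pre S)) :
  (forall P, P \in Ps -> wf_pre r P) -> wf_pre r (join Ps).
Proof.
move=> H; apply/wf_preP; split.
  apply: mem_join_trees => [E E' HSh H1 H2|P E /H/wf_preP[+ _]]; last by apply.
  by constructor; rewrite ?HSh.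
apply: mem_join_cuts => [c c' HF [H1 H2 H3 H4] [H1' H2' H3' H4']|].
  by split=> //=; constructor=> //; rewrite ?H4 ?H4' /= -/(cut_formula _) ?HF.
by move=> P c /H/wf_preP[_]; apply.
Qed.

Lemma bounded_join S d V r (Ps : seq (pre S)) :
  (forall P, P \in Ps -> cuts_bounded d V r P) -> cuts_bounded d V r (join Ps).
Proof.
move=> H; apply: (cut_shallowP (R := fun F _ => qdepth F < d \/
    [/\ qdepth F = d, is_qua F & fsem 0 r F \in V])).
apply: mem_join_cuts => // P c HP Hc.
exact: (H _ HP _ (mem_cut_shallow Hc)).
Qed.

Lemma raw_join S (Ps : seq (pre S)) :
  (forall P, P \in Ps -> pre_closed P) ->
  uniq (flatten [seq pre_eigenvars P | P <- Ps]) -> raw (join Ps).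
Proof.
move=> Hc Hu; split.
- exact: join_cut_formulas.
- exact: join_uniq_Sh.
- by rewrite (perm_uniq (join_perm _)).
- by move=> A; rewrite join_Sh => /flattenP[_ /mapP[P HP ->]]; exact: Hc.
Qed.

Definition pre_map S (s : subst S) (P : pre S) : pre S :=
  Pre [seq Cut (esubst s (cpos c)) (esubst s (cneg c)) | c <- cuts P]
      [seq esubst s E | E <- trees P].

Lemma psubstE S s (P : pre S) : psubst s P = join [:: pre_map s P].
Proof. by rewrite /psubst /join /= !cats0. Qed.

Lemma pre_map_Sh S s (P : pre S) : pre_closed P -> pre_Sh (pre_map s P) = pre_Sh P.
Proof.
move=> H; rewrite /pre_Sh -map_comp; apply/eq_in_map => E HE /=.
rewrite Sh_esubst fsubst_id // => x Hx.
by case: (H _ (map_f _ HE) _ Hx).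
Qed.

Lemma psubst_Sh S s (P : pre S) :
  pre_closed P -> pre_Sh (psubst s P) =i pre_Sh P.
Proof. by move=> H A; rewrite psubstE join_Sh /= cats0 pre_map_Sh. Qed.

Lemma psubst_closed S s (P : pre S) : pre_closed P -> pre_closed (psubst s P).
Proof. by move=> H A; rewrite psubst_Sh //; exact: H. Qed.

Lemma psubst_perm S s (P : pre S) :
  perm_eq (pre_eigenvars (psubst s P)) (map (vsubst s) (pre_eigenvars P)).
Proof.
rewrite psubstE; apply: (perm_trans (join_perm _)); rewrite /= cats0.
rewrite !pre_eigenvarsE /= map_cat; apply: perm_cat.
  elim: (trees P) => //= E l IH; rewrite map_cat perm_cat //.
  exact: esubst_perm.
elim: (cuts P) => //= c l IH; rewrite !map_cat perm_cat //.
by rewrite perm_cat // esubst_perm.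
Qed.

Lemma psubst_size S s (P : pre S) : pre_size (psubst s P) = pre_size P.
Proof.
rewrite psubstE join_size /= addn0 /pre_size /= -!map_comp.
by congr (sumn _ + sumn _); apply: eq_map => ? /=; rewrite !nsize_esubst.
Qed.

Lemma psubst_holds S s (P : pre S) v :
  holds (fun a => v (asubst s a)) P -> holds v (psubst s P).
Proof.
move=> H; rewrite psubstE; apply: join_holds; rewrite /= orbF.
move: H; rewrite /holds /= !has_map => /orP[H|H]; apply/orP; [left|right].
  by apply: sub_has H => E /= /qeval_esubst.
by apply: sub_has H => c /andP[/qeval_esubst H1 /qeval_esubst H2]; apply/andP.
Qed.

Definition fixes_pre S (s : subst S) (P : pre S) :=
  forall y, y \in pre_eigenvars P -> s y = Var (vsubst s y).

Lemma fixes_tree S (s : subst S) P E :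
  fixes_pre s P -> E \in all_trees P -> fixes_eigenvars s E.
Proof.
by move=> H HE y Hy; apply: H; apply/flattenP; exists (eigenvars E) => //;
  apply: map_f.
Qed.

Lemma mem_roots S K (P : pre S) m E : (m, E) \in roots K P -> E \in all_trees P.
Proof. by rewrite (all_treesE K) => /(map_f snd). Qed.

Lemma ok_psubst S K r s (P : pre S) :
  pre_closed P -> fixes_pre s P -> ok_pre K (scomp r s) P ->
  ok_pre K r (psubst s P).
Proof.
move=> Hc Hs H; rewrite psubstE; apply: ok_join => P'; rewrite inE => /eqP ->.
apply: rootsP => [_ /mapP[E HE ->]|_ /mapP[c Hc' ->]] /=.
  rewrite /mtree Sh_esubst fsubst_id; last first.
    by move=> x Hx; case: (Hc _ (map_f _ HE) _ Hx).
  have HE' := roots_tree K HE; apply: ok_esubst (H _ HE').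
  exact: fixes_tree Hs (mem_roots HE').
have E b : mcut K b (Cut (esubst s (cpos c)) (esubst s (cneg c))) = mcut K b c.
  by rewrite /mcut /cut_formula /= Sh_esubst is_bin_fsubst.
rewrite !E; split.
  have HE' := roots_cpos K Hc'; apply: ok_esubst (H _ HE').
  exact: fixes_tree Hs (mem_roots HE').
have HE' := roots_cneg K Hc'; apply: ok_esubst (H _ HE').
exact: fixes_tree Hs (mem_roots HE').
Qed.

Lemma wf_psubst S r s (P : pre S) :
  fixes_pre s P -> wf_pre (scomp r s) P -> wf_pre r (psubst s P).
Proof.
move=> Hs H; rewrite psubstE; apply: wf_join => P'; rewrite inE => /eqP ->.
have HE E : E \in all_trees P -> wf r (esubst s E).
  move=> HE; apply: wf_esubst; first exact: fixes_tree Hs HE.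
  by case: H => + _ _; apply.
have [_ HC] := (wf_preP _ _).1 H.
apply/wf_preP; split=> [_ /mapP[E HE' ->]|_ /mapP[c Hc ->]] /=.
  by apply: HE; rewrite mem_cat HE'.
have [_ _ Hp Hd] := HC c Hc; split.
- exact: HE (mem_roots (roots_cpos (fun _ => None) Hc)).
- exact: HE (mem_roots (roots_cneg (fun _ => None) Hc)).
- by rewrite /cut_formula /= Sh_esubst positive_fsubst.
- by rewrite /cut_formula /= !Sh_esubst dual_fsubst !fsem_fsubst Hd.
Qed.

Lemma bounded_psubst S d V r s (P : pre S) :
  cuts_bounded d V (scomp r s) P -> cuts_bounded d V r (psubst s P).
Proof.
move=> H; rewrite psubstE; apply: bounded_join => P'; rewrite inE => /eqP ->.
apply: (cut_shallowP (R := fun F _ => qdepth F < d \/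
    [/\ qdepth F = d, is_qua F & fsem 0 r F \in V])) => _ /mapP[c Hc ->] /=.
rewrite /cut_formula /= Sh_esubst qdepth_fsubst is_qua_fsubst fsem_fsubst.
exact: (H _ (mem_cut_shallow Hc)).
Qed.

Lemma vsubst_single S a2 a1 x :
  vsubst (single a2 (Var a1) : subst S) x = if x == a2 then a1 else x.
Proof. by rewrite /vsubst /single; case: eqP. Qed.

Lemma fixes_single S (P : pre S) a2 a1 : fixes_pre (single a2 (Var a1)) P.
Proof. by move=> y _; rewrite vsubst_single /single; case: eqP. Qed.

Lemma merge_in_raw S (P : pre S) o P' :
  merge_in P o P' -> raw P -> raw P' /\ uniq (omerged o ++ pre_eigenvars P').
Proof.
move=> H [H1 H2 H3 H4].
have Hu : uniq (omerged o ++ pre_eigenvars P').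
  by rewrite -(perm_uniq (merge_in_perm H)).
split=> //; split.
- have E Q : [seq cut_formula c | c <- cuts Q] = unzip1 (cut_shallow Q).
    by rewrite /unzip1 /cut_shallow -map_comp.
  by rewrite E (merge_in_cut_shallow H) -E.
- by rewrite (merge_in_Sh H).
- by move: Hu; rewrite cat_uniq => /and3P[].
- by rewrite /pre_closed (merge_in_Sh H).
Qed.

Lemma rename_eigenvars S (P : pre S) a2 a1 :
  uniq (a2 :: pre_eigenvars P) ->
  perm_eq (pre_eigenvars (psubst (single a2 (Var a1)) P)) (pre_eigenvars P).
Proof.
move=> /= /andP[Ha Hu].
apply: (perm_trans (psubst_perm _ _)).
rewrite map_id_in // => x Hx; rewrite vsubst_single; case: eqP => // E.
by rewrite -E Hx in Ha.
Qed.

Lemma merge_step_raw S (P Q : pre S) : merge_step P Q -> raw P -> raw Q.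
Proof.
move=> /merge_stepE[o [P' [H ->]]] /(merge_in_raw H)[HP'].
case: o {H} => [[a2 a1]|] //= Hu; split.
- by rewrite psubstE; exact: join_cut_formulas.
- by rewrite psubstE; exact: join_uniq_Sh.
- by rewrite (perm_uniq (rename_eigenvars _ Hu)); case/andP: Hu.
- by apply: psubst_closed; case: HP'.
Qed.

Lemma merge_step_Sh S (P Q : pre S) :
  merge_step P Q -> raw P -> pre_Sh Q =i pre_Sh P.
Proof.
move=> /merge_stepE[o [P' [H ->]]] /(merge_in_raw H)[HP' _] A.
rewrite -(merge_in_Sh H); case: o {H} => [[a2 a1]|] //=.
by rewrite psubst_Sh //; case: HP'.
Qed.

Lemma merge_step_size S (P Q : pre S) : merge_step P Q -> pre_size Q < pre_size P.
Proof.
move=> /merge_stepE[o [P' [H ->]]]; have := merge_in_size H.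
by case: o {H} => [[a2 a1]|] //=; rewrite psubst_size.
Qed.

Lemma merge_step_tautology S (P Q : pre S) :
  merge_step P Q -> (forall v, holds v P) -> forall v, holds v Q.
Proof.
move=> /merge_stepE[o [P' [H ->]]] HP v; have HP' v' := merge_in_holds H (HP v').
by case: o {H} => [[a2 a1]|] //=; apply: psubst_holds.
Qed.

Lemma wf_pre_var S r (P : pre S) : wf_pre VVar P -> wf_pre r P.
Proof.
case=> H1 H2 H3; split=> // [E HE|F HF]; first exact: wf_var (H1 _ HE).
by congr fsem; apply: fsem_var_inj (H3 _ HF).
Qed.

Lemma merge_step_wf_var S (P Q : pre S) :
  merge_step P Q -> wf_pre VVar P -> wf_pre VVar Q.
Proof.
move=> /merge_stepE[o [P' [H ->]]] HP.
case: o H => [[a2 a1]|] /= H; last exact: merge_in_wf H _ HP.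
apply: wf_psubst; first exact: fixes_single.
apply: (merge_in_wf H); last exact: wf_pre_var.
by move=> _ _ [<- <-]; rewrite /scomp /single eqxx; case: eqP => //= ->.
Qed.

(* After the renaming of [a2] to [a1], the value of [a2] is reset; this is
   sound as both eigenvariables had the same value. *)
Lemma merge_step_good S K d V r (P Q : pre S) :
  merge_step P Q -> raw P -> good K d V r P -> exists r', good K d V r' Q.
Proof.
move=> /merge_stepE[o [P' [H ->]]] Hr [Hok Hdef Hwf Hb].
have [HP' Hu] := merge_in_raw H Hr.
have [Hok' Hi] := merge_in_ok H Hok.
have Hwf' := merge_in_wf H Hi Hwf.
have Hb' : cuts_bounded d V r P'.
  by rewrite /cuts_bounded (merge_in_cut_shallow H).
case: o H Hu Hi => [[a2 a1]|] /= H Hu Hi; last first.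
  exists r; split=> // x Hx; apply: Hdef.
  by rewrite (perm_mem (merge_in_perm H)).
pose r' (x : var) : val S := if x == a2 then VVar a2 else r x.
have Ha1 := merge_in_mem H erefl.
have E : scomp r' (single a2 (Var a1)) = r.
  apply: funext => x; rewrite /scomp /single; case: eqP => [->|/eqP/negbTE] /=.
    rewrite /r'; case: eqP => [E|_]; last exact: Hi.
    by move: Hu; rewrite -E Ha1.
  by rewrite /r' => ->.
exists r'; split.
- apply: ok_psubst; rewrite ?E //; first by case: HP'.
  exact: fixes_single.
- move=> x; rewrite (perm_mem (rename_eigenvars _ Hu)) /r'.
  case: eqP => [->//|/eqP Hx Hn]; apply: Hdef.
  by rewrite (perm_mem (merge_in_perm H)) in_cons negb_or Hx.
- by apply: wf_psubst; rewrite ?E //; exact: fixes_single.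
- by apply: bounded_psubst; rewrite E.
Qed.

Definition one_bin_cut S (P : pre S) :=
  forall F G, F \in cut_shallow P -> G \in cut_shallow P ->
  is_bin F.1 -> is_bin G.1 -> F.1 = G.1.

Lemma one_bin_join S (Ps : seq (pre S)) :
  (forall P P' F F', P \in Ps -> P' \in Ps -> F \in cut_shallow P ->
     F' \in cut_shallow P' -> is_bin F.1 -> is_bin F'.1 -> F.1 = F'.1) ->
  one_bin_cut (join Ps).
Proof.
move=> H.
have HE F : F \in cut_shallow (join Ps) ->
    exists P G, [/\ P \in Ps, G \in cut_shallow P & F.1 = G.1].
  move: F; apply: (cut_shallowP (R := fun A _ => exists P G,
    [/\ P \in Ps, G \in cut_shallow P & A = G.1])).
  apply: mem_join_cuts => // P c HP Hc.
  by exists P, (cut_formula c, Sh (cneg c)); split=> //; exact: mem_cut_shallow.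
move=> F F' /HE[P [G [HP HG ->]]] /HE[P' [G' [HP' HG' ->]]] h h'.
exact: H HP HP' HG HG' h h'.
Qed.

Lemma merge_step_one_bin S (P Q : pre S) :
  merge_step P Q -> one_bin_cut P -> one_bin_cut Q.
Proof.
move=> /merge_stepE[o [P' [H ->]]].
rewrite /one_bin_cut -(merge_in_cut_shallow H) => {}H.
case: o => [[a2 a1]|] //=; set s := single _ _; rewrite psubstE.
suff H' F : F \in cut_shallow (join [:: pre_map s P']) ->
    exists2 G, G \in cut_shallow P' & F.1 = fsubst G.1 s.
  move=> F F' /H'[G HG ->] /H'[G' HG' ->]; rewrite !is_bin_fsubst => h h'.
  by have -> := H G G' HG HG' h h'.
move: F; apply: (cut_shallowP (R := fun A _ => exists2 G, G \in cut_shallow P' &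
  A = fsubst G.1 s)).
apply: mem_join_cuts => // P'' c; rewrite inE => /eqP -> /mapP[c' Hc' ->].
exists (cut_formula c', Sh (cneg c')); first exact: mem_cut_shallow.
by rewrite /cut_formula /= Sh_esubst.
Qed.

Lemma normal_form_exists S (P : pre S) : exists Q, normal_form P Q.
Proof.
have [n] := ubnP (pre_size P); elim: n P => // n IH P; rewrite ltnS => Hn.
case: (pselect (exists R, merge_step P R)) => [[R HR]|H].
  have [|Q [H1 H2]] := IH R; first exact: leq_trans (merge_step_size HR) Hn.
  by exists Q; split=> //; apply: rt_trans H1; exact: rt_step.
by exists P; split=> [|R HR]; [exact: rt_refl|apply: H; exists R].
Qed.

Lemma normal_form_ind S (J : pre S -> Prop) (P Q : pre S) :
  (forall P Q, merge_step P Q -> J P -> J Q) -> normal_form P Q -> J P -> J Q.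
Proof. by move=> HJ [H _]; elim: H => // {P Q}; eauto. Qed.

(** * Injectivity of solutions *)

Inductive extends S (m : val S) : val S -> Prop :=
| ext_refl : extends m m
| ext_L v : extends m v -> extends m (VL v)
| ext_R v : extends m v -> extends m (VR v)
| ext_Ex v t : extends m v -> extends m (VEx v t)
| ext_All v : extends m v -> extends m (VAll v).

Fixpoint hlen S (v : val S) : nat :=
  match v with VL m | VR m | VEx m _ | VAll m => (hlen m).+1 | _ => 0 end.

Lemma extends_hlen S (m v : val S) : extends m v -> hlen m <= hlen v.
Proof. by elim=> //= *; exact: leqW. Qed.

Lemma extends_vsize S (m v : val S) : extends m v -> vsize m <= vsize v.
Proof. by elim=> //= *; lia. Qed.

Lemma extends_trans S (m v w : val S) : extends m v -> extends v w -> extends m w.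
Proof. by move=> H; elim=> // *; constructor. Qed.

Lemma extends_inj S (m m' v : val S) :
  extends m v -> extends m' v -> hlen m = hlen m' -> m = m'.
Proof.
move=> H; elim: H m' => [|w Hw IH|w Hw IH|w t Hw IH|w Hw IH] m'.
- move=> H'; inversion H' as [|? K|? K|? ? K|? K] => //; subst;
    by have := extends_hlen K => /=; lia.
- move=> H; inversion H; subst; last exact: IH.
  by have := extends_hlen Hw => /=; lia.
- move=> H; inversion H; subst; last exact: IH.
  by have := extends_hlen Hw => /=; lia.
- move=> H; inversion H; subst; last exact: IH.
  by have := extends_hlen Hw => /=; lia.
- move=> H; inversion H; subst; last exact: IH.
  by have := extends_hlen Hw => /=; lia.
Qed.

Lemma eqs_below S r m (E : tree S) y v :
  (y, v) \in eqs r (Below m) E -> exists2 h, v = VAll h & extends m h.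
Proof.
elim/tree_children_ind: E m => //= [c E1 IH1 E2 IH2|A l IH|A x E IH|E1 IH1 E2 IH2] m.
- rewrite mem_cat => /orP[/IH1|/IH2] [h -> Hh]; exists h => //;
    by apply: extends_trans Hh; constructor; constructor.
- case/flattenP => _ /mapP[[t E] Hl ->] /(IH _ _ Hl)[h -> Hh].
  by exists h => //; apply: extends_trans Hh; constructor; constructor.
- rewrite in_cons => /orP[/eqP[_ ->]|/IH[h -> Hh]].
    by exists m => //; constructor.
  by exists h => //; apply: extends_trans Hh; constructor; constructor.
- by rewrite mem_cat => /orP[/IH1|/IH2].
Qed.

Lemma eqs_above S r p (E : tree S) y v :
  (y, v) \in eqs r (Above p) E ->
  exists q b h, [/\ v = VAll h, extends (VRoot q b) h &
    if p is Some p0 then exists2 p', q = Some p' & extends p0 p' else q = None].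
Proof.
elim/tree_children_ind: E p => //= [c E1 IH1 E2 IH2|A l IH|A x E IH|E1 IH1 E2 IH2] p.
- rewrite mem_cat => /orP[/IH1|/IH2] [q [b [h [-> Hh Hp]]]]; exists q, b, h;
    split=> //; case: p Hp => //= p0 [p' -> Hp]; exists p' => //;
    by apply: extends_trans Hp; constructor; constructor.
- case/flattenP => _ /mapP[[t E] Hl ->] /eqs_below[h -> Hh].
  exists p, (VQua Ex (fsem 1 (vlift 0 r) A)), h; split=> //.
    by apply: extends_trans Hh; constructor; constructor.
  by case: p {Hh} => // p0; exists p0 => //; constructor.
- rewrite in_cons => /orP[/eqP[_ ->]|/eqs_below[h -> Hh]].
    exists p, (VQua All (fsem 1 (vlift 0 r) A)), (VRoot p (VQua All (fsem 1 (vlift 0 r) A))).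
    split=> //; first exact: ext_refl.
    by case: p => // p0; exists p0 => //; constructor.
  exists p, (VQua All (fsem 1 (vlift 0 r) A)), h; split=> //.
    by apply: extends_trans Hh; constructor; constructor.
  by case: p {Hh} => // p0; exists p0 => //; constructor.
- by rewrite mem_cat => /orP[/IH1|/IH2].
Qed.

Lemma eqs_quantified S r p (E : tree S) y v :
  wf r E -> ~~ is_bin (Sh E) -> (y, v) \in eqs r (Above p) E ->
  exists2 h, v = VAll h & extends (VRoot p (fsem 0 r (Sh E))) h.
Proof.
elim/tree_children_ind: E => //= [A l _|A x E _|E1 IH1 E2 IH2].
- move=> _ _ /flattenP[_ /mapP[[t E] Hl ->]] /eqs_below[h -> Hh].
  by exists h => //; apply: extends_trans Hh; constructor; constructor.
- move=> _ _; rewrite in_cons => /orP[/eqP[_ ->]|/eqs_below[h -> Hh]].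
    by eexists; [reflexivity|constructor].
  by exists h => //; apply: extends_trans Hh; constructor; constructor.
- move=> /wf_mergeE[H1 H2 HSh] Hb; rewrite mem_cat => /orP[/(IH1 H1 Hb)//|].
  by rewrite HSh; apply: IH2 => //; rewrite -(fsem_is_bin HSh).
Qed.

Lemma ok_nice S K r (P : pre S) :
  ok_pre K r P -> default_off_eigenvars r P -> forall x, nice 0 (r x).
Proof.
move=> Hok Hd x; case: (boolP (x \in pre_eigenvars P)) => [|/Hd ->] //.
rewrite /pre_eigenvars (all_treesE K) => /flattenP[_ /mapP[_ /mapP[[m E] HE ->] ->]].
move=> /(eigenvars_eqs r m)[v Hv]; rewrite (Hok _ HE _ _ Hv) /=.
case: m HE Hv => [p _ /eqs_above[q [b [h [-> //]]]]|m _ /eqs_below[h -> //]].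
Qed.

Definition merge_normal S (E : tree S) := forall o E', ~ merge_tree E o E'.

Definition is_merge S (E : tree S) : bool := if E is TMerge _ _ then true else false.

Definition injective_on_shallow S (r : var -> val S) (E : tree S) :=
  forall x y, occ_formula x (Sh E) -> r x = r y -> x = y.

Lemma normal_merge1 S (E1 E2 : tree S) : merge_normal (TMerge E1 E2) -> merge_normal E1.
Proof. by move=> H o E' /(in_merge1 E2) /H. Qed.

Lemma normal_merge2 S (E1 E2 : tree S) : merge_normal (TMerge E1 E2) -> merge_normal E2.
Proof. by move=> H o E' /(in_merge2 E1) /H. Qed.

Lemma normal_not_merge S r (E : tree S) :
  (forall x, nice 0 (r x)) -> merge_normal E -> wf r E ->
  injective_on_shallow r E -> ~~ is_merge E.
Proof.
move=> Hn; elim/tree_children_ind: E => // E1 IH1 E2 IH2 HN.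
move=> /wf_mergeE[W1 W2 HSh] Hi.
have {}HSh := fsem_inj Hn Hi HSh.
have := IH1 (normal_merge1 HN) W1 Hi.
have := IH2 (normal_merge2 HN) W2; rewrite /injective_on_shallow -HSh => /(_ Hi).
case: E1 HN HSh {IH1 IH2 W1 W2 Hi} => // [b a|c E1 E1'|A l|A y E1].
- case: E2 => // b' a' HN [? ?]; subst; by case: (HN _ _ (merge_lit _ _)).
- case: E2 => // c' E2 E2' HN [? _ _]; subst.
  by case: (HN _ _ (merge_bin _ _ _ _ _)).
- case: E2 => // A' l' HN [?]; subst; by case: (HN _ _ (merge_ex _ _ _)).
- case: E2 => // A' y' E2 HN [?]; subst.
  by case: (HN _ _ (merge_all _ _ _ _ _)).
Qed.

Lemma normal_bin_not_merge S r (E : tree S) :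
  merge_normal E -> wf r E -> is_bin (Sh E) -> ~~ is_merge E.
Proof.
elim/tree_children_ind: E => // E1 IH1 E2 IH2 HN /wf_mergeE[W1 W2 HSh] Hb.
have := IH1 (normal_merge1 HN) W1 Hb.
have := IH2 (normal_merge2 HN) W2; rewrite -(fsem_is_bin HSh) => /(_ Hb).
case: E1 HN HSh Hb {IH1 IH2 W1 W2} => // c E1 E1'.
case: E2 => // c' E2 E2' HN [? _ _] _; subst.
by case: (HN _ _ (merge_bin _ _ _ _ _)).
Qed.

Lemma normal_bin1 S c (E1 E2 : tree S) : merge_normal (TBin c E1 E2) -> merge_normal E1.
Proof. by move=> H o E' /(in_bin1 c E2) /H. Qed.

Lemma normal_bin2 S c (E1 E2 : tree S) : merge_normal (TBin c E1 E2) -> merge_normal E2.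
Proof. by move=> H o E' /(in_bin2 c E1) /H. Qed.

Lemma normal_all S A y (E : tree S) : merge_normal (TAll A y E) -> merge_normal E.
Proof. by move=> H o E' /(in_all A y) /H. Qed.

Lemma normal_ex S A (l : seq (term S var * tree S)) t E :
  merge_normal (TEx A l) -> (t, E) \in l -> merge_normal E.
Proof. by move=> H Hl o E'; case/splitPr: Hl H => l1 l2 H /in_ex => /(_ A l1 t l2) /H. Qed.

Lemma wf_is_tree S r (E : tree S) :
  (forall x, nice 0 (r x)) -> (forall x y, r x = r y -> x = y) ->
  merge_normal E -> wf r E -> is_tree E.
Proof.
move=> Hn Hi; elim/tree_children_ind: E => [b a|c E1 IH1 E2 IH2|A l IH|A y E IH|E1 IH1 E2 IH2] HN HW.
- by constructor.
- case/wf_binE: HW => W1 W2.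
  by constructor; [apply: IH1 (normal_bin1 HN) W1|apply: IH2 (normal_bin2 HN) W2].
- case/wf_exE: HW => Hu H; constructor => // t E Hl; last by case: (H t E Hl).
  by apply: (IH t E Hl); [apply: normal_ex HN Hl|case: (H t E Hl)].
- by case/wf_allE: HW => W HSh; constructor=> //; apply: IH (normal_all HN) W.
- by have /negP[] := normal_not_merge Hn HN HW (fun x y _ => Hi x y).
Qed.

Lemma vsize_Qua S q (A : formula S (option var)) r x :
  occ_formula (Some x) A -> vsize (r x) < vsize (fsem 0 r (Qua q A)).
Proof. by move=> H; apply: (vsize_fsem (A := Qua q A)). Qed.

(* The order of induction is the size of the value; the variables in the
   shallow formula of a subtree have smaller values than its eigenvariables. *)
Definition smaller_inj S (r : var -> val S) (s : nat) :=
  forall x y, vsize (r x) < s -> r x = r y -> x = y.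

Definition small_shallow S (r : var -> val S) (s : nat) (E : tree S) :=
  forall z, occ_formula z (Sh E) -> vsize (r z) < s.

Lemma eigenvar_inj_below S r m (E : tree S) x y :
  (forall z, nice 0 (r z)) -> smaller_inj r (vsize (r x)) ->
  merge_normal E -> wf r E -> ok r (Below m) E ->
  small_shallow r (vsize (r x)) E ->
  x \in eigenvars E -> y \in eigenvars E -> r x = r y -> x = y.
Proof.
move=> Hn Hi.
elim/tree_children_ind: E m => // [c E1 IH1 E2 IH2|A l IH|A z E IH|E1 _ E2 _] m HN HW Hok Hs.
- have [W1 W2] := wf_binE HW; have /ok_bin[O1 O2] := Hok.
  have S1 : small_shallow r (vsize (r x)) E1 by move=> z Hz; apply: Hs; left.
  have S2 : small_shallow r (vsize (r x)) E2 by move=> z Hz; apply: Hs; right.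
  have Hd u v : u \in eigenvars E1 -> v \in eigenvars E2 -> r u <> r v.
    move=> /(ok_eqs O1)/eqs_below[h -> Hh] /(ok_eqs O2)/eqs_below[h' -> Hh'] [E].
    by rewrite -E in Hh'; have := extends_inj Hh Hh' erefl.
  rewrite /= !mem_cat => /orP[Hx|Hx] /orP[Hy|Hy] Hxy.
  + exact: IH1 (normal_bin1 HN) W1 O1 S1 Hx Hy Hxy.
  + by case: (Hd _ _ Hx Hy).
  + by case: (Hd _ _ Hy Hx).
  + exact: IH2 (normal_bin2 HN) W2 O2 S2 Hx Hy Hxy.
- have [Hu HW'] := wf_exE HW.
  move=> /flattenP[_ /mapP[[t E] Ht ->] Hx] /flattenP[_ /mapP[[u F] Hu' ->] Hy] Hxy.
  have /ok_ex Oex := Hok; have Ot := Oex t E Ht; have Ou := Oex u F Hu'.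
  have [h Exh Hh] := eqs_below (ok_eqs Ot Hx).
  have [h' Ey Hh'] := eqs_below (ok_eqs Ou Hy).
  have E' : h = h' by rewrite Exh Ey in Hxy; case: Hxy.
  rewrite -E' in Hh'; have [Etu] := extends_inj Hh Hh' erefl.
  have Hlt z : occ_term z t -> vsize (r z) < vsize (r x).
    move=> Hz; have := vsize_tsem r Hz; have := extends_vsize Hh.
    by rewrite Exh /=; lia.
  have Etu' : t = u.
    apply: (tsem_inj (k := 0) _ _ Etu) => // v w /Hlt; exact: Hi.
  subst u; have EF : E = F.
    have [i Hi' Ei] := nthP (t, E) Ht; have [j Hj Ej] := nthP (t, E) Hu'.
    have := nth_uniq t _ _ Hu.
    move/(_ i j); rewrite /unzip1 size_map (nth_map (t, E)) // (nth_map (t, E)) //.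
    rewrite Ei Ej eqxx => /(_ Hi' Hj) /esym /eqP Eij.
    by have := etrans (esym Ei) (etrans (congr1 (nth (t, E) l) Eij) Ej) => -[].
  subst F; have [WE SE] := HW' t E Ht.
  apply: (IH t E Ht _ (normal_ex HN Ht) WE Ot _ Hx Hy Hxy).
  move=> z; rewrite SE => Hz; case: (occ_inst Hz) => [K|]; last exact: Hlt.
  exact: Hs.
- have [W SE] := wf_allE HW; have /ok_all[Oz OE] := Hok.
  have Hd u : u \in eigenvars E -> extends (VAll m) (r u) /\ r u <> r z.
    move=> /(ok_eqs OE)/eqs_below[h -> Hh].
    split; first by apply: extends_trans Hh _; constructor; constructor.
    by rewrite Oz /= => -[Eh]; have := extends_hlen Hh; rewrite Eh /=; lia.
  rewrite /= !in_cons => /orP[/eqP ->|Hx] /orP[/eqP ->|Hy] Hxy //.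
  + by case: (Hd _ Hy).2; rewrite Hxy.
  + by case: (Hd _ Hx).2; rewrite Hxy.
  + apply: (IH _ (normal_all HN) W OE) => // w; rewrite SE => Hw.
    case: (occ_inst Hw) => [K|/= ->]; first exact: Hs.
    have [h Exh Hh] := eqs_below (ok_eqs OE Hx).
    by rewrite Oz Exh /=; have := extends_vsize Hh; rewrite /=; lia.
- by have /negP[] := normal_not_merge Hn HN HW (fun u v Hu => Hi u v (Hs u Hu)).
Qed.

Lemma eigenvar_inj_quantified S r p (E : tree S) x y :
  (forall z, nice 0 (r z)) -> smaller_inj r (vsize (r x)) ->
  merge_normal E -> wf r E -> ok r (Above p) E -> ~~ is_bin (Sh E) ->
  x \in eigenvars E -> y \in eigenvars E -> r x = r y -> x = y.
Proof.
move=> Hn Hi HN HW Hok Hb Hx.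
have [h Exh Hh] := eqs_quantified HW Hb (ok_eqs Hok Hx).
have Hs : small_shallow r (vsize (r x)) E.
  move=> z Hz; rewrite Exh /=; have := extends_vsize Hh.
  by have := vsize_fsem 0 r Hz; rewrite /=; lia.
have HM : ~~ is_merge E.
  apply: normal_not_merge HN HW _ => // u v /Hs; exact: Hi.
move: Hx; case: E HN HW Hok Hs HM Hb {Hh} => // [A l|A z E] HN HW Hok Hs _ _.
  exact: (eigenvar_inj_below (m := VRoot p (fsem 0 r (Qua Ex A))) Hn Hi HN HW Hok Hs).
exact: (eigenvar_inj_below (m := VRoot p (fsem 0 r (Qua All A))) Hn Hi HN HW Hok Hs).
Qed.

Lemma eigenvar_inj_above S r p (E : tree S) x y :
  (forall z, nice 0 (r z)) -> smaller_inj r (vsize (r x)) ->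
  merge_normal E -> wf r E -> ok r (Above (Some p)) E ->
  x \in eigenvars E -> y \in eigenvars E -> r x = r y -> x = y.
Proof.
move=> Hn Hi; elim/tree_children_ind: E p => // [c E1 IH1 E2 IH2|A l _|A z E _|E1 _ E2 _] p HN HW Hok.
- have [W1 W2] := wf_binE HW; have /ok_bin[O1 O2] := Hok.
  have Hd u v : u \in eigenvars E1 -> v \in eigenvars E2 -> r u <> r v.
    move=> /(ok_eqs O1)/eqs_above[q [b [h [-> Hh [p1 Eq Hp]]]]].
    move=> /(ok_eqs O2)/eqs_above[q' [b' [h' [-> Hh' [p1' Eq' Hp']]]]] [E].
    rewrite -E in Hh'; have [Eqq _] := extends_inj Hh Hh' erefl.
    rewrite -Eqq Eq in Eq'; case: Eq' => E'; rewrite -E' in Hp'.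
    by have := extends_inj Hp Hp' erefl.
  rewrite /= !mem_cat => /orP[Hx|Hx] /orP[Hy|Hy] Hxy.
  + exact: IH1 (normal_bin1 HN) W1 O1 Hx Hy Hxy.
  + by case: (Hd _ _ Hx Hy).
  + by case: (Hd _ _ Hy Hx).
  + exact: IH2 (normal_bin2 HN) W2 O2 Hx Hy Hxy.
- exact: eigenvar_inj_quantified HN HW Hok _.
- exact: eigenvar_inj_quantified HN HW Hok _.
- case: (boolP (is_bin (Sh (TMerge E1 E2)))) => Hb.
    by have := normal_bin_not_merge HN HW Hb.
  exact: eigenvar_inj_quantified HN HW Hok Hb.
Qed.

Definition side S (b : bool) (c : cut S) : tree S := if b then cpos c else cneg c.

Lemma roots_cases S K (P : pre S) mE :
  mE \in roots K P ->
  (exists2 E, E \in trees P & mE = (mtree E, E)) \/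
  (exists c b, c \in cuts P /\ mE = (mcut K b c, side b c)).
Proof.
move: mE; apply: rootsP => [E HE|c Hc]; first by left; exists E.
by split; right; exists c; [exists true|exists false].
Qed.

Lemma normal_roots S K (P : pre S) mE :
  (forall Q, ~ merge_step P Q) -> mE \in roots K P -> merge_normal mE.2.
Proof.
case: P => C T HN; move: mE; apply: rootsP => /= [E HE|[F G] Hc]; last split.
- case/splitPr: HE HN => T1 T2 HN o E' H.
  exact: HN _ (merge_in_tree C T1 T2 H).
- case/splitPr: Hc HN => C1 C2 HN o E' H.
  exact: HN _ (merge_in_cpos C1 G C2 T H).
- case/splitPr: Hc HN => C1 C2 HN o E' H.
  exact: HN _ (merge_in_cneg C1 F C2 T H).
Qed.

Lemma pre_eigenvars_root S K (P : pre S) x :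
  x \in pre_eigenvars P -> exists2 mE, mE \in roots K P & x \in eigenvars mE.2.
Proof.
rewrite /pre_eigenvars (all_treesE K).
by move=> /flattenP[_ /mapP[_ /mapP[mE HE ->] ->]]; exists mE.
Qed.

Lemma uniq_map_inj (T1 T2 : eqType) (f : T1 -> T2) (s : seq T1) x y :
  uniq (map f s) -> x \in s -> y \in s -> f x = f y -> x = y.
Proof.
move=> Hu Hx Hy E; have [i Hi Ei] := nthP x Hx; have [j Hj Ej] := nthP x Hy.
have := nth_uniq (f x) _ _ Hu; move/(_ i j); rewrite size_map !(nth_map x) //.
by rewrite Ei Ej E eqxx => /(_ Hi Hj) /esym /eqP Eij; rewrite -Ei -Ej Eij.
Qed.

Lemma same_value_tag S r p p' (E E' : tree S) x y v :
  (x, v) \in eqs r (Above p) E -> (y, v) \in eqs r (Above p') E' ->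
  match p, p' with
  | Some q, Some q' => hlen q = hlen q' -> q = q'
  | None, None => True
  | _, _ => False
  end.
Proof.
move=> /eqs_above[q [b [h [-> Hh Hq]]]] /eqs_above[q' [b' [h' [[E2] Hh' Hq']]]].
rewrite -E2 in Hh'; have [Eq _] := extends_inj Hh Hh' erefl.
subst q'; case: p p' Hq Hq' => [p|] [p'|] //=.
- by move=> [q1 -> H1] [q2 [<-] H2]; exact: extends_inj H1 H2.
- by move=> [q1 ->].
- by move=> -> [q2].
Qed.

Definition tagged S (K : bool -> option (val S)) (P : pre S) :=
  forall c, c \in cuts P -> is_bin (cut_formula c) -> forall b, K b = Some (VTag b).

Lemma one_bin_cutP S (P : pre S) c c' :
  one_bin_cut P -> c \in cuts P -> c' \in cuts P ->
  is_bin (cut_formula c) -> is_bin (cut_formula c') ->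
  cut_formula c = cut_formula c'.
Proof. by move=> H Hc Hc'; exact: (H _ _ (mem_cut_shallow Hc) (mem_cut_shallow Hc')). Qed.

(* Eigenvariables with equal values are at the same position, and in a normal
   form a position determines the eigenvariable. *)
Lemma solution_inj S K r (P : pre S) :
  raw P -> wf_pre r P -> ok_pre K r P -> default_off_eigenvars r P ->
  (forall Q, ~ merge_step P Q) -> tagged K P -> one_bin_cut P ->
  forall x y, r x = r y -> x = y.
Proof.
move=> [Rc RS _ _] HW Hok Hd HN HT H1.
have Hn := ok_nice Hok Hd.
have HA x : x \in pre_eigenvars P -> exists h, r x = VAll h.
  move=> /(pre_eigenvars_root K)[[m E] HE /= Hx].
  have := ok_eqs (Hok _ HE) Hx.
  case: m {HE} => [p /eqs_above[q [b [h [-> _ _]]]]|m /eqs_below[h -> _]]; by exists h.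
move=> x; have [n] := ubnP (vsize (r x)); elim: n x => // n IH x; rewrite ltnS => Hx y Hxy.
have Hi : smaller_inj r (vsize (r x)).
  by move=> u v Hu; apply: IH; exact: leq_trans Hu Hx.
case: (boolP (x \in pre_eigenvars P)) => [Px|Px]; last first.
  case: (boolP (y \in pre_eigenvars P)) => [/HA[h Ey]|Py].
    by move: Hxy; rewrite (Hd x Px) Ey.
  by move: Hxy; rewrite (Hd x Px) (Hd y Py) => -[].
case: (boolP (y \in pre_eigenvars P)) => [Py|Py]; last first.
  by move: Hxy; have [h ->] := HA _ Px; rewrite (Hd y Py).
have [[m E] HE /= HxE] := pre_eigenvars_root K Px.
have [[m' E'] HE' /= HyE'] := pre_eigenvars_root K Py.
have WE mE : mE \in roots K P -> wf r mE.2.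
  by case: HW => + _ _ H; apply; rewrite (all_treesE K) map_f.
have Hdual c b : c \in cuts P ->
    fsem 0 r (Sh (side b c)) =
    fsem 0 r (if b then cut_formula c else dual (cut_formula c)).
  by case: b => // Hc; case: HW => _ _ /(_ _ (mem_cut_shallow Hc)).
have Hpos c : c \in cuts P -> positive (cut_formula c).
  by move=> Hc; case: HW => _ /(_ _ (mem_cut_shallow Hc)).
have Hbin c b : c \in cuts P -> is_bin (Sh (side b c)) = is_bin (cut_formula c).
  by move=> /(Hdual _ b) /fsem_is_bin ->; case: b; rewrite ?is_bin_dual.
have Key : (m, E) = (m', E').
  have Ox := ok_eqs (Hok _ HE) HxE.
  have Oy : (y, r x) \in eqs r m' E' by rewrite Hxy; exact: ok_eqs (Hok _ HE') HyE'.
  have WEE := WE _ HE; have WEE' := WE _ HE'.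
  case: (roots_cases HE) => [[E0 HE0 [Em EE]]|[c [b [Hc [Em EE]]]]];
    case: (roots_cases HE') => [[E0' HE0' [Em' EE']]|[c' [b' [Hc' [Em' EE']]]]];
    subst m m' E E'; have Heq := same_value_tag Ox Oy.
  + have [/fsem_var_inj HSh] := Heq erefl.
    by rewrite (uniq_map_inj RS HE0 HE0' HSh).
  + by move: Heq; case: ifP => [/(HT _ Hc') ->|_] //= /(_ erefl).
  + by move: Heq; case: ifP => [/(HT _ Hc) ->|_] //= /(_ erefl).
  + suff [-> ->] : c = c' /\ b = b' by [].
    move: Heq Ox Oy; rewrite /mcut.
    case: ifP => [Hb|/negbT Hb]; case: ifP => [Hb'|/negbT Hb'];
      rewrite ?(HT _ Hc Hb b) ?(HT _ Hc' Hb' b') //.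
      move=> /(_ erefl)[->] _ _; split=> //.
      exact: (uniq_map_inj Rc Hc Hc' (one_bin_cutP H1 Hc Hc' Hb Hb')).
    move=> _ Ox Oy.
    have [|h E1 Hh] := eqs_quantified WEE _ Ox; first by rewrite Hbin.
    have [|h' E2 Hh'] := eqs_quantified WEE' _ Oy; first by rewrite Hbin.
    move: E2; rewrite E1 => -[E2]; rewrite -E2 in Hh'.
    have [] := extends_inj Hh Hh' erefl; rewrite !Hdual // => HF.
    have Eb : b = b'.
      have := fsem_positive HF; have := Hpos _ Hc; have := Hpos _ Hc'.
      by case: b b' {Ox Oy WEE WEE' Hh Hh' HxE HyE' HE HE' HF} => [] [];
        rewrite ?positive_dual => -> ->.
    split=> //; apply: (uniq_map_inj Rc Hc Hc').
    have HF' : (if b then cut_formula c else dual (cut_formula c)) =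
               (if b then cut_formula c' else dual (cut_formula c')).
      rewrite -Eb in HF; apply: (fsem_inj Hn _ HF) => u v Hu; apply: Hi.
      apply: leq_trans (vsize_fsem 0 r Hu) _; rewrite -Hdual // E1.
      exact: leqW (ltnW (extends_vsize Hh)).
    by case: (b) HF' => // HF'; rewrite -(dualK (cut_formula c)) HF' dualK.
have HNE := normal_roots HN HE.
case: Key => Em EE; subst m' E'.
case: (roots_cases HE) => [[E0 HE0 [Em EE]]|[c [b [Hc [Em EE]]]]].
  subst; exact: eigenvar_inj_above HNE (WE _ HE) (Hok _ HE) HxE HyE' Hxy.
case: (boolP (is_bin (Sh E))) => Hb; last first.
  subst m; exact: eigenvar_inj_quantified HNE (WE _ HE) (Hok _ HE) Hb HxE HyE' Hxy.
subst; rewrite Hbin // in Hb; move: (Hok _ HE); rewrite /= /mcut Hb (HT _ Hc Hb).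
by move=> OE; exact: eigenvar_inj_above HNE (WE _ HE) OE HxE HyE' Hxy.
Qed.

(** * Existence of solutions *)

Inductive ranked S (r : var -> nat) : (var -> Prop) -> tree S -> Prop :=
| rk_lit X b a : ranked r X (TLit b a)
| rk_bin X c E1 E2 : ranked r X E1 -> ranked r X E2 -> ranked r X (TBin c E1 E2)
| rk_ex X A l :
    (forall t E, (t, E) \in l -> ranked r (fun z => X z \/ occ_term z t) E) ->
    ranked r X (TEx A l)
| rk_all X A y E :
    (forall z, X z -> r z < r y) -> ranked r X E -> ranked r X (TAll A y E).

Lemma ranked_lt S r X (E : tree S) y z :
  ranked r X E -> y \in eigenvars E -> X z -> r z < r y.
Proof.
move=> H; elim: H y z => {X E} //= [X c E1 E2 _ IH1 _ IH2|X A l _ IH|X A x E Hx _ IH] y z.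
- by rewrite mem_cat => /orP[/IH1|/IH2]; apply.
- move=> /flattenP[_ /mapP[[t E] Hl ->] Hy] Hz.
  by apply: (IH t E Hl) => //; left.
- by rewrite in_cons => /orP[/eqP -> /Hx|/IH]; [|apply].
Qed.

Definition is_above S (m : mode S) : Prop := if m is Above _ then True else False.

Lemma eqs_causal S r X (E : tree S) (r1 r2 : var -> val S) m y v :
  ranked r X E -> (is_above m -> forall z, occ_formula z (Sh E) -> X z) ->
  (forall z, r z < r y -> r1 z = r2 z) ->
  (y, v) \in eqs r1 m E -> (y, v) \in eqs r2 m E.
Proof.
move=> H; elim: H m => {X E} //=.
- move=> X c E1 E2 _ IH1 _ IH2 m HX Hr; rewrite !mem_cat => /orP[H|H].
    by rewrite IH1 //; case: m HX {H} => //= p HX _ z Hz; apply: HX => //; left.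
  by rewrite IH2 ?orbT //; case: m HX {H} => //= p HX _ z Hz; apply: HX => //; right.
- move=> X A l HR IH m HX Hr /flattenP[_ /mapP[[t E] Hl ->] Hy].
  apply/flattenP; eexists; [apply/mapP; exists (t, E); [exact: Hl|reflexivity]|].
  have Hlt z : X z \/ occ_term z t -> r1 z = r2 z.
    by move=> Hz; apply: Hr; exact: ranked_lt (HR _ _ Hl) (mem_eqs Hy) Hz.
  have <- : hist m (fsem 0 r1 (Qua Ex A)) = hist m (fsem 0 r2 (Qua Ex A)).
    case: m HX {Hy} => //= p HX; congr VRoot; apply: (fsem_ext (A := Qua Ex A)).
    by move=> z Hz; apply: Hlt; left; exact: HX.
  have <- : tsem r1 t = tsem r2 t.
    by apply: tsem_ext => z Hz; apply: Hlt; right.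
  by apply: (IH t E Hl).
- move=> X A x E Hx HR IH m HX Hr H.
  have Hy : y = x \/ y \in eigenvars E.
    by move: H; rewrite in_cons => /orP[/eqP[-> _]|/mem_eqs]; [left|right].
  have Hlt z : X z -> r1 z = r2 z.
    move=> Hz; apply: Hr; case: Hy => [->|Hy]; first exact: Hx.
    exact: ranked_lt HR Hy Hz.
  have Eh : hist m (fsem 0 r1 (Qua All A)) = hist m (fsem 0 r2 (Qua All A)).
    case: m HX {H} => //= p HX; congr VRoot; apply: (fsem_ext (A := Qua All A)).
    by move=> z Hz; apply: Hlt; exact: HX.
  move: H; rewrite /= in Eh *; rewrite Eh !in_cons => /orP[->//|H].
  by apply/orP; right; apply: IH H.
Qed.

Definition eqs_system S (r : var -> val S) (sys : seq (mode S * tree S)) :=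
  flatten [seq eqs r mE.1 mE.2 | mE <- sys].

Definition system_eigenvars S (sys : seq (mode S * tree S)) : seq var :=
  flatten [seq eigenvars mE.2 | mE <- sys].

Definition ok_system S (r : var -> val S) (sys : seq (mode S * tree S)) :=
  forall mE, mE \in sys -> ok r mE.1 mE.2.

Definition ranked_system S (r : var -> nat) (sys : seq (mode S * tree S)) :=
  forall mE, mE \in sys -> exists2 X, ranked r X mE.2 &
    (is_above mE.1 -> forall z, occ_formula z (Sh mE.2) -> X z).

Lemma eqs_system_keys S r (sys : seq (mode S * tree S)) :
  unzip1 (eqs_system r sys) = system_eigenvars sys.
Proof.
rewrite /unzip1 map_flatten -map_comp; congr flatten.
by apply: eq_map => mE; exact: eqs_keys.
Qed.

Lemma eqs_system_causal S r (sys : seq (mode S * tree S)) r1 r2 y v :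
  ranked_system r sys -> (forall z, r z < r y -> r1 z = r2 z) ->
  (y, v) \in eqs_system r1 sys -> (y, v) \in eqs_system r2 sys.
Proof.
move=> HR Hr /flattenP[_ /mapP[mE HE ->] H]; have [X HX Ha] := HR mE HE.
apply/flattenP; exists (eqs r2 mE.1 mE.2); first by apply/mapP; exists mE.
exact: eqs_causal HX Ha Hr H.
Qed.

Lemma ok_systemP S r (sys : seq (mode S * tree S)) :
  ok_system r sys <-> forall y v, (y, v) \in eqs_system r sys -> r y = v.
Proof.
split=> [H y v /flattenP[_ /mapP[mE HE ->]]|H mE HE y v Hy]; first exact: H.
by apply: H; apply/flattenP; exists (eqs r mE.1 mE.2) => //; apply: map_f.
Qed.

(* The prescribed values only depend on values of smaller rank, so iterating
   the prescription stabilises. *)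
Lemma solve S r (sys : seq (mode S * tree S)) (r0 : var -> val S) :
  ranked_system r sys -> uniq (system_eigenvars sys) ->
  exists2 rho, ok_system rho sys &
    forall x, x \notin system_eigenvars sys -> rho x = r0 x.
Proof.
move=> HR Hu.
pose next (rho : var -> val S) x := match pselect (exists v, (x, v) \in eqs_system rho sys) with
  | left h => projT1 (cid h) | right _ => r0 x end.
have next_in rho x v : (x, v) \in eqs_system rho sys -> next rho x = v.
  rewrite /next; case: pselect => h; last by move=> Hv; case: h; exists v.
  case: (cid h) => w /= Hw Hv.
  suff: (x, w) = (x, v) by case.
  apply: (uniq_map_inj (f := fst) _ Hw Hv erefl).
  by rewrite -/(unzip1 _) eqs_system_keys.
have next_out rho x : x \notin system_eigenvars sys -> next rho x = r0 x.
  move=> Hx; rewrite /next; case: pselect => // -[v Hv].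
  by rewrite -(eqs_system_keys rho) (map_f fst Hv) in Hx.
have next_eq r1 r2 x : (forall z, r z < r x -> r1 z = r2 z) -> next r1 x = next r2 x.
  move=> H; case: (boolP (x \in system_eigenvars sys)) => Hx; last by rewrite !next_out.
  move: Hx; rewrite -(eqs_system_keys r1) => /mapP[[y v] Hv /= Ex]; rewrite -Ex in Hv.
  by rewrite (next_in _ _ _ Hv) (next_in _ _ _ (eqs_system_causal HR H Hv)).
have stable k x : r x < k -> next (iter k next r0) x = iter k next r0 x.
  elim: k x => // k IH x Hx /=; apply: next_eq => z Hz.
  by rewrite /= IH //; exact: leq_trans Hz Hx.
pose k := (\max_(x <- system_eigenvars sys) r x).+1.
exists (next (iter k next r0)) => [|x]; last exact: next_out.
apply/ok_systemP => y v Hv; apply: next_in; apply: (eqs_system_causal HR _ Hv) => z Hz.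
apply: stable; apply: leq_trans Hz _; apply: leqW.
have Hy : y \in system_eigenvars sys.
  by rewrite -(eqs_system_keys (next (iter k next r0))) (map_f fst Hv).
exact: (leq_bigmax_seq _ Hy isT).
Qed.

Lemma solution_unique S r (sys : seq (mode S * tree S)) r1 r2 N :
  ranked_system r sys -> ok_system r1 sys -> ok_system r2 sys ->
  (forall x, x \notin system_eigenvars sys -> r x <= N -> r1 x = r2 x) ->
  forall x, r x <= N -> r1 x = r2 x.
Proof.
move=> HR H1 H2 Hout x; have [n] := ubnP (r x); elim: n x => // n IH x.
rewrite ltnS => Hx HN; case: (boolP (x \in system_eigenvars sys)) => Px; last exact: Hout.
move: Px => /flattenP[_ /mapP[mE HE ->] Px].
have Hin : (x, r1 x) \in eqs_system r1 sys.
  apply/flattenP; exists (eqs r1 mE.1 mE.2); first by apply/mapP; exists mE.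
  exact: ok_eqs (H1 _ HE) Px.
apply/esym/((ok_systemP _ _).1 H2).
apply: (eqs_system_causal HR _ Hin) => z Hz; apply: IH.
  exact: leq_trans Hz Hx.
exact: leq_trans (ltnW Hz) HN.
Qed.

Lemma ranked_ok S rho m X (E : tree S) :
  is_tree E -> ok rho (Below m) E -> (forall z, X z -> vsize (rho z) <= vsize m) ->
  ranked (fun x => vsize (rho x)) X E.
Proof.
move=> H; elim: H m X => {E} [b a|c E1 E2 _ IH1 _ IH2|A l _ _ IH _|A y E _ IH _] m X.
- by constructor.
- move=> /ok_bin[H1 H2] HX; constructor; [apply: IH1 H1 _|apply: IH2 H2 _] => z /HX;
    exact: leqW.
- move=> /ok_ex H HX; constructor=> t E Hl; apply: (IH t E Hl _ _ (H t E Hl)).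
  move=> z [/HX|/(vsize_tsem rho)] /=; lia.
- move=> /ok_all[Hy HE] HX; constructor; first by move=> z /HX; rewrite Hy /=; lia.
  by apply: IH HE _ => z /HX /=; lia.
Qed.

Lemma ranked_ok_closed S rho m X (E : tree S) :
  is_tree E -> ok rho m E -> (forall z, ~ X z) ->
  ranked (fun x => vsize (rho x)) X E.
Proof.
move=> H; elim: H m X => {E} [b a|c E1 E2 _ IH1 _ IH2|A l _ Hl' _ _|A y E HE' _ _] m X.
- by constructor.
- by move=> /ok_bin[H1 H2] HX; constructor; [apply: IH1 H1 _|apply: IH2 H2 _].
- move=> /ok_ex H HX; constructor=> t E Hl; apply: (ranked_ok (Hl' t E Hl) (H t E Hl)).
  by move=> z [/HX//|/(vsize_tsem rho)] /=; lia.
- move=> /ok_all[Hy HE] HX; constructor; first by move=> z /HX.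
  by apply: ranked_ok HE' HE _ => z /HX.
Qed.

Lemma ranked_ok_quantified S rho p (E : tree S) :
  is_tree E -> ok rho (Above p) E -> is_qua (Sh E) ->
  ranked (fun x => vsize (rho x)) (fun z => occ_formula z (Sh E)) E /\
  (forall y, y \in eigenvars E -> vsize (fsem 0 rho (Sh E)) < vsize (rho y)).
Proof.
move=> HE Hok Hq.
have Hb : ~~ is_bin (Sh E) by case: (Sh E) Hq.
split; last first.
  move=> y Hy; have [h -> Hh] := eqs_quantified (is_tree_wf _ HE) Hb (ok_eqs Hok Hy).
  by have := extends_vsize Hh; rewrite /=; lia.
have Hocc z : occ_formula z (Sh E) -> vsize (rho z) <= vsize (VRoot p (fsem 0 rho (Sh E))).
  by move=> /(vsize_fsem 0 rho) /=; lia.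
case: E HE Hok Hq Hocc {Hb} => // [A l|A y E|E1 E2 H]; last by inversion H.
  move=> HE Hok _ Hocc.
  exact: (ranked_ok (m := VRoot p (fsem 0 rho (Qua Ex A)))) HE Hok Hocc.
move=> HE Hok _ Hocc.
exact: (ranked_ok (m := VRoot p (fsem 0 rho (Qua All A)))) HE Hok Hocc.
Qed.

(** * Acyclicity and rankings *)

Lemma expansion_at_eigenvar S (E : tree S) p y :
  expansion_at E p (LAll y) -> y \in eigenvars E.
Proof.
move: {1 3}(LAll y) (erefl (LAll y : label S)) => L EL H; elim: H EL => //=.
- by move=> c E1 E2 q L' _ IH /IH; rewrite mem_cat => ->.
- by move=> c E1 E2 q L' _ IH /IH; rewrite mem_cat orbC => ->.
- move=> A l i t E' q L' Hi _ IH /IH Hy; apply/flattenP.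
  by exists (eigenvars E') => //; apply/mapP; exists (t, E') => //; apply/onthP; exists i.
- by move=> A z E' [->]; rewrite mem_head.
- by move=> A z E' q L' _ IH /IH; rewrite in_cons orbC => ->.
Qed.

Lemma expansion_at_nonempty S (E : tree S) p L : expansion_at E p L -> p <> [::].
Proof. by case. Qed.

Lemma root_tree_all S (P : pre S) rt E : root_tree P rt = Some E -> E \in all_trees P.
Proof.
rewrite (all_treesE (fun _ => None)); case: rt => [i|i b] /= H.
  have HE : E \in trees P by apply/onthP; exists i.
  exact: (map_f snd (roots_tree (fun _ => None) HE)).
case Ec: (onth (cuts P) i) H => [c|] //= -[<-].
have Hc : c \in cuts P by apply/onthP; exists i.
case: b; first exact: (map_f snd (roots_cpos (fun _ => None) Hc)).
exact: (map_f snd (roots_cneg (fun _ => None) Hc)).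
Qed.

Lemma count_lt (T : eqType) (a b : pred T) s z :
  (forall x, a x -> b x) -> z \in s -> b z -> ~~ a z -> count a s < count b s.
Proof.
move=> Hab; elim: s => //= x s IH; rewrite in_cons => /orP[/eqP <-|/IH{}IH] Hb Ha.
  by rewrite Hb (negbTE Ha) add0n add1n ltnS; apply: sub_count.
have := IH Hb Ha; have := Hab x; case: (a x) (b x) => [] [] //= H; try by move=> /leqW.
by have := H isT.
Qed.

Definition all_node S (P : pre S) (y : var) (n : node) : Prop :=
  exists rt p, n = NExp rt p /\ expansion P rt p (LAll y).

Definition below_eigenvar S (P : pre S) (z y : var) : Prop :=
  exists2 n, all_node P y n & forall n', all_node P z n' -> dep P n' n.

Definition dep_rank S (P : pre S) (y : var) : nat :=
  if y \in pre_eigenvars P then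
    (count (fun z => `[< below_eigenvar P z y >]) (pre_eigenvars P)).+1
  else 0.

Lemma dep_rank_lt S (P : pre S) z y :
  (forall v, ~ dep P v v) -> below_eigenvar P z y -> dep_rank P z < dep_rank P y.
Proof.
move=> Hac Hzy; have [n [rt [p [_ [E HE Hp]]]] _] := Hzy.
have Py : y \in pre_eigenvars P.
  apply/flattenP; exists (eigenvars E); last exact: expansion_at_eigenvar Hp.
  exact/map_f/root_tree_all/HE.
rewrite /dep_rank Py; case: ifP => // Pz; rewrite ltnS.
apply: (count_lt (z := z)) => //.
- move=> x /asboolP [m Hm Hxm]; apply/asboolP.
  have [n' Hn' Hzn'] := Hzy; exists n' => // k /Hxm Hk.
  by apply: t_trans Hk _; exact: Hzn'.
- exact/asboolP.
- by apply/asboolP => -[m Hm /(_ m Hm)]; exact: Hac.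
Qed.

Lemma ranked_dep S (P : pre S) rt E0 (E : tree S) pos (X : var -> Prop) :
  (forall v, ~ dep P v v) -> root_tree P rt = Some E0 -> is_tree E ->
  (forall q L, expansion_at E q L -> expansion_at E0 (pos ++ q) L) ->
  (forall z q L n', X z -> expansion_at E q L -> all_node P z n' ->
     dep P n' (NExp rt (pos ++ q))) ->
  ranked (dep_rank P) X E.
Proof.
move=> Hac Hrt H; elim: H pos X => {E} [b a|c E1 E2 _ IH1 _ IH2|A l _ _ IH _|A y E _ IH _]
  pos X Hpos HX.
- by constructor.
- constructor; [apply: (IH1 (pos ++ [:: 0]))|apply: (IH2 (pos ++ [:: 1]))].
  + by move=> q L Hq; rewrite -catA; apply: Hpos; exact: at_bin1.
  + by move=> z q L n' Hz Hq; rewrite -catA; exact: HX Hz (at_bin1 c E2 Hq).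
  + by move=> q L Hq; rewrite -catA; apply: Hpos; exact: at_bin2.
  + by move=> z q L n' Hz Hq; rewrite -catA; exact: HX Hz (at_bin2 c E1 Hq).
- constructor=> t E Hl; have /onthP[i Hi] := Hl.
  apply: (IH t E Hl (pos ++ [:: i])) => [q L Hq|z q L n' Hz Hq Hn'].
    by rewrite -catA; apply: Hpos; exact: at_ex_sub Hi Hq.
  case: Hz => Hz; first by rewrite -catA; apply: (HX _ _ _ _ Hz (at_ex_sub A Hi Hq) Hn').
  have [rt' [p' [-> Hp']]] := Hn'.
  have Hex : expansion P rt (pos ++ [:: i]) (LEx t).
    by exists E0 => //; apply: Hpos; exact: at_ex Hi.
  apply: (t_trans _ _ _ (NExp rt (pos ++ [:: i]))); apply: t_step.
    exact: dep_term Hp' Hex Hz.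
  apply: (dep_dom Hex); last exact: expansion_at_nonempty Hq.
  by exists E0 => //; rewrite -catA; apply: Hpos; exact: at_ex_sub Hi Hq.
- constructor=> [z Hz|].
    apply: dep_rank_lt => //; exists (NExp rt (pos ++ [:: 0])).
      exists rt, (pos ++ [:: 0]); split=> //; exists E0 => //; apply: Hpos; exact: at_all.
    by move=> n' Hn'; apply: (HX _ _ _ _ Hz _ Hn'); apply: at_all.
  apply: (IH (pos ++ [:: 0])) => [q L Hq|z q L n' Hz Hq].
    by rewrite -catA; apply: Hpos; exact: at_all_sub.
  by rewrite -catA; exact: HX Hz (at_all_sub A y Hq).
Qed.

Lemma preproof_is_tree S K (P : pre S) mE :
  expansion_preproof P -> mE \in roots K P -> is_tree mE.2.
Proof.
move=> [HT HC _ _ _ _]; move: mE; apply: rootsP => [E /HT //|c /HC[]].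
by split.
Qed.

Lemma ranked_system_dep S K (P : pre S) :
  expansion_preproof P -> (forall v, ~ dep P v v) ->
  ranked_system (dep_rank P) (roots K P).
Proof.
move=> HP Hac mE HE; exists (fun z => occ_formula z (Sh mE.2)) => //.
have Ht := preproof_is_tree HP HE.
case: (roots_cases HE) => [[E HE' Em]|[c [b [Hc Em]]]]; subst mE; rewrite /= in Ht *.
  have /onthP[i Hi] := HE'.
  apply: (ranked_dep Hac (rt := InTree i) Hi Ht (pos := [::])) => // z q L n' Hz.
  by case: HP => _ _ _ _ _ /(_ _ (map_f _ HE') z Hz).
have /onthP[i Hi] := Hc.
have Hrt : root_tree P (InCut i b) = Some (side b c) by rewrite /= Hi.
apply: (ranked_dep Hac Hrt Ht (pos := [::])) => // z q L n' Hz Hq [rt [p [-> Hp]]].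
apply: (t_trans _ _ _ (NCut i)); apply: t_step.
  apply: dep_cut_formula Hp Hi _.
  case: b {HE Ht Hrt Hq} Hz => //=; case: HP => _ /(_ c Hc)[_ _ _ ->] _ _ _ _.
  exact: occ_dual.
by apply: (dep_in_cut (L := L)); exists (side b c).
Qed.

Definition mode_size S (m : mode S) : nat :=
  if m is Below h then vsize h else 0.

Fixpoint mode_at S (r : var -> val S) (m : mode S) (E : tree S) (p : seq nat) : mode S :=
  if p is i :: p' then
    match E with
    | TBin _ E1 E2 =>
        if i == 0 then mode_at r (mleft m) E1 p' else mode_at r (mright m) E2 p'
    | TEx A l =>
        if onth l i is Some (t, E') then
          mode_at r (Below (VEx (hist m (fsem 0 r (Qua Ex A))) (tsem r t))) E' p'
        else m
    | TAll A y E' => mode_at r (Below (VAll (hist m (fsem 0 r (Qua All A))))) E' p'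
    | _ => m
    end
  else m.

Lemma mode_size_hist S (m : mode S) v : mode_size m <= vsize (hist m v).
Proof. by case: m => [p|m] //=; lia. Qed.

Lemma mode_at_lt S r m (E : tree S) p L :
  expansion_at E p L -> mode_size m < mode_size (mode_at r m E p).
Proof.
have HL (m' : mode S) : mode_size m' <= mode_size (mleft m') by case: m'.
have HR (m' : mode S) : mode_size m' <= mode_size (mright m') by case: m'.
move=> H; elim: H m => {E p L}.
- by move=> c E1 E2 p L _ IH m; apply: leq_ltn_trans (HL m) _; exact: IH.
- by move=> c E1 E2 p L _ IH m; apply: leq_ltn_trans (HR m) _; exact: IH.
- move=> A l i t E Hi m; rewrite [mode_at _ _ _ _]/= Hi /=.
  by apply: leq_ltn_trans (mode_size_hist m (fsem 0 r (Qua Ex A))) _;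
    rewrite ltnS leq_addr.
- move=> A l i t E p L Hi _ IH m; rewrite [mode_at _ _ _ _]/= Hi.
  apply: leq_ltn_trans (IH _) => /=.
  by apply: leq_trans (mode_size_hist m (fsem 0 r (Qua Ex A))) _;
    rewrite leqW // leq_addr.
- by move=> A y E m; exact: leq_ltn_trans (mode_size_hist m (fsem 0 r (Qua All A))) _.
- move=> A y E p L _ IH m; apply: leq_ltn_trans (IH _) => /=.
  exact: leq_trans (mode_size_hist m (fsem 0 r (Qua All A))) _.
Qed.

Lemma expansion_at_ex S A (l : seq (term S var * tree S)) i t E p L :
  expansion_at (TEx A l) (i :: p) L -> onth l i = Some (t, E) -> p <> [::] ->
  expansion_at E p L.
Proof.
move=> H Hi Hp; inversion H as [| |? ? ? ? ? Hi'|? ? ? ? ? ? ? Hi' HE| |]; subst => //.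
by move: Hi' HE; rewrite Hi => -[_ <-].
Qed.

Lemma expansion_at_all S A y (E : tree S) i p L :
  expansion_at (TAll A y E) (i :: p) L -> p <> [::] -> expansion_at E p L.
Proof. by move=> H Hp; inversion H; subst. Qed.

Lemma mode_at_dom S r m (E : tree S) p q L L' :
  expansion_at E p L -> expansion_at E (p ++ q) L' -> q <> [::] ->
  mode_size (mode_at r m E p) < mode_size (mode_at r m E (p ++ q)).
Proof.
have Hcat (p' : seq nat) : p' <> [::] -> p' ++ q <> [::] by case: p'.
move=> H; elim: H m => {E p L}.
- by move=> c E1 E2 p L Hp IH m H Hq; inversion H; subst; exact: IH.
- by move=> c E1 E2 p L Hp IH m H Hq; inversion H; subst; exact: IH.
- move=> A l i t E Hi m H Hq; rewrite /= Hi.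
  exact: mode_at_lt (expansion_at_ex H Hi Hq).
- move=> A l i t E p L Hi Hp IH m H Hq; rewrite /= Hi.
  have Hpq := Hcat _ (expansion_at_nonempty Hp).
  exact: IH (expansion_at_ex H Hi Hpq) Hq.
- move=> A y E m H Hq.
  exact: mode_at_lt (expansion_at_all H Hq).
- move=> A y E p L Hp IH m H Hq.
  exact: IH (expansion_at_all H (Hcat _ (expansion_at_nonempty Hp))) Hq.
Qed.

Lemma mode_at_eigenvar S r m (E : tree S) p y :
  ok r m E -> expansion_at E p (LAll y) -> mode_at r m E p = Below (r y).
Proof.
move=> Hok H; move: {1 3}(LAll y) (erefl (LAll y : label S)) H => L EL H.
elim: H EL m Hok => //= {E p L}.
- by move=> c E1 E2 p L _ IH EL m /ok_bin[H _]; exact: IH.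
- by move=> c E1 E2 p L _ IH EL m /ok_bin[_ H]; exact: IH.
- move=> A l i t E p L Hi _ IH EL m /ok_ex H; rewrite Hi; apply: IH => //.
  by apply: H; apply/onthP; exists i.
- by move=> A z E [->] m /ok_all[-> _].
- by move=> A z E p L _ IH EL m /ok_all[_ H]; exact: IH.
Qed.

Lemma mode_at_term S r m (E : tree S) p t :
  expansion_at E p (LEx t) -> vsize (tsem r t) < mode_size (mode_at r m E p).
Proof.
move: {1 3}(LEx t) (erefl (LEx t)) => L EL H.
elim: H EL m => //= {E p L}.
- by move=> c E1 E2 p L _ IH EL m; exact: IH.
- by move=> c E1 E2 p L _ IH EL m; exact: IH.
- by move=> A l i u E Hi [<-] m; rewrite Hi /= ltnS leq_addl.
- by move=> A l i u E p L Hi _ IH EL m; rewrite Hi; exact: IH.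
- by move=> A z E p L _ IH EL m; exact: IH.
Qed.

Definition node_size S (r : var -> val S) (P : pre S) (n : node) : nat :=
  if n is NExp rt p then
    if root_tree P rt is Some E then mode_size (mode_at r (mtree E) E p) else 0
  else 0.

Lemma cut_free_acyclic S K r (P : pre S) :
  cut_free P -> ok_pre K r P -> forall v, ~ dep P v v.
Proof.
move=> Hc Hok v.
have Hcut (n : nat) : onth (cuts P) n = None by rewrite Hc; case: n.
suff H n n' : dep P n n' -> node_size r P n < node_size r P n'.
  by move=> /H; rewrite ltnn.
have Hr rt E : root_tree P rt = Some E -> ok r (mtree E) E.
  case: rt => [i|i b] /=; last by rewrite Hcut.
  by move=> Hi; apply: (Hok (_, _)); apply: roots_tree; apply/onthP; exists i.
elim=> {n n'} [n n' []|n1 n2 n3 _ H1 _ H2]; last exact: ltn_trans H1 H2.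
- move=> rt p y rt' p' t [E HE Hy] [E' HE' Ht] Hyt /=; rewrite HE HE'.
  rewrite (mode_at_eigenvar (Hr _ _ HE) Hy) /=.
  exact: leq_ltn_trans (vsize_tsem r Hyt) (mode_at_term _ _ Ht).
- move=> rt p q L L' [E HE HL] [E' HE' HL'] Hq /=; rewrite HE.
  move: HE'; rewrite HE => -[EE]; subst E'; exact: mode_at_dom HL HL' Hq.
- by move=> i b p L [E] /=; rewrite Hcut.
- by move=> rt p y i c _; rewrite Hcut.
Qed.

(** * Occurrences *)

Lemma occ_tree_ex S x A (l : seq (term S var * tree S)) t E :
  (t, E) \in l -> occ_term x t \/ occ_tree x E -> occ_tree x (TEx A l).
Proof.
move=> Hl H; right; elim: l Hl => //= -[u F] l IH.
rewrite in_cons => /orP[/eqP[<- <-]|/IH {}H]; last by constructor 3.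
by case: H; [constructor 1|constructor 2].
Qed.

Lemma occ_eigenvar S x (E : tree S) : x \in eigenvars E -> occ_tree x E.
Proof.
elim/tree_children_ind: E => //= [c E1 IH1 E2 IH2|A l IH|A y E IH|E1 IH1 E2 IH2].
- by rewrite mem_cat => /orP[/IH1|/IH2]; [left|right].
- move=> /flattenP[_ /mapP[[t E] Hl ->] /(IH _ _ Hl) H].
  by apply: (occ_tree_ex A Hl); right.
- by rewrite in_cons => /orP[/eqP ->|/IH]; [constructor 2|constructor 3].
- by rewrite mem_cat => /orP[/IH1|/IH2]; [left|right].
Qed.

Lemma occ_Sh S x (E : tree S) : occ_formula x (Sh E) -> occ_tree x E.
Proof.
elim: E x => //= [c E1 IH1 E2 IH2|A l|A y E _|E1 IH1 E2 _] x.
- by case=> [/IH1|/IH2]; [left|right].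
- by left.
- by constructor 1.
- by move=> /IH1; left.
Qed.

Lemma occ_tree_bound S (E : tree S) : exists N, forall x, occ_tree x E -> x < N.
Proof.
have HF (A : formula S (option var)) x : occ_formula (Some x) A ->
    x < vsize (fsem 0 VVar (Qua Ex A)).
  by move=> Hx; apply: ltn_trans (vsize_Qua Ex VVar Hx); rewrite /= ltnS.
elim/tree_children_ind: E => [b a|c E1 [N1 H1] E2 [N2 H2]|A l IH|A y E [N H]|
  E1 [N1 H1] E2 [N2 H2]].
- exists (vsize (fsem 0 VVar (Lit b a))) => x Hx.
  by apply: ltn_trans (vsize_fsem (A := Lit b a) 0 VVar Hx); rewrite /= ltnS.
- by exists (maxn N1 N2) => x; rewrite leq_max => -[/H1 ->|/H2 ->]; rewrite ?orbT.
- have [N HN] : exists N, forall x, foldr (fun tE R =>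
      [\/ occ_term x tE.1, occ_tree x tE.2 | R]) False l -> x < N.
    elim: l IH => [_|[t E] l IHl IH]; first by exists 0.
    have [|N HN] := IHl; first by move=> u F Hl; apply: (IH u F); rewrite in_cons Hl orbT.
    have [M HM] := IH t E (mem_head _ _).
    exists (maxn (vsize (tsem VVar t)) (maxn M N)) => x /=; rewrite !leq_max.
    move=> [Hx|/HM ->|/HN ->]; rewrite ?orbT //.
    by rewrite (vsize_tsem VVar Hx).
  exists (maxn (vsize (fsem 0 VVar (Qua Ex A))) N) => x /= [/HF|/HN] H;
    by rewrite leq_max H ?orbT.
- exists (maxn (vsize (fsem 0 VVar (Qua Ex A))) (maxn y.+1 N)) => x /=; rewrite !leq_max.
  by move=> [/HF ->|->|/H ->]; rewrite ?leqnn ?orbT.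
- by exists (maxn N1 N2) => x; rewrite leq_max => -[/H1 ->|/H2 ->]; rewrite ?orbT.
Qed.

Lemma occ_pre_bound S (P : pre S) : exists N, forall x, occ_pre x P -> x < N.
Proof.
rewrite /occ_pre; elim: (all_trees P) => [|E l [N HN]]; first by exists 0 => x [].
have [M HM] := occ_tree_bound E; exists (maxn M N) => x [F].
rewrite leq_max in_cons => /orP[/eqP ->/HM ->//|HF Hx].
by rewrite (HN x) ?orbT //; exists F.
Qed.

Lemma eqs_ext S (r1 r2 : var -> val S) m (E : tree S) :
  (forall x, occ_tree x E -> r1 x = r2 x) -> eqs r1 m E = eqs r2 m E.
Proof.
elim/tree_children_ind: E m => //= [c E1 IH1 E2 IH2|A l IH|A y E IH|E1 IH1 E2 IH2] m H.
- by rewrite (IH1 (mleft m)) ?(IH2 (mright m)) // => x Hx; apply: H; [right|left].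
- congr flatten; apply/eq_in_map => -[t E] Hl /=.
  have -> : fsem 1 (vlift 0 r1) A = fsem 1 (vlift 0 r2) A.
    by apply: fsem_ext => -[x|] //= Hx; apply: H; left.
  have -> : tsem r1 t = tsem r2 t.
    by apply: tsem_ext => x Hx; apply/H/(occ_tree_ex A Hl); left.
  by apply: (IH _ _ Hl) => x Hx; apply/H/(occ_tree_ex A Hl); right.
- have -> : fsem 1 (vlift 0 r1) A = fsem 1 (vlift 0 r2) A.
    by apply: fsem_ext => -[x|] //= Hx; apply: H; constructor 1.
  by rewrite IH // => x Hx; apply: H; constructor 3.
- by rewrite (IH1 m) ?(IH2 m) // => x Hx; apply: H; [right|left].
Qed.

Lemma ok_ext S (r1 r2 : var -> val S) m (E : tree S) :
  (forall x, occ_tree x E -> r1 x = r2 x) -> ok r1 m E -> ok r2 m E.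
Proof.
move=> H Hok y v; rewrite -(eqs_ext m H) => Hy; rewrite -(Hok y v Hy).
by apply/esym/H/occ_eigenvar/mem_eqs/Hy.
Qed.

Lemma ok_pre_ext S K (r1 r2 : var -> val S) (P : pre S) :
  (forall x, occ_pre x P -> r1 x = r2 x) -> ok_pre K r1 P -> ok_pre K r2 P.
Proof.
move=> H Hok [m E] HE; apply: ok_ext (Hok _ HE) => x Hx; apply: H.
by exists E => //; apply: mem_roots HE.
Qed.

(** * Propositional cuts *)

Definition untagged S (b : bool) : option (val S) := None.

Record bounded_preproof S d (V : seq (val S)) (P : pre S) : Prop := BoundedPreproof {
  bp_preproof : expansion_preproof P;
  bp_holds : forall v, holds v P;
  bp_solution : exists r, [/\ ok_pre (@untagged S) r P, default_off_eigenvars r P &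
                             cuts_bounded d V r P] }.

Lemma preproof_raw S (P : pre S) : expansion_preproof P -> raw P.
Proof. by case. Qed.

Lemma preproof_wf S (P : pre S) : expansion_preproof P -> wf_pre VVar P.
Proof.
case=> HT HC _ _ _ _; apply/wf_preP; split=> [E /HT|c /HC[H1 H2 H3 ->]].
  exact: is_tree_wf.
by split=> //; exact: is_tree_wf.
Qed.

Lemma is_tree_normal S (E : tree S) : is_tree E -> merge_normal E.
Proof.
move=> HE o E' H; elim: H HE => {E o E'}; try by move=> *; match goal with
  H : is_tree _ |- _ => inversion H; subst; auto end.
move=> A l1 t E l2 o E' _ IH H; inversion H as [| |? ? _ Ht _|]; subst; apply: IH.
by apply: (Ht t); rewrite mem_cat mem_head orbT.
Qed.

Lemma preproof_normal S (P : pre S) Q : expansion_preproof P -> ~ merge_step P Q.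
Proof.
move=> HP /merge_stepE[o [P' [H _]]].
have [X [m [E [E' [Y [HE HX _]]]]]] := merge_in_roots (@untagged S) H.
apply: (is_tree_normal _ HE); apply: (preproof_is_tree (K := @untagged S) (mE := (m, E)) HP).
by rewrite HX mem_cat mem_head orbT.
Qed.

Lemma normal_preproof S r (P : pre S) :
  (forall x, nice 0 (r x)) -> (forall x y, r x = r y -> x = y) ->
  raw P -> wf_pre r P -> (forall Q, ~ merge_step P Q) -> expansion_preproof P.
Proof.
move=> Hn Hi [H1 H2 H3 H4] HW HN.
have HT mE : mE \in roots (@untagged S) P -> is_tree mE.2.
  move=> HE; apply: (wf_is_tree Hn Hi (normal_roots HN HE)).
  by case: HW => + _ _; apply; rewrite (all_treesE (@untagged S)) map_f.
split=> // [E /(roots_tree (@untagged S))/HT //|c Hc].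
have [_ /(_ c Hc)[_ _ Hp Hd]] := (wf_preP _ _).1 HW.
split=> //; first exact: HT (roots_cpos _ Hc).
  exact: HT (roots_cneg _ Hc).
by apply: fsem_inj Hd => // x y _; apply: Hi.
Qed.

Lemma merge_bounded S d V (J Q : pre S) :
  raw J -> (forall v, holds v J) -> normal_form J Q ->
  (exists r, good (@untagged S) d V r J) ->
  (raw Q -> expansion_preproof Q) ->
  bounded_preproof d V Q /\ pre_Sh Q =i pre_Sh J.
Proof.
move=> Hraw Hh HQ [r Hg] Hpp.
pose inv (R : pre S) := [/\ raw R, forall v, holds v R, pre_Sh R =i pre_Sh J &
  exists r, good (@untagged S) d V r R].
have [H1 H2 H3 [r' [G1 G2 _ G4]]] : inv Q.
  apply: normal_form_ind HQ _; last by split=> //; exists r.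
  move=> R R' HR [H1 H2 H3 [r' H4]]; split.
  - exact: merge_step_raw HR H1.
  - exact: merge_step_tautology HR H2.
  - by move=> A; rewrite (merge_step_Sh HR).
  - exact: merge_step_good HR H1 H4.
by split=> //; split=> //; [exact: Hpp|exists r'].
Qed.

Lemma normal_form_size S (P Q : pre S) : normal_form P Q -> pre_size Q <= pre_size P.
Proof.
move=> H; apply: (normal_form_ind (J := fun R => pre_size R <= pre_size P) _ H) => //.
by move=> R R' /merge_step_size; lia.
Qed.

Lemma fsem_dual S (V : Set) (A B : formula S V) k r :
  fsem k r A = fsem k r B -> fsem k r (dual A) = fsem k r (dual B).
Proof.
elim/formula_set_ind: A B k r => {V} [V b a|V c A IHA A' IHA'|V q A IH] [b' a'|c' B B'|q' B] //= k r.
- by case=> Eb Ep Et; congr VLit => //; rewrite Eb.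
- by case=> -> /IHA -> /IHA' ->.
- by case=> -> /IH ->.
Qed.

Lemma vsize_dual S (V : Set) (A : formula S V) k r :
  vsize (fsem k r (dual A)) = vsize (fsem k r A).
Proof.
elim/formula_set_ind: A k r => {V} //= [V c A IHA B IHB|V q A IH] k r.
  by rewrite IHA IHB.
by rewrite IH.
Qed.

Lemma only_cut_perm S (E F : tree S) :
  perm_eq (pre_eigenvars (only_cut (mk_cut E F))) (eigenvars E ++ eigenvars F).
Proof.
rewrite /pre_eigenvars /= /mk_cut; case: ifP => _ /=; rewrite cats0 //.
by rewrite perm_catC.
Qed.

Lemma only_cut_ok S K r (E F : tree S) :
  (forall b, b = positive (Sh E) ->
    let m b' := Above (if is_bin (cut_formula (mk_cut E F)) then K b' else None) in
    ok r (m b) E /\ ok r (m (~~ b)) F) ->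
  ok_pre K r (only_cut (mk_cut E F)).
Proof.
move=> /(_ _ erefl) /=; rewrite /mk_cut; case: (positive (Sh E)) => -[H1 H2];
  apply: rootsP => //= c; by rewrite inE => /eqP ->.
Qed.

Lemma only_cut_wf S r (E F : tree S) :
  wf r E -> wf r F -> fsem 0 r (Sh F) = fsem 0 r (dual (Sh E)) ->
  wf_pre r (only_cut (mk_cut E F)).
Proof.
move=> HE HF HSh; apply/wf_preP; split=> // c; rewrite inE => /eqP ->.
rewrite /mk_cut; case: ifP => Hp //; split=> //.
  by rewrite /cut_formula /= (fsem_positive HSh) positive_dual Hp.
by rewrite /cut_formula /= -{1}(dualK (Sh E)); apply/fsem_dual/esym.
Qed.

Lemma only_cut_bounded S d V r (E F : tree S) :
  qdepth (Sh E) < d -> qdepth (Sh F) < d ->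
  cuts_bounded d V r (only_cut (mk_cut E F)).
Proof.
move=> HE HF A; rewrite inE => /eqP -> /=; left.
by rewrite /cut_formula /mk_cut; case: ifP.
Qed.

Lemma only_cut_holds S v (E F : tree S) :
  qeval v (Dp E) -> qeval v (Dp F) -> holds v (only_cut (mk_cut E F)).
Proof.
by rewrite /holds /= /qeval_cut /mk_cut => HE HF; case: ifP => _ /=; rewrite HE HF.
Qed.

Lemma only_cut_size S (E F : tree S) :
  pre_size (only_cut (mk_cut E F)) = nsize E + nsize F.
Proof. by rewrite /pre_size /= /mk_cut; case: ifP => _ /=; lia. Qed.

Lemma split_cut_perm S C1 c C2 (T : seq (tree S)) :
  perm_eq (pre_eigenvars (Pre (C1 ++ c :: C2) T))
    ((eigenvars (cpos c) ++ eigenvars (cneg c)) ++ pre_eigenvars (Pre (C1 ++ C2) T)).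
Proof.
rewrite !pre_eigenvarsE /= !map_cat !flatten_cat /=; apply/permP => p.
by rewrite !count_cat; lia.
Qed.

Lemma split_cut_sub S C1 c C2 (c' : cut S) : c' \in C1 ++ C2 -> c' \in C1 ++ c :: C2.
Proof. by rewrite !mem_cat in_cons => /orP[->//|->]; rewrite !orbT. Qed.

Lemma split_cut_roots S K C1 c C2 (T : seq (tree S)) mE :
  mE \in roots K (Pre (C1 ++ C2) T) -> mE \in roots K (Pre (C1 ++ c :: C2) T).
Proof.
move: mE; apply: rootsP => [E /= HE|c' /= /(@split_cut_sub _ C1 c C2) Hc].
  exact: (roots_tree K (P := Pre (C1 ++ c :: C2) T) HE).
split; first exact: (roots_cpos K (P := Pre (C1 ++ c :: C2) T) Hc).
exact: (roots_cneg K (P := Pre (C1 ++ c :: C2) T) Hc).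
Qed.

Lemma split_cut_shallow S C1 c C2 (T : seq (tree S)) F :
  F \in cut_shallow (Pre (C1 ++ C2) T) -> F \in cut_shallow (Pre (C1 ++ c :: C2) T).
Proof.
move=> /mapP[c' Hc' ->]; apply: (mem_cut_shallow (P := Pre (C1 ++ c :: C2) T)).
exact: split_cut_sub.
Qed.

Lemma split_cut_preproof S C1 c C2 (T : seq (tree S)) :
  expansion_preproof (Pre (C1 ++ c :: C2) T) -> expansion_preproof (Pre (C1 ++ C2) T).
Proof.
move=> [H1 H2 H3 H4 H5 H6]; split=> //.
- by move=> c' Hc'; apply: H2; apply: split_cut_sub.
- apply: (subseq_uniq _ H3); rewrite /= !map_cat cat_subseq //=.
  exact: subseq_cons.
- by move: H5; rewrite (perm_uniq (split_cut_perm C1 c C2 T)) cat_uniq => /and3P[].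
Qed.

Lemma split_cut_holds S C1 c C2 (T : seq (tree S)) v :
  holds v (Pre (C1 ++ c :: C2) T) = qeval_cut v c || holds v (Pre (C1 ++ C2) T).
Proof. by rewrite /holds /= !has_cat /=; do !case: (has _ _); case: (qeval_cut v c). Qed.

Lemma is_treeE S (E : tree S) : is_tree E ->
  match Sh E with
  | Lit b a => E = TLit b a
  | Bin c _ _ => exists E1 E2, E = TBin c E1 E2
  | Qua Ex A => exists l, E = TEx A l
  | Qua All A => exists y E', E = TAll A y E'
  end.
Proof. by case => *; rewrite /=; repeat eexists. Qed.

Lemma propositional_step S d V C1 C2 (T : seq (tree S)) E1 E2 F1 F2 :
  let P := Pre (C1 ++ Cut (TBin Or E1 E2) (TBin And F1 F2) :: C2) T in
  bounded_preproof d V P -> exists Q,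
  [/\ cut_step P Q, bounded_preproof d V Q, pre_Sh Q =i pre_Sh P &
      pre_size Q < pre_size P].
Proof.
set c := Cut _ _; move=> P [HP Hh [r [Hok Hd Hb]]].
set P0 := Pre (C1 ++ C2) T.
have Hc : c \in cuts P by rewrite mem_cat mem_head orbT.
have HP0 : expansion_preproof P0 := split_cut_preproof HP.
pose Ps := [:: only_cut (mk_cut E1 F1); only_cut (mk_cut E2 F2); P0].
have [Q HQ] := normal_form_exists (join Ps).
have HSh : pre_Sh (join Ps) =i pre_Sh P by move=> A; rewrite join_Sh /= cats0.
have [T1 T2 [W1 W2 W3 W4] [D1 D2]] : [/\ is_tree E1 /\ is_tree E2, is_tree F1 /\ is_tree F2,
    [/\ wf r E1, wf r E2, wf r F1 & wf r F2] &
    Sh F1 = dual (Sh E1) /\ Sh F2 = dual (Sh E2)].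
  have [_ /(_ c Hc)[/= H1 H2 _ HD] _ _ _ _] := HP.
  inversion H1; inversion H2; subst; rewrite /cut_formula /= in HD; case: HD => D1 D2.
  by split=> //; split; exact: is_tree_wf.
have Hperm : perm_eq (pre_eigenvars (join Ps)) (pre_eigenvars P).
  apply: (perm_trans (join_perm Ps)); rewrite perm_sym.
  apply: (perm_trans (split_cut_perm C1 c C2 T)); rewrite /= cats0.
  have /permP h1 := only_cut_perm E1 F1; have /permP h2 := only_cut_perm E2 F2.
  by apply/permP => p; have := h1 p; have := h2 p; rewrite /P0 /= !count_cat; lia.
have Hclosed (P' : pre S) : P' \in Ps -> pre_closed P'.
  rewrite !inE => /or3P[] /eqP -> //; by case: HP0.
have Hraw : raw (join Ps).
  apply: raw_join => //; rewrite -(perm_uniq (join_perm Ps)) (perm_uniq Hperm).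
  by case: HP.
have Hholds v : holds v (join Ps).
  apply: join_holds; have := Hh v; rewrite split_cut_holds /= orbF.
  case/orP => [/andP[/= /orP[] HE /andP[HF1 HF2]]|->]; last by rewrite !orbT.
    by rewrite only_cut_holds.
  by rewrite (only_cut_holds HE) ?orbT.
have Hwf r' : wf_pre r' (join Ps).
  apply: wf_join => P'; rewrite !inE => /or3P[] /eqP ->; last exact/wf_pre_var/preproof_wf.
    by case: T1 T2 => ? _ [? _]; apply: only_cut_wf; rewrite ?D1; auto using is_tree_wf.
  by case: T1 T2 => _ ? [_ ?]; apply: only_cut_wf; rewrite ?D2; auto using is_tree_wf.
have [O1 O2] : (ok r (Above None) E1 /\ ok r (Above None) E2) /\
    (ok r (Above None) F1 /\ ok r (Above None) F2).
  have := Hok _ (roots_cpos _ Hc); have := Hok _ (roots_cneg _ Hc).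
  by rewrite /= /mcut /= => /ok_bin[? ?] /ok_bin[? ?].
have [Q1 Q2] : (qdepth (Sh E1) < d /\ qdepth (Sh E2) < d).
  have [/=|[]//] := Hb _ (mem_cut_shallow Hc); by rewrite gtn_max => /andP[].
have Hgood : good (@untagged S) d V r (join Ps).
  split=> //.
  - apply: ok_join => P'; rewrite !inE => /or3P[] /eqP ->.
    + by apply: only_cut_ok => b _ /=; rewrite !if_same; case: O1 O2 => ? _ [? _].
    + by apply: only_cut_ok => b _ /=; rewrite !if_same; case: O1 O2 => _ ? [_ ?].
    + by move=> mE /(split_cut_roots c)/Hok.
  - by move=> x; rewrite (perm_mem Hperm); apply: Hd.
  - apply: bounded_join => P'; rewrite !inE => /or3P[] /eqP ->.
    + by apply: only_cut_bounded; rewrite ?D1 ?qdepth_dual.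
    + by apply: only_cut_bounded; rewrite ?D2 ?qdepth_dual.
    + by move=> F /(split_cut_shallow c)/Hb.
have HppQ : raw Q -> expansion_preproof Q.
  move=> HrQ; have HWQ : wf_pre VVar Q.
    by apply: (normal_form_ind _ HQ (Hwf _)) => R R'; exact: merge_step_wf_var.
  by apply: normal_preproof HrQ HWQ HQ.2 => // x y [].
have [HbQ HShQ] := merge_bounded Hraw Hholds HQ (ex_intro _ r Hgood) HppQ.
exists Q; split=> //; first exact: step_propositional.
  by move=> A; rewrite HShQ HSh.
apply: leq_ltn_trans (normal_form_size HQ) _.
rewrite join_size /= !only_cut_size /pre_size /= !map_cat !sumn_cat /=; lia.
Qed.

Lemma atomic_step S d V C1 C2 (T : seq (tree S)) a :
  let P := Pre (C1 ++ Cut (TLit true a) (TLit false a) :: C2) T in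
  bounded_preproof d V P -> exists Q,
  [/\ cut_step P Q, bounded_preproof d V Q, pre_Sh Q =i pre_Sh P &
      pre_size Q < pre_size P].
Proof.
set c := Cut _ _; move=> P [HP Hh [r [Hok Hd Hb]]].
exists (Pre (C1 ++ C2) T); split=> //; first exact: step_atomic.
  split; first exact: split_cut_preproof HP.
    by move=> v; have := Hh v; rewrite split_cut_holds /qeval_cut /=; case: (v a).
  exists r; split.
  - by move=> mE /(split_cut_roots c)/Hok.
  - by move=> x Hx; apply: Hd; rewrite (perm_mem (split_cut_perm C1 c C2 T)).
  - by move=> F /(split_cut_shallow c)/Hb.
by rewrite /pre_size /= !map_cat !sumn_cat /=; lia.
Qed.

Lemma eliminate_propositional S d V (P : pre S) :
  bounded_preproof d V P -> exists Q,
  [/\ cut_reduces P Q, bounded_preproof d V Q, pre_Sh Q =i pre_Sh P &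
      forall c, c \in cuts Q -> is_qua (cut_formula c)].
Proof.
have [n] := ubnP (pre_size P); elim: n P => // n IH P; rewrite ltnS => Hn HP.
case: (boolP (all (fun c => is_qua (cut_formula c)) (cuts P))) => [/allP H|/allPn[c Hc Hq]].
  by exists P; split=> //; exact: rt_refl.
suff [R [H1 H2 H3 H4]] : exists R, [/\ cut_step P R, bounded_preproof d V R,
    pre_Sh R =i pre_Sh P & pre_size R < pre_size P].
  have [Q [H5 H6 H7 H8]] := IH R (leq_trans H4 Hn) H2.
  exists Q; split=> //; last by move=> A; rewrite H7 H3.
  by apply: rt_trans H5; exact: rt_step.
have [[_ /(_ c Hc)[TE TF Hp HD] _ _ _ _] _ _] := HP.
case: P Hc HP Hn => C T /= Hc; case/splitPr: Hc => C1 C2 HP _.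
case: c TE TF Hp HD Hq HP => E F TE TF; rewrite /cut_formula /= => Hp HD Hq HP.
have := is_treeE TE; have := is_treeE TF; rewrite HD.
case: (Sh E) Hp Hq {HD} => [[] // a|[] // A B|] _ //= _.
  by move=> EF EE; subst; exact: atomic_step HP.
by move=> [F1 [F2 EF]] [E1 [E2 EE]]; subst; exact: propositional_step HP.
Qed.

(** * Quantifier cuts *)

Lemma tbins_eigenvars S c (E : tree S) l :
  eigenvars (tbins c E l) = flatten [seq eigenvars F | F <- E :: l].
Proof. by elim: l E => [|F l IH] E /=; rewrite ?cats0 // IH. Qed.

Lemma tbins_or S v (E : tree S) l :
  qeval v (Dp (tbins Or E l)) = has (fun F => qeval v (Dp F)) (E :: l).
Proof. by elim: l E => [|F l IH] E /=; rewrite ?orbF // IH. Qed.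

Lemma tbins_and S v (E : tree S) l :
  qeval v (Dp (tbins And E l)) = all (fun F => qeval v (Dp F)) (E :: l).
Proof. by elim: l E => [|F l IH] E /=; rewrite ?andbT // IH. Qed.

Lemma tbins_wf S r c (E : tree S) l :
  (forall F, F \in E :: l -> wf r F) -> wf r (tbins c E l).
Proof.
elim: l E => [|F l IH] E H /=; first by apply: H; rewrite mem_head.
constructor; first by apply: H; rewrite mem_head.
by apply: IH => G HG; apply: H; rewrite in_cons HG orbT.
Qed.

Lemma tbins_qdepth S d c (E : tree S) l :
  (forall F, F \in E :: l -> qdepth (Sh F) < d) -> qdepth (Sh (tbins c E l)) < d.
Proof.
elim: l E => [|F l IH] E H /=; first by apply: H; rewrite mem_head.
rewrite gtn_max H ?mem_head //=.
by apply: IH => G HG; apply: H; rewrite in_cons HG orbT.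
Qed.

Lemma tbins_dual S r (E0 F0 E F : tree S) l l' :
  size l = size l' ->
  (forall j, j < (size l).+1 ->
     fsem 0 r (Sh (nth F0 (F :: l') j)) = fsem 0 r (dual (Sh (nth E0 (E :: l) j)))) ->
  fsem 0 r (Sh (tbins And F l')) = fsem 0 r (dual (Sh (tbins Or E l))).
Proof.
elim: l l' E F => [|E1 l IH] [|F1 l'] E F //= => [_ /(_ 0 isT) //|[Hs] H].
by rewrite (H 0) // (IH l' E1 F1) // => j Hj; exact: (H j.+1).
Qed.

Fixpoint tbins_mode S (m : mode S) (n j : nat) : mode S :=
  if n is n'.+1 then
    if j is j'.+1 then tbins_mode (mright m) n' j' else mleft m
  else m.

Lemma tbins_ok S r m c (E0 E : tree S) l :
  (forall j, j < (size l).+1 ->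
     ok r (tbins_mode m (size l) j) (nth E0 (E :: l) j)) ->
  ok r m (tbins c E l).
Proof.
elim: l E m => [|F l IH] E m H /=; first exact: (H 0).
apply/ok_bin; split; first exact: (H 0).
by apply: IH => j Hj; exact: (H j.+1).
Qed.

Lemma instance_cut_perm S (Es Fs : seq (tree S)) :
  size Es = size Fs ->
  perm_eq (flatten [seq pre_eigenvars J | J <- instance_cut Es Fs])
    (flatten [seq eigenvars E | E <- Es] ++ flatten [seq eigenvars F | F <- Fs]).
Proof.
case: Es Fs => [|E Es] [|F Fs] //= _; rewrite cats0.
by apply: (perm_trans (only_cut_perm _ _)); rewrite !tbins_eigenvars.
Qed.

Lemma instance_cut_ok S K (E0 F0 : tree S) Es Fs :
  size Es = size Fs -> exists mE mF : nat -> mode S, forall r,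
    (forall j, j < size Es ->
       ok r (mE j) (nth E0 Es j) /\ ok r (mF j) (nth F0 Fs j)) ->
    forall I, I \in instance_cut Es Fs -> ok_pre K r I.
Proof.
case: Es Fs => [|E Es] [|F Fs] //= => [_|[Hs]].
  by exists (fun _ => Above None), (fun _ => Above None).
set ES := tbins Or E Es; set FS := tbins And F Fs.
pose m b := Above (if is_bin (cut_formula (mk_cut ES FS)) then K b else None).
exists (tbins_mode (m (positive (Sh ES))) (size Es)),
  (tbins_mode (m (~~ positive (Sh ES))) (size Fs)) => r H J.
rewrite inE => /eqP ->; apply: only_cut_ok => _ -> /=; split.
  by apply: (tbins_ok (E0 := E0)) => j Hj; case: (H j Hj).
by apply: (tbins_ok (E0 := F0)) => j Hj; case: (H j _) => //; rewrite Hs.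
Qed.

Lemma instance_cut_wf S r (E0 F0 : tree S) Es Fs :
  size Es = size Fs -> (forall E, E \in Es -> wf r E) -> (forall F, F \in Fs -> wf r F) ->
  (forall j, j < size Es -> fsem 0 r (Sh (nth F0 Fs j)) =
                            fsem 0 r (dual (Sh (nth E0 Es j)))) ->
  forall I, I \in instance_cut Es Fs -> wf_pre r I.
Proof.
case: Es Fs => [|E Es] [|F Fs] //= [Hs] HE HF HD J; rewrite inE => /eqP ->.
apply: only_cut_wf; [exact: tbins_wf|exact: tbins_wf|exact: tbins_dual HD].
Qed.

Lemma instance_cut_bounded S d V r (Es Fs : seq (tree S)) :
  (forall E, E \in Es -> qdepth (Sh E) < d) -> (forall F, F \in Fs -> qdepth (Sh F) < d) ->
  forall I, I \in instance_cut Es Fs -> cuts_bounded d V r I.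
Proof.
case: Es Fs => [|E Es] [|F Fs] //= HE HF J; rewrite inE => /eqP ->.
by apply: only_cut_bounded; exact: tbins_qdepth.
Qed.

Lemma instance_cut_holds S v (Es Fs : seq (tree S)) :
  size Es = size Fs -> has (fun E => qeval v (Dp E)) Es -> all (fun F => qeval v (Dp F)) Fs ->
  has (holds v) (instance_cut Es Fs).
Proof.
case: Es Fs => [|E Es] [|F Fs] // _ HE HF; rewrite /= orbF.
by apply: only_cut_holds; rewrite ?tbins_or ?tbins_and.
Qed.

Lemma instance_cut_closed S (Es Fs : seq (tree S)) (I : pre S) :
  I \in instance_cut Es Fs -> pre_Sh I = [::].
Proof. by case: Es Fs => [|E Es] [|F Fs] //=; rewrite inE => /eqP ->. Qed.

Lemma instance_cut_shallow S (Es Fs : seq (tree S)) (I J : pre S) F G :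
  I \in instance_cut Es Fs -> J \in instance_cut Es Fs ->
  F \in cut_shallow I -> G \in cut_shallow J -> F.1 = G.1.
Proof.
case: Es Fs => [|E Es] [|E' Fs] //=; rewrite !inE => /eqP -> /eqP ->.
by rewrite !inE => /eqP -> /eqP ->.
Qed.

Lemma roots_no_bin S K K' (P : pre S) :
  (forall c, c \in cuts P -> ~~ is_bin (cut_formula c)) -> roots K P = roots K' P.
Proof.
move=> H; congr (_ ++ flatten _); apply/eq_in_map => c Hc.
by rewrite /mcut (negbTE (H c Hc)).
Qed.

Lemma system_eigenvars_roots S K (P : pre S) :
  system_eigenvars (roots K P) = pre_eigenvars P.
Proof. by rewrite /pre_eigenvars (all_treesE K) /system_eigenvars /unzip2 -map_comp. Qed.

Lemma ranked_roots S K r (P : pre S) :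
  expansion_preproof P -> (forall c, c \in cuts P -> is_qua (cut_formula c)) ->
  ok_pre (@untagged S) r P -> ranked_system (fun x => vsize (r x)) (roots K P).
Proof.
move=> HP Hq Hok mE; rewrite (roots_no_bin K (@untagged S)); last first.
  by move=> c /Hq; case: (cut_formula c).
move=> HE; have Ht := preproof_is_tree HP HE; have HO := Hok _ HE.
case: (roots_cases HE) => [[E HE' Em]|[c [b [Hc Em]]]]; subst mE; rewrite /= in Ht HO *.
  have Hcl z : ~ occ_formula z (Sh E) by case: HP => _ _ _ _ _ /(_ _ (map_f _ HE') z).
  exists (fun _ => False); first exact: ranked_ok_closed Ht HO (fun _ => id).
  by move=> _ z /Hcl.
exists (fun z => occ_formula z (Sh (side b c))) => //.
rewrite /mcut if_same in HO.
apply: (ranked_ok_quantified Ht HO _).1.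
have := Hq _ Hc; case: b {HE Ht HO} => //=.
by case: HP => _ /(_ c Hc)[_ _ _ ->] _ _ _ _; rewrite is_qua_dual.
Qed.

Lemma preproof_solution_inj S r (P : pre S) :
  expansion_preproof P -> (forall c, c \in cuts P -> is_qua (cut_formula c)) ->
  ok_pre (@untagged S) r P -> default_off_eigenvars r P ->
  forall x y, r x = r y -> x = y.
Proof.
move=> HP Hq Hok Hd.
have Hb c : c \in cuts P -> is_bin (cut_formula c) = false.
  by move=> /Hq; case: (cut_formula c).
apply: (solution_inj (preproof_raw HP) _ Hok Hd) => [|Q|c Hc|F G].
- exact/wf_pre_var/preproof_wf.
- exact: preproof_normal.
- by rewrite Hb.
- by move=> /mapP[c Hc ->] _; rewrite Hb.
Qed.

Lemma cuts_bounded_ext S d V (r r' : var -> val S) (P : pre S) :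
  (forall F x, F \in cut_shallow P -> qdepth F.1 = d -> occ_formula x F.1 -> r x = r' x) ->
  cuts_bounded d V r P -> cuts_bounded d V r' P.
Proof.
move=> H Hb F HF; case: (Hb F HF) => [|[H1 H2 H3]]; [by left|right; split=> //].
by rewrite -(fsem_ext (A := F.1) 0 (r1 := r)) // => x; apply: H.
Qed.

Definition shift_var (N i : nat) (x : var) : var := i.+1 * N + x.

Definition copy_tree S N xs alpha (t : term S var) i (E : tree S) : tree S :=
  esubst (single alpha t) (esubst (renaming S xs (shift_var N i)) E).

Definition copy_pre S N xs alpha (t : term S var) i (P : pre S) : pre S :=
  psubst (single alpha t) (psubst (renaming S xs (shift_var N i)) P).

Lemma vsubst_renaming S xs e x :
  vsubst (renaming S xs e) x = if x \in xs then e x else x.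
Proof. by []. Qed.

Lemma vsubst_single_neq S alpha (t : term S var) x :
  x != alpha -> vsubst (single alpha t) x = x.
Proof. by rewrite /vsubst /single => /negbTE ->. Qed.

Lemma shift_var_ge N i x : N <= shift_var N i x.
Proof. by rewrite /shift_var; nia. Qed.

Lemma renamed_map S N xs alpha (t : term S var) i s :
  alpha < N -> {subset s <= xs} ->
  map (vsubst (single alpha t)) (map (vsubst (renaming S xs (shift_var N i))) s) =
  map (shift_var N i) s.
Proof.
move=> Ha Hs; rewrite -map_comp; apply/eq_in_map => x Hx /=.
rewrite vsubst_renaming (Hs x Hx) vsubst_single_neq //.
by have := shift_var_ge N i x; case: eqP => // ->; lia.
Qed.

Lemma copy_tree_perm S N xs alpha (t : term S var) i (E : tree S) :
  alpha < N -> {subset eigenvars E <= xs} ->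
  perm_eq (eigenvars (copy_tree N xs alpha t i E)) (map (shift_var N i) (eigenvars E)).
Proof.
move=> Ha Hs; rewrite -(renamed_map t i Ha Hs).
apply: perm_trans (esubst_perm _ _) _; exact/perm_map/esubst_perm.
Qed.

Lemma copy_pre_perm S N xs alpha (t : term S var) i (P : pre S) :
  alpha < N -> {subset pre_eigenvars P <= xs} ->
  perm_eq (pre_eigenvars (copy_pre N xs alpha t i P))
    (map (shift_var N i) (pre_eigenvars P)).
Proof.
move=> Ha Hs; rewrite -(renamed_map t i Ha Hs).
apply: perm_trans (psubst_perm _ _) _; exact/perm_map/psubst_perm.
Qed.

Lemma fixes_copy_tree S N xs alpha (t : term S var) i (E : tree S) :
  alpha < N -> {subset eigenvars E <= xs} ->
  fixes_eigenvars (single alpha t) (esubst (renaming S xs (shift_var N i)) E).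
Proof.
move=> Ha Hs y; rewrite (perm_mem (esubst_perm _ _)) => /mapP[x Hx ->].
rewrite vsubst_renaming (Hs x Hx) vsubst_single_neq; last first.
  by have := shift_var_ge N i x; case: eqP => // ->; lia.
rewrite /single; case: eqP => // E'.
by have := shift_var_ge N i x; rewrite E'; lia.
Qed.

Lemma fixes_copy_pre S N xs alpha (t : term S var) i (P : pre S) :
  alpha < N -> {subset pre_eigenvars P <= xs} ->
  fixes_pre (single alpha t) (psubst (renaming S xs (shift_var N i)) P).
Proof.
move=> Ha Hs y; rewrite (perm_mem (psubst_perm _ _)) => /mapP[x Hx ->].
rewrite vsubst_renaming (Hs x Hx) vsubst_single_neq; last first.
  by have := shift_var_ge N i x; case: eqP => // ->; lia.
rewrite /single; case: eqP => // E'.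
by have := shift_var_ge N i x; rewrite E'; lia.
Qed.

Definition copy_interp S N xs alpha (t : term S var) i (r : var -> val S) : var -> val S :=
  scomp (scomp r (single alpha t)) (renaming S xs (shift_var N i)).

Lemma copy_tree_ok S N xs alpha (t : term S var) i r m (E : tree S) :
  alpha < N -> {subset eigenvars E <= xs} ->
  ok (copy_interp N xs alpha t i r) m E -> ok r m (copy_tree N xs alpha t i E).
Proof.
move=> Ha Hs H; apply: ok_esubst; first exact: fixes_copy_tree.
exact: ok_esubst.
Qed.

Lemma copy_tree_wf S N xs alpha (t : term S var) i r (E : tree S) :
  alpha < N -> {subset eigenvars E <= xs} ->
  wf (copy_interp N xs alpha t i r) E -> wf r (copy_tree N xs alpha t i E).
Proof.
move=> Ha Hs H; apply: wf_esubst; first exact: fixes_copy_tree.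
exact: wf_esubst.
Qed.

Lemma copy_tree_Sh S N xs alpha (t : term S var) i r k (E : tree S) :
  fsem k r (Sh (copy_tree N xs alpha t i E)) =
  fsem k (copy_interp N xs alpha t i r) (Sh E).
Proof. by rewrite /copy_tree !Sh_esubst !fsem_fsubst. Qed.

Lemma copy_tree_qdepth S N xs alpha (t : term S var) i (E : tree S) :
  qdepth (Sh (copy_tree N xs alpha t i E)) = qdepth (Sh E).
Proof. by rewrite /copy_tree !Sh_esubst !qdepth_fsubst. Qed.

Lemma copy_pre_ok S K N xs alpha (t : term S var) i r (P : pre S) :
  alpha < N -> {subset pre_eigenvars P <= xs} -> pre_closed P ->
  ok_pre K (copy_interp N xs alpha t i r) P -> ok_pre K r (copy_pre N xs alpha t i P).
Proof.
move=> Ha Hs Hc H; apply: ok_psubst; first exact: psubst_closed.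
  exact: fixes_copy_pre.
exact: ok_psubst.
Qed.

Lemma copy_pre_wf S N xs alpha (t : term S var) i r (P : pre S) :
  alpha < N -> {subset pre_eigenvars P <= xs} ->
  wf_pre (copy_interp N xs alpha t i r) P -> wf_pre r (copy_pre N xs alpha t i P).
Proof.
move=> Ha Hs H; apply: wf_psubst; first exact: fixes_copy_pre.
exact: wf_psubst.
Qed.

Lemma copy_pre_bounded S d V N xs alpha (t : term S var) i r (P : pre S) :
  cuts_bounded d V (copy_interp N xs alpha t i r) P ->
  cuts_bounded d V r (copy_pre N xs alpha t i P).
Proof. by move=> H; apply/bounded_psubst/bounded_psubst. Qed.

Lemma copy_interpE S N xs alpha (t : term S var) i (r r' : var -> val S) x :
  alpha < N -> (forall y, y \in xs -> r (shift_var N i y) = r' y) ->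
  tsem r t = r' alpha -> (x \notin xs -> x != alpha -> r x = r' x) ->
  copy_interp N xs alpha t i r x = r' x.
Proof.
move=> Ha H1 H2 H3; rewrite /copy_interp /scomp /renaming /=.
case: (boolP (x \in xs)) => Hx; rewrite /single.
  case: eqP => [E|_]; last exact: H1.
  by have := shift_var_ge N i x; rewrite E; lia.
case: eqP => [->//|/eqP Hxa]; exact: H3.
Qed.

Definition reduct S N alpha (l : seq (term S var * tree S)) (E : tree S) (P : pre S) :
    seq (pre S) :=
  let xs := pre_eigenvars P ++ eigenvars E in
  P :: instance_cut (unzip2 l)
         [seq copy_tree N xs alpha (nth (Var 0) (unzip1 l) i) i E | i <- iota 0 (size l)]
    ++ [seq copy_pre N xs alpha (nth (Var 0) (unzip1 l) i) i P | i <- iota 0 (size l)].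

Lemma reduct_perm S N alpha (l : seq (term S var * tree S)) (E : tree S) (P : pre S) :
  alpha < N ->
  perm_eq (flatten [seq pre_eigenvars Q | Q <- reduct N alpha l E P])
    ((pre_eigenvars P ++ flatten [seq eigenvars tE.2 | tE <- l]) ++
     [seq shift_var N i x | i <- iota 0 (size l), x <- pre_eigenvars P ++ eigenvars E]).
Proof.
move=> Ha; rewrite /reduct; set xs := _ ++ eigenvars E.
set Fs := [seq copy_tree _ _ _ _ _ _ | _ <- _].
set Ps := [seq copy_pre _ _ _ _ _ _ | _ <- _].
rewrite /= map_cat flatten_cat -catA perm_cat2l.
have Hsz : size (unzip2 l) = size Fs by rewrite /unzip2 !size_map size_iota.
have /permP H1 := instance_cut_perm Hsz.
have HE : {subset eigenvars E <= xs} by move=> x Hx; rewrite mem_cat Hx orbT.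
have HP : {subset pre_eigenvars P <= xs} by move=> x Hx; rewrite mem_cat Hx.
have H2 : perm_eq (flatten [seq eigenvars F | F <- Fs] ++ flatten [seq pre_eigenvars Q | Q <- Ps])
    [seq shift_var N i x | i <- iota 0 (size l), x <- xs].
  rewrite /Fs /Ps -!map_comp; elim: (iota 0 (size l)) => //= i s /permP IH.
  have /permP h1 := copy_tree_perm (nth (Var 0) (unzip1 l) i) i Ha HE.
  have /permP h2 := copy_pre_perm (nth (Var 0) (unzip1 l) i) i Ha HP.
  apply/permP => p; have := IH p; have := h1 p; have := h2 p.
  have -> : map (shift_var N i) xs = map (shift_var N i) (pre_eigenvars P) ++
      map (shift_var N i) (eigenvars E) by rewrite map_cat.
  rewrite !count_cat; lia.
move/permP: H2 => H2; apply/permP => p; have := H1 p; have := H2 p.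
rewrite !count_cat /unzip2 -!map_comp => <- ->.
by rewrite addnA.
Qed.

Lemma shift_var_inj N i j x y : x < N -> y < N ->
  shift_var N i x = shift_var N j y -> i = j /\ x = y.
Proof.
rewrite /shift_var => Hx Hy H; have Eij : i = j by nia.
by split=> //; move: H; rewrite Eij => /addnI.
Qed.

Lemma reduct_uniq S N alpha (l : seq (term S var * tree S)) (E : tree S) (P : pre S) :
  alpha < N ->
  uniq (pre_eigenvars P ++ flatten [seq eigenvars tE.2 | tE <- l]) ->
  uniq (pre_eigenvars P ++ eigenvars E) ->
  (forall x, x \in pre_eigenvars P ++ flatten [seq eigenvars tE.2 | tE <- l] -> x < N) ->
  (forall x, x \in pre_eigenvars P ++ eigenvars E -> x < N) ->
  uniq (flatten [seq pre_eigenvars Q | Q <- reduct N alpha l E P]).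
Proof.
move=> Ha Hu1 Hu2 HN1 HN2; rewrite (perm_uniq (reduct_perm l E P Ha)) cat_uniq Hu1 /=.
apply/andP; split.
  apply/hasPn => x /allpairsP[[i y] /= [_ _ ->]]; apply/negP => /HN1.
  by have := shift_var_ge N i y; lia.
apply: allpairs_uniq => //; first exact: iota_uniq.
move=> [i x] [j y] /allpairsP[[i' x'] /= [_ Hx [-> ->]]] /allpairsP[[j' y'] /= [_ Hy [-> ->]]].
by move=> /(shift_var_inj (HN2 _ Hx) (HN2 _ Hy))[-> ->].
Qed.

Lemma merge_instance S d V (J Q : pre S) :
  raw J -> (forall v, holds v J) -> one_bin_cut J ->
  (forall K, exists r, good K d V r J) -> normal_form J Q ->
  bounded_preproof d V Q /\ pre_Sh Q =i pre_Sh J.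
Proof.
move=> Hraw Hh H1 Hg HQ; apply: merge_bounded => // HrQ.
pose K b : option (val S) := Some (VTag b).
have [HQ1 [r [G1 G2 G3 _]]] : one_bin_cut Q /\ exists r, good K d V r Q.
  pose inv (R : pre S) := [/\ raw R, one_bin_cut R & exists r, good K d V r R].
  suff [] : inv Q by [].
  apply: (normal_form_ind _ HQ); last by split.
  move=> R R' HR [I1 I2 [r I3]]; split.
  - exact: merge_step_raw HR I1.
  - exact: merge_step_one_bin HR I2.
  - exact: merge_step_good HR I1 I3.
apply: (normal_preproof _ _ HrQ G3 HQ.2); first exact: (ok_nice G1 G2).
exact: (solution_inj HrQ G3 G1 G2 HQ.2).
Qed.

Lemma nth_unzip S (l : seq (term S var * tree S)) t0 E0 i :
  i < size l -> (nth t0 (unzip1 l) i, nth E0 (unzip2 l) i) \in l.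
Proof.
move=> Hi; rewrite (nth_map (t0, E0)) // (nth_map (t0, E0)) // -surjective_pairing.
exact: mem_nth.
Qed.

Lemma reduct_good S K d V N C1 C2 (T : seq (tree S)) A l alpha E rho :
  let c := Cut (TEx A l) (TAll (dual A) alpha E) in
  let P := Pre (C1 ++ c :: C2) T in
  expansion_preproof P -> ok_pre (@untagged S) rho P -> default_off_eigenvars rho P ->
  cuts_bounded d V rho P -> (forall c', c' \in cuts P -> is_qua (cut_formula c')) ->
  (forall c', c' \in cuts P -> qdepth (cut_formula c') = d ->
     vsize (fsem 0 rho (cut_formula c')) <= vsize (fsem 0 rho (cut_formula c))) ->
  qdepth (cut_formula c) = d -> (forall x, occ_pre x P -> x < N) ->
  exists r, good K d [seq v <- V | v != fsem 0 rho (cut_formula c)] r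
              (join (reduct N alpha l E (Pre (C1 ++ C2) T))).
Proof.
move=> c P HP Hok Hd Hb Hq Hmax Hdc HN.
set P0 := Pre (C1 ++ C2) T; set v0 := fsem 0 rho (cut_formula c).
have Hc : c \in cuts P by rewrite mem_cat mem_head orbT.
have HP0 : expansion_preproof P0 := split_cut_preproof HP.
have Hq0 c' : c' \in cuts P0 -> is_qua (cut_formula c').
  by move=> /(@split_cut_sub _ C1 c C2); exact: Hq.
have Hcl : pre_closed P0 by case: HP0.
have Hok0 : ok_pre (@untagged S) rho P0 by move=> mE /(split_cut_roots c)/Hok.
have OE : ok rho (Above None) (TEx A l).
  exact: (Hok _ (roots_cpos _ Hc)).
have OA : ok rho (Above None) (TAll (dual A) alpha E).
  exact: (Hok _ (roots_cneg _ Hc)).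
have [TE TA] : is_tree (TEx A l) /\ is_tree (TAll (dual A) alpha E).
  by case: HP => _ /(_ c Hc)[].
have Hl t E' : (t, E') \in l -> is_tree E' /\ Sh E' = inst A t.
  by move=> H; inversion TE; subst; split; eauto.
have [HE SE] : is_tree E /\ Sh E = inst (dual A) (Var alpha) by inversion TA.
have [mE [mF Hinst]] := @instance_cut_ok S K E E (unzip2 l)
  [seq copy_tree N (pre_eigenvars P0 ++ eigenvars E) alpha (nth (Var 0) (unzip1 l) i) i E
  | i <- iota 0 (size l)] (etrans (size_map _ _) (esym (etrans (size_map _ _) (size_iota _ _)))).
set xs := pre_eigenvars P0 ++ eigenvars E in Hinst.
set ti := nth (Var 0) (unzip1 l); set Ei := nth E (unzip2 l).
have Hi i : i < size l -> (ti i, Ei i) \in l by exact: nth_unzip.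
have Hperm := split_cut_perm C1 c C2 T; rewrite -/P -/P0 /= in Hperm.
have Hu : uniq ((flatten [seq eigenvars tE.2 | tE <- l] ++ alpha :: eigenvars E) ++
    pre_eigenvars P0) by rewrite -(perm_uniq Hperm); case: HP.
have [Ha Hu'] : alpha \notin eigenvars E ++ pre_eigenvars P0 /\
    uniq (eigenvars E ++ pre_eigenvars P0).
  by move: Hu; rewrite -catA cat_uniq => /and3P[_ _ H]; apply/andP.
pose rk x := vsize (rho x).
have HEi : [seq Ei i | i <- iota 0 (size l)] = unzip2 l.
  by rewrite -(size_map snd l); exact: mkseq_nth.
pose sys0 := roots K P0 ++ [seq (mE i, Ei i) | i <- iota 0 (size l)].
have Esys0 : system_eigenvars sys0 =
    pre_eigenvars P0 ++ flatten [seq eigenvars tE.2 | tE <- l].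
  rewrite /system_eigenvars /sys0 map_cat flatten_cat -(system_eigenvars_roots K).
  have -> : [seq eigenvars tE.2 | tE <- l] = map (@eigenvars S) (unzip2 l).
    by rewrite /unzip2 -map_comp.
  by rewrite -HEi -!map_comp.
pose sys i := roots K P0 ++ [:: (mF i, E)].
have Esys i : system_eigenvars (sys i) = xs.
  rewrite /system_eigenvars /sys map_cat flatten_cat -/(system_eigenvars _).
  by rewrite system_eigenvars_roots /= cats0.
have R0 := @ranked_roots S K rho P0 HP0 Hq0 Hok0.
have Rsys0 : ranked_system rk sys0.
  move=> mE'; rewrite mem_cat => /orP[/R0 //|/mapP[i]]; rewrite mem_iota => /andP[_ Hil ->] /=.
  have Hin := Hi i Hil; have [Ht HSh] := Hl _ _ Hin.
  exists (fun z => occ_formula (Some z) A \/ occ_term z (ti i)); last first.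
    by move=> _ z; rewrite HSh => Hz; exact: occ_inst Hz.
  have /ok_ex /(_ _ _ Hin) Oi := OE; apply: (ranked_ok Ht Oi) => z [Hz|Hz] /=.
    by have := vsize_Qua Ex rho Hz; rewrite /=; clear; lia.
  by have := vsize_tsem rho Hz; clear; lia.
have Rsys i : ranked_system rk (sys i).
  move=> mE'; rewrite mem_cat => /orP[/R0 //|]; rewrite inE => /eqP -> /=.
  have /ok_all[Hal Oi] := OA.
  exists (fun z => occ_formula (Some z) (dual A) \/ z = alpha); last first.
    by move=> _ z; rewrite SE => Hz; case: (occ_inst Hz); [left|right].
  apply: (ranked_ok HE Oi) => z [Hz|->]; last by rewrite Hal.
  by have := vsize_Qua All rho Hz; rewrite /=; clear; lia.
have [rho0 O0 D0] : exists2 r0, ok_system r0 sys0 &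
    forall x, x \notin system_eigenvars sys0 -> r0 x = VVar x.
  apply: solve Rsys0 _; rewrite Esys0 uniq_catC; move: Hu.
  by rewrite -catA uniq_catCA cat_uniq => /and3P[].
have Hex i : exists r, ok_system r (sys i) /\
    forall x, x \notin xs -> r x = if x == alpha then tsem rho0 (ti i) else rho0 x.
  have [|r1 H1 H2] := @solve S rk (sys i)
    (fun x => if x == alpha then tsem rho0 (ti i) else rho0 x) (Rsys i).
    by rewrite Esys uniq_catC.
  by exists r1; split=> // x Hx; apply: H2; rewrite Esys.
have [rhoi Hrhoi] := choice Hex.
have alpha_xs : alpha \notin xs.
  by rewrite mem_cat orbC -mem_cat.
have Oroots r : ok_system r (roots K P0) -> ok_system r (roots (@untagged S) P0).
  by rewrite (roots_no_bin K (@untagged S)) // => c' /Hq0; case: (cut_formula c').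
have Ocut x : x \in flatten [seq eigenvars tE.2 | tE <- l] ++ alpha :: eigenvars E ->
    vsize v0 < rk x.
  rewrite mem_cat => /orP[Hx|Hx].
    exact: (ranked_ok_quantified TE OE isT).2.
  have -> : vsize v0 = vsize (fsem 0 rho (Sh (TAll (dual A) alpha E))).
    by rewrite -(vsize_dual (cut_formula c)).
  exact: (ranked_ok_quantified TA OA isT).2.
(* Small values are determined by the equations of the remaining trees. *)
have Agree r : ok_system r (roots K P0) ->
    (forall x, x \notin pre_eigenvars P -> r x = VVar x) ->
    forall x, rk x <= vsize v0 -> rho x = r x.
  move=> /Oroots Or Dr; apply: (solution_unique (r := rk) _ Hok0 Or).
    exact: ranked_roots.
  move=> x; rewrite system_eigenvars_roots => Hx Hs.
  have Px : x \notin pre_eigenvars P.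
    rewrite (perm_mem Hperm) mem_cat negb_or Hx andbT.
    by apply/negP => /Ocut; rewrite ltnNge Hs.
  by rewrite Hd // Dr.
have A0 : forall x, rk x <= vsize v0 -> rho x = rho0 x.
  apply: Agree => [mE' HmE|x]; first by apply: O0; rewrite mem_cat HmE.
  rewrite (perm_mem Hperm) => Hx; apply: D0; apply: contra Hx.
  by rewrite Esys0 !mem_cat => /orP[->|->]; rewrite ?orbT.
have Ai i : forall x, rk x <= vsize v0 -> rho x = rhoi i x.
  have [Oi Di] := Hrhoi i.
  apply: Agree => [mE' HmE|x]; first by apply: Oi; rewrite mem_cat HmE.
  rewrite (perm_mem Hperm) !mem_cat in_cons !negb_or => /andP[/andP[H1 /andP[H2 H3]] H4].
  rewrite Di ?mem_cat ?negb_or ?H3 ?H4 // (negbTE H2); apply: D0.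
  by rewrite Esys0 mem_cat negb_or H4.
have Nalpha : alpha < N.
  apply: HN; exists (TAll (dual A) alpha E); first exact: mem_roots (roots_cneg K Hc).
  by constructor 2.
have NP x : x \in pre_eigenvars P -> x < N.
  move=> /flattenP[_ /mapP[E' HE' ->] Hx]; apply: HN; exists E' => //.
  exact: occ_eigenvar.
have Nxs x : x \in xs -> x < N.
  move=> Hx; apply: NP; rewrite (perm_mem Hperm); move: Hx; rewrite !mem_cat in_cons.
  by case/orP => ->; rewrite ?orbT.
have Nt i x : i < size l -> occ_term x (ti i) -> x < N.
  move=> /Hi Hin Hx; apply: HN; exists (TEx A l); first exact: mem_roots (roots_cpos K Hc).
  by apply: (occ_tree_ex A Hin); left.
have NEi i x : i < size l -> occ_tree x (Ei i) -> x < N.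
  move=> /Hi Hin Hx; apply: HN; exists (TEx A l); first exact: mem_roots (roots_cpos K Hc).
  by apply: (occ_tree_ex A Hin); right.
have NE x : occ_tree x E -> x < N.
  move=> Hx; apply: HN; exists (TAll (dual A) alpha E); first exact: mem_roots (roots_cneg K Hc).
  by constructor 3.
have NP0 x : occ_pre x P0 -> x < N.
  move=> [E' HE' Hx]; apply: HN; exists E' => //.
  move: HE'; rewrite !(all_treesE K) => /mapP[mE' HmE ->]; apply: map_f.
  exact: (split_cut_roots c HmE).
pose rn x : val S := if x < N then rho0 x else
  if ((x %/ N).-1 < size l) && (x %% N \in xs) then rhoi (x %/ N).-1 (x %% N) else VVar x.
have rn_lt x : x < N -> rn x = rho0 x by rewrite /rn => ->.
have rn_shift i x : i < size l -> x \in xs -> rn (shift_var N i x) = rhoi i x.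
  move=> Hil Hx; have Hx' := Nxs x Hx; have N0 : 0 < N by exact: leq_ltn_trans Hx'.
  rewrite /rn ltnNge shift_var_ge /= /shift_var divnMDl // divn_small // addn0 /=.
  by rewrite modnMDl modn_small // Hil Hx.
have Hcopy i x : i < size l -> x < N ->
    copy_interp N xs alpha (ti i) i rn x = rhoi i x.
  move=> Hil Hx; have [_ Di] := Hrhoi i; apply: copy_interpE => //.
  - by move=> y Hy; apply: rn_shift.
  - rewrite Di // eqxx; apply: tsem_ext => z Hz; apply: rn_lt; exact: Nt Hz.
  - by move=> Hx1 /negbTE Hx2; rewrite Di // Hx2 rn_lt.
have xs_E : {subset eigenvars E <= xs} by move=> x Hx; rewrite mem_cat Hx orbT.
have xs_P0 : {subset pre_eigenvars P0 <= xs} by move=> x Hx; rewrite mem_cat Hx.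
have VP0 := preproof_wf HP0.
have nth_copy j : j < size l -> nth E [seq copy_tree N xs alpha (ti i) i E | i <- iota 0 (size l)] j
    = copy_tree N xs alpha (ti j) j E.
  by move=> Hj; rewrite (nth_map 0) ?size_iota // nth_iota.
have szl : size (unzip2 l) = size l by rewrite size_map.
have Hbounded r : (forall F z, F \in cut_shallow P0 -> qdepth F.1 = d ->
      occ_formula z F.1 -> rho z = r z) ->
    cuts_bounded d [seq v <- V | v != v0] r P0.
  move=> Hr; apply: cuts_bounded_ext Hr _ => F HF.
  case: (Hb F (split_cut_shallow c HF)) => [|[H1 H2 H3]]; [by left|right; split=> //].
  rewrite mem_filter H3 andbT; apply/eqP => EF.
  have inj := preproof_solution_inj HP Hq Hok Hd.
  have {}EF : F.1 = cut_formula c.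
    by apply: (fsem_inj (ok_nice Hok Hd) _ EF) => x y _; exact: inj.
  case: HP => _ _ + _ _ _; rewrite /= map_cat /= -cat_rcons -cats1 -catA uniq_catCA /=.
  rewrite -map_cat => /andP[/negP + _]; apply; rewrite -EF.
  by case/mapP: HF => c' Hc' -> /=; exact: map_f.
have Hsmall F z : F \in cut_shallow P0 -> qdepth F.1 = d -> occ_formula z F.1 ->
    rk z <= vsize v0 /\ z < N.
  move=> HF HdF Hz; have /mapP[c' Hc' EF] := split_cut_shallow c HF.
  split; last first.
    apply: HN; exists (cpos c'); first exact: mem_roots (roots_cpos K Hc').
    by apply: occ_Sh; move: Hz; rewrite EF.
  apply: leq_trans (ltnW (vsize_fsem 0 rho Hz)) _; rewrite EF.
  by apply: Hmax => //; rewrite EF in HdF.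
exists rn; split.
- apply: ok_join => P'; rewrite in_cons mem_cat => /or3P[/eqP ->|HI|/mapP[i]].
  + apply: (ok_pre_ext (r1 := rho0)) => [x /NP0/rn_lt -> //|mE' HmE].
    by apply: O0; rewrite mem_cat HmE.
  + apply: Hinst HI => j; rewrite szl => Hj; split.
      apply: (ok_ext (r1 := rho0)) => [x /(NEi _ _ Hj)/rn_lt -> //|].
      apply: (O0 (mE j, Ei j)); rewrite mem_cat; apply/orP; right.
      by apply/mapP; exists j; rewrite // mem_iota.
    rewrite nth_copy //; apply: copy_tree_ok => //.
    apply: (ok_ext (r1 := rhoi j)) => [x /NE Hx|]; first by rewrite Hcopy.
    by apply: ((Hrhoi j).1 (mF j, E)); rewrite mem_cat mem_head orbT.
  + rewrite mem_iota => /andP[_ Hil] ->; apply: copy_pre_ok => //.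
    apply: (ok_pre_ext (r1 := rhoi i)) => [x /NP0 Hx|mE' HmE]; first by rewrite Hcopy.
    by apply: (Hrhoi i).1; rewrite mem_cat HmE.
- move=> x; rewrite (perm_mem (join_perm _)) (perm_mem (reduct_perm _ _ _ Nalpha)).
  rewrite mem_cat negb_or -Esys0 => /andP[H1 H2]; rewrite /rn; case: ltnP => HxN.
    exact: D0.
  case: ifP => // /andP[H3 H4]; case/negP: H2; apply/allpairsP.
  exists ((x %/ N).-1, x %% N); split=> //=; first by rewrite mem_iota.
  rewrite /shift_var prednK -?divn_eq // divn_gt0 //.
  exact: leq_ltn_trans (leq0n _) (Nxs _ H4).
- apply: wf_join => P'; rewrite in_cons mem_cat => /or3P[/eqP ->|HI|/mapP[i]].
  + exact: wf_pre_var.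
  + apply: (instance_cut_wf (E0 := E) (F0 := E) _ _ _ _ HI).
    * by rewrite szl size_map size_iota.
    * by move=> E' /mapP[[t F] HtF ->]; apply: is_tree_wf; case: (Hl _ _ HtF).
    * move=> E' /mapP[i Hil ->]; apply: copy_tree_wf => //; exact: is_tree_wf.
    * move=> j; rewrite szl => Hj; rewrite nth_copy // copy_tree_Sh.
      rewrite (fsem_ext 0 (r2 := rhoi j)); last by move=> x /occ_Sh/NE; exact: Hcopy.
      rewrite -/(Ei j) (Hl _ _ (Hi _ Hj)).2 SE /inst dual_fsubst !fsem_fsubst.
      apply: fsem_ext => -[z|] Hz; rewrite /scomp /=.
        have Hz' : rk z <= vsize v0.
          apply: ltnW; have := vsize_Qua Ex rho (occ_dual Hz); exact.
        rewrite -(Ai j z Hz') A0 // rn_lt //.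
        apply: HN; exists (TEx A l); first exact: mem_roots (roots_cpos K Hc).
        by left; apply: occ_dual.
      rewrite (Hrhoi j).2 // eqxx; apply: tsem_ext => x Hx; apply/esym/rn_lt.
      exact: Nt Hx.
  + move=> _ ->; apply: copy_pre_wf => //; exact: wf_pre_var.
- apply: bounded_join => P'; rewrite in_cons mem_cat => /or3P[/eqP ->|HI|/mapP[i]].
  + apply: Hbounded => F z HF HdF Hz; have [H1 H2] := Hsmall F z HF HdF Hz.
    by rewrite rn_lt // A0.
  + apply: instance_cut_bounded HI => E'.
      move=> /mapP[[t F] HtF ->]; rewrite (Hl _ _ HtF).2 /inst qdepth_fsubst.
      by rewrite -Hdc /cut_formula /=.
    move=> /mapP[i Hil ->]; rewrite copy_tree_qdepth SE /inst qdepth_fsubst qdepth_dual.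
    by rewrite -Hdc /cut_formula /=.
  + rewrite mem_iota => /andP[_ Hil] ->; apply: copy_pre_bounded.
    apply: Hbounded => F z HF HdF Hz; have [H1 H2] := Hsmall F z HF HdF Hz.
    by rewrite Hcopy //; exact: Ai.
Qed.

Lemma reductE S N alpha (l : seq (term S var * tree S)) (E : tree S) (P : pre S) :
  let etas := [seq shift_var N i | i <- iota 0 (size l)] in
  let xs := pre_eigenvars P ++ eigenvars E in
  let sigmas := [seq (renaming S xs et.1, single alpha et.2) | et <- zip etas (unzip1 l)] in
  P :: instance_cut (unzip2 l) [seq esubst s.2 (esubst s.1 E) | s <- sigmas]
    ++ [seq psubst s.2 (psubst s.1 P) | s <- sigmas] = reduct N alpha l E P.
Proof.
rewrite /reduct /=; set xs := _ ++ eigenvars E.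
have {1 2}-> : unzip1 l = [seq nth (Var 0) (unzip1 l) i | i <- iota 0 (size l)].
  by rewrite -(size_map fst l); exact/esym/mkseq_nth.
by rewrite zip_map -!map_comp.
Qed.

Lemma shift_var_fresh S N (P : pre S) xs n :
  (forall x, occ_pre x P -> x < N) -> (forall x, x \in xs -> x < N) -> uniq xs ->
  fresh_renamings P xs [seq shift_var N i | i <- iota 0 n].
Proof.
move=> HN Hxs Hu; split; last first.
  move=> e x /List.in_map_iff[i [<- _]] Hx /HN.
  by have := shift_var_ge N i x; lia.
rewrite -map_comp; change (uniq [seq shift_var N i x | i <- iota 0 n, x <- xs]).
apply: allpairs_uniq => //; first exact: iota_uniq.
move=> [i x] [j y] /allpairsP[[i' x'] /= [_ Hx [-> ->]]] /allpairsP[[j' y'] /= [_ Hy [-> ->]]].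
by move=> /(shift_var_inj (Hxs _ Hx) (Hxs _ Hy))[-> ->].
Qed.

Lemma copy_pre_Sh S N xs alpha (t : term S var) i (P : pre S) :
  pre_closed P -> pre_Sh (copy_pre N xs alpha t i P) =i pre_Sh P.
Proof. by move=> H A; rewrite psubst_Sh ?psubst_Sh //; exact: psubst_closed. Qed.

Lemma reduct_Sh S N alpha (l : seq (term S var * tree S)) (E : tree S) (P : pre S) :
  pre_closed P -> pre_Sh (join (reduct N alpha l E P)) =i pre_Sh P.
Proof.
move=> Hc A; rewrite join_Sh; apply/idP/idP => [|HA].
  move=> /flattenP[_ /mapP[Q + ->]]; rewrite in_cons mem_cat => /or3P[/eqP ->//|HI|/mapP[i _ ->]].
    by rewrite (instance_cut_closed HI).
  by rewrite copy_pre_Sh.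
by rewrite /reduct /= mem_cat HA.
Qed.

Lemma reduct_holds S N alpha (l : seq (term S var * tree S)) (E : tree S) (P : pre S) :
  (forall v, has (fun tE => qeval v (Dp tE.2)) l && qeval v (Dp E) || holds v P) ->
  forall v, holds v (join (reduct N alpha l E P)).
Proof.
move=> H v; apply: join_holds; rewrite /reduct /= has_cat.
case: (boolP (holds v P)) => //= HP; set xs := _ ++ _; set ti := nth _ _.
pose vi i (a : atom S var) := v (asubst (single alpha (ti i)) (asubst (renaming S xs (shift_var N i)) a)).
case: (boolP (has (fun i => holds (vi i) P) (iota 0 (size l)))) => [/hasP[i Hi Hv]|/hasPn Hv].
  apply/orP; right; rewrite has_map; apply/hasP; exists i => //=.
  by apply: psubst_holds; apply: psubst_holds.
apply/orP; left; apply: instance_cut_holds; first by rewrite !size_map size_iota.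
  by have := H v; rewrite (negbTE HP) orbF has_map => /andP[].
rewrite all_map; apply/allP => i Hi /=.
have := H (vi i); rewrite (negbTE (Hv i Hi)) orbF => /andP[_ HE].
by apply: qeval_esubst; apply: qeval_esubst.
Qed.

Lemma quantifier_step S d V rho C1 C2 (T : seq (tree S)) A l alpha E :
  let c := Cut (TEx A l) (TAll (dual A) alpha E) in
  let P := Pre (C1 ++ c :: C2) T in
  expansion_preproof P -> (forall v, holds v P) ->
  ok_pre (@untagged S) rho P -> default_off_eigenvars rho P ->
  cuts_bounded d V rho P -> (forall c', c' \in cuts P -> is_qua (cut_formula c')) ->
  (forall c', c' \in cuts P -> qdepth (cut_formula c') = d ->
     vsize (fsem 0 rho (cut_formula c')) <= vsize (fsem 0 rho (cut_formula c))) ->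
  qdepth (cut_formula c) = d ->
  exists Q, [/\ cut_step P Q,
    bounded_preproof d [seq v <- V | v != fsem 0 rho (cut_formula c)] Q &
    pre_Sh Q =i pre_Sh P].
Proof.
move=> c P HP Hh Hok Hd Hb Hq Hmax Hdc.
have [N HN] := occ_pre_bound P; set P0 := Pre (C1 ++ C2) T.
have [Q HQ] := normal_form_exists (join (reduct N alpha l E P0)).
have HP0 : expansion_preproof P0 := split_cut_preproof HP.
have Hcl : pre_closed P0 by case: HP0.
have Hc : c \in cuts P by rewrite mem_cat mem_head orbT.
have Hperm := split_cut_perm C1 c C2 T; rewrite -/P -/P0 /= in Hperm.
have NP x : x \in pre_eigenvars P -> x < N.
  move=> /flattenP[_ /mapP[E' HE' ->] Hx]; apply: HN; exists E' => //.
  exact: occ_eigenvar.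
have Hu : uniq ((flatten [seq eigenvars tE.2 | tE <- l] ++ alpha :: eigenvars E) ++
    pre_eigenvars P0) by rewrite -(perm_uniq Hperm); case: HP.
have Na : alpha < N.
  by apply: NP; rewrite (perm_mem Hperm) !mem_cat mem_head orbT.
have N1 x : x \in pre_eigenvars P0 ++ flatten [seq eigenvars tE.2 | tE <- l] -> x < N.
  move=> Hx; apply: NP; rewrite (perm_mem Hperm); move: Hx; rewrite !mem_cat.
  by case/orP => ->; rewrite ?orbT.
have N2 x : x \in pre_eigenvars P0 ++ eigenvars E -> x < N.
  move=> Hx; apply: NP; rewrite (perm_mem Hperm); move: Hx; rewrite !mem_cat in_cons.
  by case/orP => ->; rewrite ?orbT.
have U1 : uniq (pre_eigenvars P0 ++ flatten [seq eigenvars tE.2 | tE <- l]).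
  by rewrite uniq_catC; move: Hu; rewrite -catA uniq_catCA cat_uniq => /and3P[].
have U2 : uniq (pre_eigenvars P0 ++ eigenvars E).
  have [_ H] : alpha \notin eigenvars E ++ pre_eigenvars P0 /\
      uniq (eigenvars E ++ pre_eigenvars P0).
    by move: Hu; rewrite -catA cat_uniq => /and3P[_ _ H]; apply/andP.
  by rewrite uniq_catC.
have Hraw : raw (join (reduct N alpha l E P0)).
  apply: raw_join; last exact: reduct_uniq.
  move=> R; rewrite in_cons mem_cat => /or3P[/eqP ->//|HI|/mapP[i _ ->]].
    by rewrite /pre_closed (instance_cut_closed HI).
  by apply/psubst_closed/psubst_closed.
have Hholds : forall v, holds v (join (reduct N alpha l E P0)).
  apply: reduct_holds => v; have := Hh v; rewrite split_cut_holds /qeval_cut.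
  by rewrite qeval_ex.
have Hbin R F : R \in reduct N alpha l E P0 -> F \in cut_shallow R -> is_bin F.1 ->
    R \in instance_cut (unzip2 l) [seq copy_tree N (pre_eigenvars P0 ++ eigenvars E) alpha
      (nth (Var 0) (unzip1 l) i) i E | i <- iota 0 (size l)].
  have Hno F' : F' \in cut_shallow P0 -> is_bin F'.1 = false.
    move=> /mapP[c' Hc' ->] /=; have := Hq c' (split_cut_sub c Hc').
    by case: (cut_formula c').
  have Hsub s (R' : pre S) : (forall F', F' \in cut_shallow R' -> is_bin F'.1 = false) ->
      forall F', F' \in cut_shallow (psubst s R') -> is_bin F'.1 = false.
    move=> HR'; rewrite psubstE; apply: (cut_shallowP (R := fun A _ => is_bin A = false)).
    apply: mem_join_cuts => // P' c'; rewrite inE => /eqP -> /mapP[c'' Hc'' ->].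
    rewrite /cut_formula /= Sh_esubst is_bin_fsubst.
    exact: (HR' _ (mem_cut_shallow Hc'')).
  rewrite in_cons mem_cat => /or3P[/eqP ->|//|/mapP[i _ ->]].
    by move=> /Hno ->.
  by move=> /(Hsub _ _ (Hsub _ _ Hno)) ->.
have Hone : one_bin_cut (join (reduct N alpha l E P0)).
  apply: one_bin_join => R R' F F' HR HR' HF HF' hF hF'.
  exact: instance_cut_shallow (Hbin _ _ HR HF hF) (Hbin _ _ HR' HF' hF') HF HF'.
have Hg K : exists r, good K d [seq v <- V | v != fsem 0 rho (cut_formula c)] r
    (join (reduct N alpha l E P0)).
  exact: (reduct_good K HP Hok Hd Hb Hq Hmax Hdc HN).
have [H1 H2] := merge_instance Hraw Hholds Hone Hg HQ.
exists Q; split=> //; last first.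
  by move=> B; rewrite H2 reduct_Sh.
apply: (@step_quantifier S C1 C2 T A l l alpha E [seq shift_var N i | i <- iota 0 (size l)]).
- exact: perm_refl.
- by rewrite size_map size_iota.
- exact: shift_var_fresh.
- by rewrite reductE.
Qed.

Lemma exists_max (X : eqType) (p : pred X) (f : X -> nat) s :
  has p s -> exists x, [/\ x \in s, p x & forall y, y \in s -> p y -> f y <= f x].
Proof.
elim: s => //= x s IH; case: (boolP (has p s)) => [/IH[y [H1 H2 H3]] _|/hasPn H].
  case: (boolP (p x && (f y <= f x))) => [/andP[Hx Hle]|Hn].
    exists x; split; rewrite ?mem_head // => z; rewrite in_cons => /orP[/eqP ->//|Hz Hp].
    exact: leq_trans (H3 z Hz Hp) Hle.
  exists y; split; rewrite ?in_cons ?H1 ?orbT // => z /orP[/eqP -> Hp|]; last exact: H3.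
  by move: Hn; rewrite Hp -ltnNge => /ltnW.
rewrite orbF => Hx; exists x; split; rewrite ?mem_head // => z.
by rewrite in_cons => /orP[/eqP ->//|/H /negP].
Qed.

Lemma deep_cut_step S d V (P : pre S) :
  bounded_preproof d V P -> (forall c, c \in cuts P -> is_qua (cut_formula c)) ->
  has (fun c => qdepth (cut_formula c) == d) (cuts P) ->
  exists V' Q, [/\ size V' < size V, cut_step P Q, bounded_preproof d V' Q &
    pre_Sh Q =i pre_Sh P].
Proof.
move=> [HP Hh [r [Hok Hd Hb]]] Hq Hhas.
have [c [Hc /eqP Hdc Hmax]] := exists_max (fun c => vsize (fsem 0 r (cut_formula c))) Hhas.
have [_ /(_ c Hc)[TE TF Hp HD] _ _ _ _] := HP.
have HV : fsem 0 r (cut_formula c) \in V.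
  by case: (Hb _ (mem_cut_shallow Hc)) => [|[]] //=; rewrite Hdc ltnn.
have {}Hmax c' : c' \in cuts P -> qdepth (cut_formula c') = d ->
    vsize (fsem 0 r (cut_formula c')) <= vsize (fsem 0 r (cut_formula c)).
  by move=> H1 /eqP H2; exact: Hmax.
have [A [l [alpha [E Ec]]]] : exists A l alpha E, c = Cut (TEx A l) (TAll (dual A) alpha E).
  have := is_treeE TE; have := is_treeE TF; rewrite HD; have := Hq c Hc.
  move: Hp HD; case: c {Hc Hdc Hmax HV TE TF} => F G; rewrite /cut_formula /=.
  case: (Sh F) => // -[] // A _ _ _ /= [y [E ->]] [l ->].
  by exists A, l, y, E.
case: P HP Hh Hok Hd Hb Hq Hhas Hc Hmax => C T HP Hh Hok Hd Hb Hq Hhas Hc Hmax.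
rewrite /= in Hc; case/splitPr: Hc HP Hh Hok Hd Hb Hq Hmax {Hhas} => C1 C2 HP Hh Hok Hd Hb Hq Hmax.
subst c; have [Q [H1 H2 H3]] := quantifier_step HP Hh Hok Hd Hb Hq Hmax Hdc.
do 2!eexists; split; [|exact: H1|exact: H2|exact: H3].
rewrite size_filter -(count_predC (pred1 (fsem 0 r (Qua Ex A))) V) -[X in X < _]add0n.
by rewrite ltn_add2r -has_count has_pred1.
Qed.

Lemma eliminate_cuts S d V (P : pre S) :
  bounded_preproof d V P -> exists Q,
  [/\ expansion_proof Q, cut_free Q, pre_Sh P =i pre_Sh Q & cut_reduces P Q].
Proof.
elim: d V P => [|d IHd] V.
  move=> P /eliminate_propositional[Q [H1 [HQ Hh [r [Hok _ Hb]]] H3 H4]].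
  have Hf : cut_free Q.
    rewrite /cut_free; case EC: (cuts Q) => [//|c s].
    have Hc : c \in cuts Q by rewrite EC mem_head.
    have := H4 c Hc; case: (Hb _ (mem_cut_shallow Hc)) => [//|[/= + _ _]].
    by case: (cut_formula c).
  exists Q; split=> //; split=> //; last exact/tautologyE.
  exact: cut_free_acyclic Hf Hok.
have [n] := ubnP (size V); elim: n V => // n IHn V; rewrite ltnS => Hn P.
move=> /eliminate_propositional[Q [H1 HQ H3 H4]].
suff [R [K1 K2 K3 K4]] : exists R, [/\ expansion_proof R, cut_free R,
    pre_Sh Q =i pre_Sh R & cut_reduces Q R].
  exists R; split=> //; first by move=> A; rewrite -K3 H3.
  exact: rt_trans H1 K4.
case: (boolP (has (fun c => qdepth (cut_formula c) == d.+1) (cuts Q))) => [Hd|/hasPn Hd].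
  have [V' [R [K1 K2 K3 K4]]] := deep_cut_step HQ H4 Hd.
  have [R' [L1 L2 L3 L4]] := IHn V' (leq_trans K1 Hn) R K3.
  exists R'; split=> //; first by move=> A; rewrite -L3 K4.
  by apply: rt_trans L4; exact: rt_step.
case: HQ => G1 G2 [r [G3 G4 G5]].
apply: (IHd [seq fsem 0 r (cut_formula c) | c <- cuts Q]); split=> //; exists r; split=> //.
move=> _ /mapP[c Hc ->] /=; have := Hd c Hc.
case: (G5 _ (mem_cut_shallow Hc)) => [/= Hlt _|[/= -> _ _]]; last by rewrite eqxx.
move: Hlt; rewrite ltnS leq_eqVlt => /orP[/eqP E|]; last by left.
by right; split=> //; [exact: H4|exact: map_f].
Qed.

Theorem theorem32 (S : signature) (P : pre S) :
  expansion_proof P ->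
  exists P' : pre S,
    [/\ expansion_proof P', cut_free P', pre_Sh P =i pre_Sh P'
      & cut_reduces P P'].
Proof.
move=> [HP Hac /tautologyE Hh].
pose d := (sumn [seq qdepth (cut_formula c) | c <- cuts P]).+1.
apply: (@eliminate_cuts S d [::]); split=> //.
have [r Hok Hd] := solve VVar (ranked_system_dep (K := @untagged S) HP Hac)
  (eq_ind_r uniq (pp_eigenvars HP) (system_eigenvars_roots (@untagged S) P)).
exists r; split=> // [x Hx|_ /mapP[c Hc ->] /=].
  by apply: Hd; rewrite system_eigenvars_roots.
left; rewrite ltnS; elim: (cuts P) Hc => //= c' s IH; rewrite in_cons => /orP[/eqP ->|/IH H].
  exact: leq_addr.
exact: leq_trans H (leq_addl _ _).
Qed.
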